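(* Let $a,b$ be real numbers with $a>2$ and $b>1$. Then the integral packing of the polydisk $P(a,b)$ by $\{L(m,n)\}_{m,n\in\mathbb{N},\, m<a,\, n<b}$ is not maximal; that is, there exists an integral Lagrangian $L\subset P(a,b)$ such that $L\cap L(m,n)=\emptyset$ for all $m,n\in\mathbb{N}$ with $m<a$ and $n<b$.
   Context: $\mathbb{C}^2$ carries the standard symplectic form and $\mathbb{N}$ denotes the positive integers. For $a,b>0$, the Lagrangian product torus is $L(a,b):=\{(z_1,z_2)\in\mathbb{C}^2 : \pi|z_1|^2=a,\ \pi|z_2|^2=b\}$, and the polydisk is $P(a,b):=\{(z_1,z_2)\in\mathbb{C}^2 : \pi|z_1|^2<a,\ \pi|z_2|^2<b\}$ with the restricted symplectic form. Lagrangian submanifolds are embedded and closed (compact without boundary). An integral Lagrangian in a symplectic manifold $(X,\omega)$ is a Lagrangian submanifold $L$ such that the area homomorphism $H_2(X,L;\mathbb{Z})\to\mathbb{R}$ (integration of $\omega$) takes only integer values. For $m,n\in\mathbb{N}$ with $m<a$, $n<b$, the torus $L(m,n)$ is an integral Lagrangian in $P(a,b)$. The integral packing of $P(a,b)$ by $\{L(m,n)\}$ is called maximal if every integral Lagrangian $L\subset P(a,b)$ intersects some $L(m,n)$ with $m,n\in\mathbb{N}$, $m<a$, $n<b$. *)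

(* Defs.v *)
(* MathComp-Analysis *)
From HB Require Import structures.
From mathcomp Require Import all_boot all_order all_algebra.
From mathcomp Require Import all_classical all_reals all_analysis.

Set Implicit Arguments.
Unset Strict Implicit.
Unset Printing Implicit Defensive.

Import Order.TTheory GRing.Theory Num.Theory.
Import numFieldNormedType.Exports.

Local Open Scope classical_set_scope.
Local Open Scope ring_scope.

(* C^2 is 'rV[R]_4, with (z_1, z_2) = (x_1 + i y_1, x_2 + i y_2) stored as the
   row (x_1, y_1, x_2, y_2); the indices 2 and 3 below are elements of 'I_4. *)

(* pi * |z_1|^2 and pi * |z_2|^2 *)
Definition area1 (R : realType) (z : 'rV[R]_4) : R :=
  pi * (z 0 0 ^+ 2 + z 0 1 ^+ 2).
Definition area2 (R : realType) (z : 'rV[R]_4) : R :=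
  pi * (z 0 2 ^+ 2 + z 0 3 ^+ 2).

Definition product_torus (R : realType) (a b : R) : set 'rV[R]_4 :=
  [set z | area1 z = a /\ area2 z = b].

Definition polydisk (R : realType) (a b : R) : set 'rV[R]_4 :=
  [set z | area1 z < a /\ area2 z < b].

(* dx_1 /\ dy_1 + dx_2 /\ dy_2 *)
Definition omega (R : realType) (v w : 'rV[R]_4) : R :=
  (v 0 0 * w 0 1 - v 0 1 * w 0 0) + (v 0 2 * w 0 3 - v 0 3 * w 0 2).

Fixpoint iter_derive (R : realType) (m n : nat)
    (vs : seq 'rV[R]_m) (f : 'rV[R]_m -> 'rV[R]_n) : 'rV[R]_m -> 'rV[R]_n :=
  if vs is v :: vs' then 'D_v (iter_derive vs' f) else f.

(* C^oo for U open: the iterated directional derivatives of all orders exist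
   and are continuous on U. *)
Definition smooth_on (R : realType) (m n : nat)
    (U : set 'rV[R]_m) (f : 'rV[R]_m -> 'rV[R]_n) : Prop :=
  forall (vs : seq 'rV[R]_m) (x : 'rV[R]_m), U x ->
    {for x, continuous (iter_derive vs f)} /\
    forall v : 'rV[R]_m, derivable (iter_derive vs f) x v.

(* f is a smooth immersion of the open set U, and a homeomorphism from U onto
   an open neighbourhood of p in L (with inverse g). *)
Definition local_parametrization (R : realType) (L : set 'rV[R]_4)
    (p : 'rV[R]_4) (U : set 'rV[R]_2) (f : 'rV[R]_2 -> 'rV[R]_4) : Prop :=
  [/\ open U,
      smooth_on U f,
      forall u v : 'rV[R]_2, U u -> 'D_v f u = 0 -> v = 0 &
      exists W : set 'rV[R]_4,
        [/\ open W, W p, f @` U = L `&` W &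
            exists g : 'rV[R]_4 -> 'rV[R]_2,
              (forall u, U u -> g (f u) = u) /\
              {within L `&` W, continuous g}]].

(* A nonempty compact embedded surface without boundary on which omega
   vanishes: the tangent space of L at f u is the image of v |-> 'D_v f u. *)
Definition lagrangian (R : realType) (L : set 'rV[R]_4) : Prop :=
  [/\ L !=set0,
      compact L &
      forall p, L p ->
        exists (U : set 'rV[R]_2) (f : 'rV[R]_2 -> 'rV[R]_4),
          local_parametrization L p U f /\
          forall u v w : 'rV[R]_2, U u -> omega ('D_v f u) ('D_w f u) = 0].

Definition point2 (R : realType) (s t : R) : 'rV[R]_2 :=
  \row_j (if j == 0 then s else t).

(* Delta^2, with ordered vertices (0,0), (1,0), (0,1) *)
Definition simplex2 (R : realType) : set 'rV[R]_2 :=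
  [set u | [/\ 0 <= u 0 0, 0 <= u 0 1 & u 0 0 + u 0 1 <= 1]].

(* The parametrization by [0,1] of the face opposite to the i-th vertex *)
Definition face (R : realType) (i : 'I_3) (t : R) : 'rV[R]_2 :=
  if i == 0 then point2 (1 - t) t
  else if i == 1 then point2 0 t
  else point2 t 0.

Definition smooth_simplex (R : realType) (X : set 'rV[R]_4)
    (s : 'rV[R]_2 -> 'rV[R]_4) : Prop :=
  (exists U : set 'rV[R]_2,
     [/\ open U, @simplex2 R `<=` U & smooth_on U s]) /\
  s @` @simplex2 R `<=` X.

(* (k_1, s_1) :: ... :: (k_r, s_r) :: nil stands for the singular 2-chain
   k_1 s_1 + ... + k_r s_r. *)
Definition chain2 (R : realType) : Type :=
  seq (int * ('rV[R]_2 -> 'rV[R]_4)).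

(* The coefficient of the singular 1-simplex g (restricted to [0,1]) in the
   boundary of c *)
Definition boundary_coef (R : realType) (c : chain2 R)
    (g : R -> 'rV[R]_4) : int :=
  \sum_(x <- c) x.1 * \sum_(i < 3) (-1) ^+ i *
    `[< forall t : R, 0 <= t <= 1 -> x.2 (face i t) = g t >]%:R.

(* Smooth 2-chains in X whose boundary is a 1-chain in L, that is, the
   representatives of the classes in H_2(X, L; Z) *)
Definition relative_cycle (R : realType) (X L : set 'rV[R]_4)
    (c : chain2 R) : Prop :=
  (forall x, x \in c -> smooth_simplex X x.2) /\
  (forall g : R -> 'rV[R]_4,
     boundary_coef c g != 0 -> forall t : R, 0 <= t <= 1 -> L (g t)).

(* The integral over Delta^2 of the pullback of omega by s *)
Definition simplex_area (R : realType) (s : 'rV[R]_2 -> 'rV[R]_4) : R :=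
  \int[lebesgue_measure]_(x in `[0, 1])
    \int[lebesgue_measure]_(y in `[0, 1 - x])
      omega ('D_(point2 1 0) s (point2 x y)) ('D_(point2 0 1) s (point2 x y)).

Definition chain_area (R : realType) (c : chain2 R) : R :=
  \sum_(x <- c) x.1%:~R * simplex_area x.2.

(* For L Lagrangian, chain_area depends only on the class of c in
   H_2(X, L; Z), and every class has a smooth representative: the last clause
   says that the area homomorphism H_2(X, L; Z) -> R is integer-valued. *)
Definition integral_lagrangian (R : realType) (X L : set 'rV[R]_4) : Prop :=
  [/\ lagrangian L, L `<=` X &
      forall c : chain2 R, relative_cycle X L c -> chain_area c \is a Num.int].

Definition maximal_integral_packing (R : realType) (a b : R) : Prop :=
  forall L : set 'rV[R]_4, integral_lagrangian (polydisk a b) L ->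
    exists m n : nat,
      [/\ (0 < m)%N, (0 < n)%N, m%:R < a, n%:R < b &
          L `&` product_torus (m%:R : R) n%:R !=set0].

(* Main.v *)
Require Import Defs.
From mathcomp Require Import all_boot all_order all_algebra.
From mathcomp Require Import all_classical all_reals all_analysis.
From mathcomp Require Import ring lra.

(* In the coordinates A_i = pi |z_i|^2 and f_i = arg z_i, take a rounded
   rectangle C of area 1 in the cylinder of (A_1, f_1 / 2 pi): slightly longer
   than 1 <= A_1 <= 2 and winding almost once around. Use t = f_2 as a
   parameter and translate C by (sg cos t, - k sin t cos t) in (A_1, f_1). The
   moving curve sweeps out a Lagrangian torus once A_2 is a function of t minus
   the Hamiltonian generating the motion, and that function is chosen with mean
   1, so that both periods of A_1 df_1 + A_2 df_2 are 2 pi.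

   The translation in A_1 makes the curve meet A_1 = 2 only if cos t is
   positive or nearly so, and A_1 = 1 only if cos t is negative or nearly so.
   The term - k cos t of A_2 then gives A_2 < 1 in the first case and A_2 > 1 in
   the second, except near cos t = 0, where C moves between the two positions;
   there the rotation in f_1 contributes k cos(2 t) (A_1 - 3/2) to A_2, which has
   the right sign at both ends. All excursions beyond A_1 = 2 and A_2 = 1 are
   O(k).

   Integrality: by Stokes the area of a relative cycle is the sum of the
   integrals of the Liouville form x_1 dy_1 + x_2 dy_2 along its boundary paths,
   and along a path in the torus this integral is the increment of a potential
   that is well defined modulo integers. *)

Set Implicit Arguments.
Unset Strict Implicit.
Unset Printing Implicit Defensive.

Import Order.TTheory GRing.Theory Num.Theory.
Import numFieldNormedType.Exports.

Local Open Scope classical_set_scope.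
Local Open Scope ring_scope.

(** * C^k functions *)

Section Ck.
Context {R : realType} {V : normedModType R}.

(** The annulus [1 < A_1 < 2] has area exactly 1, so a closed disc of area 1 bounded by an embedded
    curve does not fit inside it: C has to protrude at one end. While C passes from one end to the
    other it meets [A_1 = 1] and [A_1 = 2] at the same [t]. There [A_2] must be larger than 1 at one
    crossing and smaller at the other, which no function of [t] alone achieves. This is the reason
    for the rotation in [f_1]: its Hamiltonian is linear in [A_1].

    The translation in [A_1] has the angle [f_1] as Hamiltonian, up to a factor. It is multivalued
    on the cylinder but single-valued along C, because C does not wind around. Its contribution to
    [A_2] has no useful sign, so [sg] is a small multiple of [k] and this term stays below the
    others.

    Winding less than once ([Q < 1 / 2]) is also what makes the torus embedded. At area 1 it forces
    the length of C in the [A_1] direction above 1 by an amount paying for the rounded corners as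
    well; this excess is kept below [sg / 5], so that both ends are crossed only when [cos t] is
    nearly 0. *)

Fixpoint Ck {W : normedModType R} (U : set V) (k : nat) (f : V -> W) : Prop :=
  (forall x, U x -> {for x, continuous f}) /\
  (if k is k'.+1 then
     (forall x v, U x -> derivable f x v) /\ forall v, Ck U k' ('D_v f)
   else True).

Lemma CkW (W : normedModType R) U k (f : V -> W) : Ck U k.+1 f -> Ck U k f.
Proof.
elim: k f => [|k IH] f /=; first by case.
move=> [cf [df Df]]; split => //; split => // v; exact/IH/Df.
Qed.

Lemma Ck_derive (W : normedModType R) U k (f : V -> W) v :
  Ck U k.+1 f -> Ck U k ('D_v f).
Proof. by case=> _ [_ ]; exact. Qed.

(** Since [U] is open, agreement on [U] is agreement near each of its points, so the derivatives
    agree too. The closure lemmas below use this to replace ['D_v] of a compound function by its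
    explicit formula before applying the induction hypothesis. *)
Lemma Ck_eq (W : normedModType R) (U : set V) k (f g : V -> W) :
  open U -> (forall x, U x -> f x = g x) -> Ck U k f -> Ck U k g.
Proof.
move=> oU.
have nE (a b : V -> W) x : (forall x, U x -> a x = b x) -> U x ->
    \forall y \near x, a y = b y.
  move=> ab Ux; have : nbhs x U by exact: open_nbhs_nbhs.
  by apply: filterS => y; exact: ab.
elim: k f g => [|k IH] f g fg [cf H].
  split => // x Ux; rewrite /prop_for /continuous_at -fg//.
  apply: cvg_trans (cf x Ux); apply: near_eq_cvg.
  exact: (nE f g).
split.
  move=> x Ux; rewrite /prop_for /continuous_at -fg//.
  by apply: cvg_trans (cf x Ux); apply: near_eq_cvg; exact: (nE f g).
case: H => df Df; split.
  by move=> x v Ux; apply: near_eq_derivable (df x v Ux); exact: nE.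
move=> v; apply: (IH ('D_v f)); last exact: Df.
by move=> x Ux; apply: near_eq_derive; exact: nE.
Qed.

Lemma Ck_cst (W : normedModType R) (U : set V) k (c : W) : Ck U k (cst c).
Proof.
elim: k c => [|k IH] c; first by split => // x _; exact: cvg_cst.
split; first by move=> x _; exact: cvg_cst.
split => [x v _|v]; first exact: derivable_cst.
have -> : 'D_v (cst c) = cst (0 : W).
  by apply/funext => x; rewrite derive_cst.
exact: IH.
Qed.

Lemma Ck_add (W : normedModType R) (U : set V) k (f g : V -> W) :
  open U -> Ck U k f -> Ck U k g -> Ck U k (fun x => f x + g x).
Proof.
move=> oU; elim: k f g => [|k IH] f g [cf Hf] [cg Hg].
  by split => // x Ux; apply: cvgD; [exact: cf|exact: cg].
split; first by move=> x Ux; apply: cvgD; [exact: cf|exact: cg].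
case: Hf => df Df; case: Hg => dg Dg; split.
  by move=> x v Ux; exact: derivableD (df _ _ Ux) (dg _ _ Ux).
move=> v; apply: Ck_eq (IH _ _ (Df v) (Dg v)) => // x Ux.
by rewrite -deriveD//; [exact: df|exact: dg].
Qed.

Lemma Ck_opp (W : normedModType R) (U : set V) k (f : V -> W) :
  open U -> Ck U k f -> Ck U k (fun x => - f x).
Proof.
move=> oU; elim: k f => [|k IH] f [cf Hf].
  by split => // x Ux; apply: cvgN; exact: cf.
split; first by move=> x Ux; apply: cvgN; exact: cf.
case: Hf => df Df; split.
  by move=> x v Ux; exact: derivableN (df _ _ Ux).
move=> v; apply: Ck_eq (IH _ (Df v)) => // x Ux.
by rewrite -deriveN//; exact: df.
Qed.

Lemma Ck_mul (U : set V) k (f g : V -> R) :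
  open U -> Ck U k f -> Ck U k g -> Ck U k (fun x => f x * g x).
Proof.
move=> oU; elim: k f g => [|k IH] f g Hf Hg.
  split => // x Ux; apply: cvgM; [exact: Hf.1|exact: Hg.1].
split; first by move=> x Ux; apply: cvgM; [exact: Hf.1|exact: Hg.1].
split.
  by move=> x v Ux; exact: derivableM (Hf.2.1 _ _ Ux) (Hg.2.1 _ _ Ux).
move=> v.
have H : Ck U k (fun x => f x * 'D_v g x + g x * 'D_v f x).
  apply: Ck_add => //; apply: IH => //; do ?exact: CkW.
  - exact: Ck_derive.
  - exact: Ck_derive.
apply: Ck_eq H => // x Ux.
rewrite -[fun x => _]/(f * g) deriveM//; first exact: Hf.2.1.
exact: Hg.2.1.
Qed.

Lemma Ck_scale (W : normedModType R) (U : set V) k (c : R) (f : V -> W) :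
  open U -> Ck U k f -> Ck U k (fun x => c *: f x).
Proof.
move=> oU; elim: k f => [|k IH] f [cf Hf].
  by split => // x Ux; apply: cvgZl_tmp; exact: cf.
split; first by move=> x Ux; apply: cvgZl_tmp; exact: cf.
case: Hf => df Df; split.
  by move=> x v Ux; exact: derivableZ (df _ _ Ux).
move=> v; apply: Ck_eq (IH _ (Df v)) => // x Ux.
by rewrite -deriveZ//; exact: df.
Qed.

Lemma derive_line (W : normedModType R) (f : V -> W) x v :
  'D_v f x = 'D_1 (fun h : R => f (h *: v + x)) 0.
Proof.
rewrite /derive; set g1 := fun h => h^-1 *: _; set g2 := fun h => h^-1 *: _.
suff -> : g1 = g2 by [].
by rewrite funeqE /g1 /g2 => h /=; rewrite addr0 scale0r add0r [_%:A]mulr1.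
Qed.

(** Only derivability of [f] in the single direction [v] is assumed: restricted to the line through
    [x], this is the one-variable chain rule. *)
Lemma is_derive_comp1 (f : V -> R) (phi : R -> R) (x v : V) (df dphi : R) :
  is_derive x v f df -> is_derive (f x) 1 phi dphi ->
  is_derive x v (fun y => phi (f y)) (dphi * df).
Proof.
move=> Hf Hphi.
pose F := fun h : R => f (h *: v + x).
have dF : derivable F 0 1 by case: Hf => /derivable1P + _; exact.
have F0 : F 0 = f x by rewrite /F scale0r add0r.
have DF : is_derive (0 : R) 1 F df.
  by split => //; rewrite -derive_line; case: Hf.
have Hphi' : is_derive (F 0) 1 phi dphi by rewrite F0.
have [E D] := is_derive1_comp Hphi' DF.
split; first by apply/derivable1P; exact: E.
by rewrite derive_line -D.
Qed.

Lemma Ck_inv (U : set V) k (f : V -> R) : open U ->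
  (forall x, U x -> f x != 0) -> Ck U k f -> Ck U k (fun x => (f x)^-1).
Proof.
move=> oU f0; elim: k f f0 => [|k IH] f f0 Hf.
  by split => // x Ux; apply: cvgV; [exact: f0|exact: Hf.1].
split; first by move=> x Ux; apply: cvgV; [exact: f0|exact: Hf.1].
split=> [x v Ux|v]; first exact: derivableV (f0 _ Ux) (Hf.2.1 _ _ Ux).
have Hi : Ck U k (fun x => (f x)^-1) by apply: IH => //; exact: CkW.
have H : Ck U k (fun x => - ((f x)^-1 * (f x)^-1 * 'D_v f x)).
  apply: Ck_opp => //; apply: Ck_mul => //; last exact: Ck_derive.
  exact: Ck_mul.
apply: Ck_eq H => // x Ux.
have -> : 'D_v (fun x => (f x)^-1) x = - (f x) ^- 2 *: 'D_v f x.
  by apply: deriveV; [exact: f0|exact: Hf.2.1].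
by rewrite -mulNr -invfM -expr2.
Qed.

Lemma Ck_sqrt (U : set V) k (f : V -> R) : open U ->
  (forall x, U x -> 0 < f x) -> Ck U k f -> Ck U k (fun x => Num.sqrt (f x)).
Proof.
move=> oU f0; elim: k f f0 => [|k IH] f f0 Hf.
  split => // x Ux.
  by apply: (@cvg_comp _ _ _ f (@Num.sqrt R)); [exact: Hf.1|exact: sqrt_continuous].
have D x v : U x ->
    is_derive x v (fun x => Num.sqrt (f x)) ((2 * Num.sqrt (f x))^-1 * 'D_v f x).
  move=> Ux; apply: is_derive_comp1; first by apply/derivableP/Hf.2.1.
  by apply: is_derive1_sqrt; exact: f0.
split.
  move=> x Ux.
  by apply: (@cvg_comp _ _ _ f (@Num.sqrt R)); [exact: Hf.1|exact: sqrt_continuous].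
split=> [x v Ux|v]; first by case: (D x v Ux).
have H : Ck U k (fun x => (2 * Num.sqrt (f x))^-1 * 'D_v f x).
  apply: Ck_mul => //; last exact: Ck_derive.
  apply: Ck_inv => //.
    by move=> x Ux; rewrite mulf_neq0// gt_eqF// sqrtr_gt0 f0.
  apply: (@Ck_scale _) => //; apply: IH => //; exact: CkW.
by apply: Ck_eq H => // x Ux; case: (D x v Ux).
Qed.

(** The two claims form one induction because each derivative involves the other function. *)
Lemma Ck_cos_sin (U : set V) k (f : V -> R) : open U -> Ck U k f ->
  Ck U k (fun x => cos (f x)) /\ Ck U k (fun x => sin (f x)).
Proof.
move=> oU; elim: k f => [|k IH] f Hf.
  split; split => // x Ux.
    by apply: (@cvg_comp _ _ _ f (@cos R)); [exact: Hf.1|exact: continuous_cos].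
  by apply: (@cvg_comp _ _ _ f (@sin R)); [exact: Hf.1|exact: continuous_sin].
have [Hc Hs] := IH f (CkW Hf).
have Dc x v : U x -> is_derive x v (fun x => cos (f x)) (- sin (f x) * 'D_v f x).
  by move=> Ux; apply: is_derive_comp1; apply/derivableP/Hf.2.1.
have Ds x v : U x -> is_derive x v (fun x => sin (f x)) (cos (f x) * 'D_v f x).
  by move=> Ux; apply: is_derive_comp1; apply/derivableP/Hf.2.1.
split; split.
- move=> x Ux.
  by apply: (@cvg_comp _ _ _ f (@cos R)); [exact: Hf.1|exact: continuous_cos].
- split=> [x v Ux|v]; first by case: (Dc x v Ux).
  have H : Ck U k (fun x => - sin (f x) * 'D_v f x).
    by apply: Ck_mul => //; [exact: Ck_opp|exact: Ck_derive].
  by apply: Ck_eq H => // x Ux; case: (Dc x v Ux).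
- move=> x Ux.
  by apply: (@cvg_comp _ _ _ f (@sin R)); [exact: Hf.1|exact: continuous_sin].
- split=> [x v Ux|v]; first by case: (Ds x v Ux).
  have H : Ck U k (fun x => cos (f x) * 'D_v f x).
    by apply: Ck_mul => //; exact: Ck_derive.
  by apply: Ck_eq H => // x Ux; case: (Ds x v Ux).
Qed.

Lemma Ck_mxP (m n : nat) (U : set V) k (f : V -> 'M[R]_(m, n)) : open U ->
  Ck U k f <-> forall i j, Ck U k (fun x => f x i j).
Proof.
move=> oU.
have C (g : V -> 'M[R]_(m, n)) x :
    {for x, continuous g} <-> forall i j, {for x, continuous (fun x => g x i j)}.
  split=> [cg i j|cg].
    by apply: (@cvg_comp _ _ _ g (fun M : 'M[R]_(m, n) => M i j));
      [exact: cg|exact: coord_continuous].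
  apply/cvgrPdist_lt => e e0; near=> y.
  rewrite /Num.Def.normr/= mx_normrE; apply: bigmax_lt => // -[i j] _.
  rewrite !mxE/=; move: i j; near: y.
  apply: filter_forall => i; apply: filter_forall => j.
  by move/cvgrPdist_lt : (cg i j); apply.
elim: k f => [|k IH] f.
  split=> [[cf _] i j|H].
    by split=> // x Ux; move: i j; apply/(C f x)/cf.
  by split=> // x Ux; apply/C => i j; exact: (H i j).1.
split=> [Hf i j|H].
  split; first by move=> x Ux; move: i j; apply/(C f x)/Hf.1.
  split=> [x v Ux|v].
    by move: i j; apply/derivable_mxP; exact: Hf.2.1.
  have := (IH ('D_v f)).1 (Hf.2.2 v) i j.
  apply: Ck_eq => // x Ux; rewrite derive_mx ?mxE//.
  exact: Hf.2.1.
have df x v : U x -> derivable f x v.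
  by move=> Ux; apply/derivable_mxP => i j; exact: (H i j).2.1.
split; first by move=> x Ux; apply/C => i j; exact: (H i j).1.
split=> // v; apply/IH => i j.
have := (H i j).2.2 v; apply: Ck_eq => // x Ux.
by rewrite derive_mx ?mxE//; exact: df.
Unshelve. all: by end_near. Qed.

End Ck.

Lemma is_derive_coord (R : realType) (n : nat) (u v : 'rV[R]_n) j :
  is_derive u v (fun u : 'rV[R]_n => u 0 j) (v 0 j).
Proof.
have D0 : derivable (@id 'rV[R]_n) u v by exact: derivable_id.
apply: DeriveDef; first exact: (derivable_mxP _ _ _).1 D0 0 j.
have /(congr1 (fun M : 'rV[R]_n => M 0 j)) := derive_mx D0.
by rewrite derive_id mxE.
Qed.

Lemma Ck_coord (R : realType) (n : nat) (U : set 'rV[R]_n) k j :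
  Ck U k (fun u : 'rV[R]_n => u 0 j).
Proof.
have D (x v : 'rV[R]_n) := is_derive_coord x v j.
case: k => [|k]; split => //; try by move=> x _; exact: coord_continuous.
split => [x v _|v]; first by case: (D x v).
have -> : 'D_v (fun u : 'rV[R]_n => u 0 j) = cst (v 0 j).
  by apply/funext => x; case: (D x v).
exact: Ck_cst.
Qed.

(** [smooth_on] quantifies over lists of directions, whereas [Ck] recurses on the order and
    therefore supports the inductive closure properties above. The list adds derivatives at its head
    and [Ck] peels off the innermost one first, hence the induction on [rcons]. *)
Lemma smooth_onP (R : realType) (m n : nat) (U : set 'rV[R]_m)
    (f : 'rV[R]_m -> 'rV[R]_n) :
  smooth_on U f <-> forall k, Ck U k f.
Proof.
have iter_cat vs v (g : 'rV[R]_m -> 'rV[R]_n) :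
    iter_derive (rcons vs v) g = iter_derive vs ('D_v g).
  by elim: vs => //= w vs ->.
split.
  move=> H k; elim: k f H => [|k IH] f H.
    by split => // x Ux; exact: (H [::] x Ux).1.
  split; first by move=> x Ux; exact: (H [::] x Ux).1.
  split=> [x v Ux|v]; first exact: (H [::] x Ux).2.
  by apply: IH => vs x Ux; rewrite -iter_cat; exact: H.
move=> H vs x Ux.
have {H} := H (size vs).+1; elim/last_ind: vs f => [|vs v IH] f H.
  by split; [exact: H.1|move=> v; exact: H.2.1].
rewrite iter_cat; apply: IH.
by move: H; rewrite size_rcons => H; exact: H.2.2.
Qed.

(** * Real functions of two variables *)

Section TwoVariables.
Context {R : realType}.

Lemma mvt_bound (phi dphi : R -> R) (a c e : R) :
  (forall t : R, `|t| <= `|a| -> is_derive t 1 phi (dphi t) /\ `|dphi t - c| <= e) ->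
  `|phi a - phi 0 - c * a| <= e * `|a|.
Proof.
move=> H.
have cphi t : `|t| <= `|a| -> {for t, continuous phi}.
  by move=> /H[[dt _] _]; apply/differentiable_continuous/derivable1_diffP.
have [a0|a0|->] := ltgtP a 0; last first.
- by rewrite subrr mulr0 subr0 normr0 mulr0.
- have sub t : t \in `[0, a] -> `|t| <= `|a|.
    by rewrite in_itv/= => /andP[t0 ta]; rewrite ger0_norm// gtr0_norm.
  have [|/=|t ta] := @MVT _ phi dphi 0 a a0.
  + by move=> t /subset_itv_oo_cc/sub/H[].
  + by apply: continuous_in_subspaceT => t /[!inE] /sub/cphi.
  + rewrite subr0 => ->; rewrite -mulrBl normrM ler_wpM2r//.
    by have /subset_itv_oo_cc/sub/H[] := ta.
- have sub t : t \in `[a, 0] -> `|t| <= `|a|.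
    by rewrite in_itv/= => /andP[ta t0]; rewrite ler0_norm// ltr0_norm// lerN2.
  have [|/=|t ta] := @MVT _ phi dphi a 0 a0.
  + by move=> t /subset_itv_oo_cc/sub/H[].
  + by apply: continuous_in_subspaceT => t /[!inE] /sub/cphi.
  + rewrite sub0r => E.
    have -> : phi a - phi 0 - c * a = (dphi t - c) * a.
      by rewrite -[phi a - phi 0]opprB E; ring.
    by rewrite normrM ler_wpM2r//; have /subset_itv_oo_cc/sub/H[] := ta.
Qed.

Lemma is_derive_line (V W : normedModType R) (f : V -> W) (y v : V) (t : R) :
  derivable f (y + t *: v) v ->
  is_derive t 1 (fun s : R => f (y + s *: v)) ('D_v f (y + t *: v)).
Proof.
move=> df.
have E : (fun h : R => f (y + (h *: (1 : R) + t) *: v)) =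
         (fun h : R => f (h *: v + (y + t *: v))).
  by apply/funext => h; congr f; rewrite [h *: 1]mulr1 scalerDl addrCA.
split.
  by apply/derivable1P; rewrite E -derivable1P.
by rewrite derive_line E -derive_line.
Qed.

Local Notation e0 := (@point2 R 1 0).
Local Notation e1 := (@point2 R 0 1).

Lemma point2E (h : 'rV[R]_2) : h = h 0 0 *: e0 + h 0 1 *: e1.
Proof.
apply/rowP => j; rewrite !mxE.
case: j => [[|[|//]] Hj] /=; rewrite ?mulr1 ?mulr0 ?addr0 ?add0r; congr (h _ _);
  exact: val_inj.
Qed.

Lemma norm_coord (h : 'rV[R]_2) j : `|h 0 j| <= `|h|.
Proof.
by rewrite [leRHS]/Num.Def.normr/= mx_normrE; exact: (le_bigmax _ _ (0, j)).
Qed.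

Lemma norm_point2 (s t e : R) : `|s| <= e -> `|t| <= e -> `|point2 s t| <= e.
Proof.
move=> se te; rewrite [leLHS]/Num.Def.normr/= mx_normrE.
apply: bigmax_le; first exact: le_trans se.
by move=> [i j] _; rewrite mxE/=; case: ifP.
Qed.

Lemma norm_combination (s t : R) : `|s *: e0 + t *: e1| <= Num.max `|s| `|t|.
Proof.
have -> : s *: e0 + t *: e1 = point2 s t.
  apply/rowP => j; rewrite !mxE.
  by case: ifP => _; rewrite ?mulr1 ?mulr0 ?addr0 ?add0r.
by apply: norm_point2; rewrite le_max lexx ?orbT.
Qed.

(** Continuous partial derivatives give an expansion uniform in the direction of [h]: one goes from
    [x] to [x + h] by a step along [e1] followed by a step along [e0], and [mvt_bound] costs [e / 2]
    times the norm of [h] on each. *)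
Lemma C1_expansion (U : set 'rV[R]_2) (f : 'rV[R]_2 -> R) x (e : R) :
  open U -> Ck U 1 f -> U x -> 0 < e ->
  exists2 d : R, 0 < d & forall h, `|h| < d ->
    `|f (x + h) - f x - (h 0 0 * 'D_e0 f x + h 0 1 * 'D_e1 f x)| <= e * `|h|.
Proof.
move=> oU Hf Ux e_gt0.
have e2 : 0 < e / 2 by rewrite divr_gt0.
have cont v : {for x, continuous ('D_v f)} by exact: (Hf.2.2 v).1.
have /cvgrPdist_lt/(_ _ e2) c0 := cont e0.
have /cvgrPdist_lt/(_ _ e2) c1 := cont e1.
have near_x : \forall y \near x, [/\ U y, `|'D_e0 f x - 'D_e0 f y| < e / 2 &
    `|'D_e1 f x - 'D_e1 f y| < e / 2].
  have nU : nbhs x U by exact: open_nbhs_nbhs.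
  apply: filterS (filterI nU (filterI c0 c1)) => y /= [Uy [y0 y1]].
  exact: (And3 Uy y0 y1).
have [d /= d0 Hd] := (nbhs_normP _ _).1 near_x.
exists d => // h hd.
have inU h' : `|h'| < d -> [/\ U (x + h'), `|'D_e0 f x - 'D_e0 f (x + h')| < e / 2 &
    `|'D_e1 f x - 'D_e1 f (x + h')| < e / 2].
  by move=> h'd; apply: Hd; rewrite /ball_ /= opprD addNKr normrN.
have sm s t : `|s| <= `|h 0 0| -> `|t| <= `|h 0 1| -> `|s *: e0 + t *: e1| < d.
  move=> sh th; apply: le_lt_trans (norm_combination _ _) _.
  rewrite gt_max; apply/andP; split; apply: le_lt_trans hd.
    exact: le_trans sh (norm_coord _ _).
  exact: le_trans th (norm_coord _ _).
pose a := h 0 0; pose b := h 0 1.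
have Ha := @mvt_bound (fun s => f (x + b *: e1 + s *: e0))
  (fun s => 'D_e0 f (x + b *: e1 + s *: e0)) a ('D_e0 f x) (e / 2).
have Hb := @mvt_bound (fun s => f (x + s *: e1))
  (fun s => 'D_e1 f (x + s *: e1)) b ('D_e1 f x) (e / 2).
have {}Ha : `|f (x + h) - f (x + b *: e1) - 'D_e0 f x * a| <= e / 2 * `|h|.
  have Ea : x + h = x + b *: e1 + a *: e0.
    by rewrite {1}[h]point2E -/a -/b -addrA [b *: _ + _]addrC.
  rewrite Ea; move: Ha; rewrite /= scale0r addr0 => Ha.
  apply: le_trans (Ha _) _ => [t ta|]; last first.
    by apply: ler_wpM2l; [exact: ltW|exact: norm_coord].
  have Et : x + (t *: e0 + b *: e1) = x + b *: e1 + t *: e0.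
    by rewrite [t *: _ + _]addrC addrA.
  have := inU _ (sm t b ta (lexx _)); rewrite Et => -[Ut U0 _].
  split; last by rewrite distrC ltW.
  by apply: is_derive_line; exact: Hf.2.1.
have {}Hb : `|f (x + b *: e1) - f x - 'D_e1 f x * b| <= e / 2 * `|h|.
  move: Hb; rewrite /= scale0r addr0 => Hb.
  apply: le_trans (Hb _) _ => [t tb|]; last first.
    by apply: ler_wpM2l; [exact: ltW|exact: norm_coord].
  have := inU _ (sm 0 t _ tb); rewrite normr0 normr_ge0 scale0r add0r => -[]// Ut _ U1.
  split; last by rewrite distrC ltW.
  by apply: is_derive_line; exact: Hf.2.1.
have -> : f (x + h) - f x - (h 0 0 * 'D_e0 f x + h 0 1 * 'D_e1 f x) =
  (f (x + h) - f (x + b *: e1) - 'D_e0 f x * a) +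
  (f (x + b *: e1) - f x - 'D_e1 f x * b) by rewrite -/a -/b; ring.
by rewrite [e]splitr mulrDl; apply: le_trans (ler_normD _ _) (lerD _ _).
Unshelve. all: by end_near. Qed.

(** Linearity in the direction is not built into [Ck], which treats each direction separately; it is
    obtained by applying the uniform expansion to the increments [t *: v]. *)
Lemma C1_derive_linear (U : set 'rV[R]_2) (f : 'rV[R]_2 -> R) x v :
  open U -> Ck U 1 f -> U x ->
  'D_v f x = v 0 0 * 'D_e0 f x + v 0 1 * 'D_e1 f x.
Proof.
move=> oU Hf Ux; set l := RHS.
apply/cvg_lim => //; apply/cvgrPdist_le => e e_gt0.
have e'0 : 0 < e / (`|v| + 1) by rewrite divr_gt0// ltr_wpDl.
have [d d0 Hd] := C1_expansion oU Hf Ux e'0.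
near=> t.
have t0 : t != 0 by near: t; exact: nbhs_dnbhs_neq.
have td : `|t *: v| < d.
  rewrite normrZ.
  apply: (@le_lt_trans _ _ (`|t| * (`|v| + 1))).
    by rewrite ler_wpM2l// lerDl.
  rewrite -ltr_pdivlMr ?ltr_wpDl//.
  by near: t; apply: dnbhs0_lt; rewrite divr_gt0// ltr_wpDl.
have := Hd _ td; rewrite !mxE.
have -> : t * v 0 0 * 'D_e0 f x + t * v 0 1 * 'D_e1 f x = t * l.
  by rewrite /l mulrDr !mulrA.
move=> H /=.
have -> : l - t^-1 *: (f (t *: v + x) - f x) =
    - (t^-1 * (f (x + t *: v) - f x - t * l)).
  rewrite [t *: v + x]addrC -[t^-1 *: _]/(t^-1 * _).
  have -> // : forall p q m : R, m - t^-1 * (p - q) = - (t^-1 * (p - q - t * m)).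
  by move=> p q m; field.
rewrite normrN normrM normfV mulrC ler_pdivrMr ?normr_gt0//.
apply: le_trans H _; rewrite normrZ mulrCA [leRHS]mulrC ler_wpM2l//.
by rewrite mulrAC ler_pdivrMr ?ltr_wpDl// ler_pM2l// lerDl.
Unshelve. all: by end_near. Qed.

(** The second difference is an increment of [g], so the mean value theorem in the direction [v]
    turns it into a difference of ['D_v f], and a second application in the direction [w] produces
    the mixed derivative. *)
Lemma mixed_difference (U : set 'rV[R]_2) (f : 'rV[R]_2 -> R) x v w (t : R) :
  Ck U 2 f -> 0 < t ->
  (forall a b : R, 0 <= a <= t -> 0 <= b <= t -> U (x + a *: v + b *: w)) ->
  exists a b : R, [/\ 0 <= a <= t, 0 <= b <= t &
   f (x + t *: v + t *: w) - f (x + t *: v) - f (x + t *: w) + f x =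
   t ^+ 2 * 'D_w ('D_v f) (x + a *: v + b *: w)].
Proof.
move=> Hf t0 HU.
have t00 : 0 <= (0 : R) <= t by rewrite lexx ltW.
have HU0 a : 0 <= a <= t -> U (x + a *: v).
  by move=> at0; have := HU a 0 at0 t00; rewrite scale0r addr0.
pose g s := f (x + s *: v + t *: w) - f (x + s *: v).
have dg s : 0 <= s <= t -> is_derive s 1 g
    ('D_v f (x + s *: v + t *: w) - 'D_v f (x + s *: v)).
  move=> st; apply: is_deriveB; last by apply: is_derive_line; exact/Hf.2.1/HU0.
  rewrite [fun s => _](_ : _ = fun s => f (x + t *: w + s *: v)); last first.
    by apply/funext => s'; rewrite addrAC.
  rewrite addrAC; apply: is_derive_line; apply: Hf.2.1; rewrite addrAC.
  by apply: HU => //; rewrite lexx ltW.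
have [|/=|a at0 ga] := MVT t0 (f := g) (df := fun s =>
    'D_v f (x + s *: v + t *: w) - 'D_v f (x + s *: v)).
- by move=> s /subset_itv_oo_cc; rewrite in_itv/= => /dg.
- apply: continuous_in_subspaceT => s /[!inE] /=; rewrite in_itv/= => /dg[ds _].
  exact/differentiable_continuous/derivable1_diffP.
have {}at0 : 0 <= a <= t by move/subset_itv_oo_cc : at0; rewrite in_itv.
pose k s := 'D_v f (x + a *: v + s *: w).
have dk s : 0 <= s <= t -> is_derive s 1 k ('D_w ('D_v f) (x + a *: v + s *: w)).
  by move=> st; apply: is_derive_line; apply: (Hf.2.2 v).2.1; exact: HU.
have [|/=|b bt kb] := MVT t0 (f := k) (df := fun s =>
    'D_w ('D_v f) (x + a *: v + s *: w)).
- by move=> s /subset_itv_oo_cc; rewrite in_itv/= => /dk.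
- apply: continuous_in_subspaceT => s /[!inE] /=; rewrite in_itv/= => /dk[ds _].
  exact/differentiable_continuous/derivable1_diffP.
exists a, b; split => //.
  by move/subset_itv_oo_cc : bt; rewrite in_itv.
move: ga kb; rewrite /g /k !subr0 !scale0r !addr0 => ga kb.
by rewrite [RHS]mulrC expr2 mulrA -kb -ga opprB addrA addrAC.
Qed.

(** The second difference is symmetric in [v] and [w]. Evaluating it in both orders equates the two
    mixed derivatives at two points near [x], and continuity brings them to [x]. *)
Lemma derive_comm (U : set 'rV[R]_2) (f : 'rV[R]_2 -> R) x v w :
  open U -> Ck U 2 f -> U x -> 'D_v ('D_w f) x = 'D_w ('D_v f) x.
Proof.
move=> oU Hf Ux.
apply/eqP; rewrite -subr_eq0 -normr_le0; apply/ler_addgt0Pr => e e0; rewrite add0r.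
have e2 : 0 < e / 2 by rewrite divr_gt0.
have cont a b : {for x, continuous ('D_a ('D_b f))}.
  by exact: ((Hf.2.2 b).2.2 a).1.
have /cvgrPdist_lt/(_ _ e2) c0 := cont v w.
have /cvgrPdist_lt/(_ _ e2) c1 := cont w v.
have near_x : \forall y \near x, [/\ U y, `|'D_v ('D_w f) x - 'D_v ('D_w f) y| < e / 2 &
    `|'D_w ('D_v f) x - 'D_w ('D_v f) y| < e / 2].
  have nU : nbhs x U by exact: open_nbhs_nbhs.
  apply: filterS (filterI nU (filterI c0 c1)) => y /= [Uy [y0 y1]].
  exact: (And3 Uy y0 y1).
have [d /= d0 Hd] := (nbhs_normP _ _).1 near_x.
have vw : 0 < `|v| + `|w| + 1 by rewrite ltr_wpDl// addr_ge0.
have [t t0 td] : exists2 t : R, 0 < t & t * (`|v| + `|w| + 1) < d.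
  exists (d / (2 * (`|v| + `|w| + 1))); first by rewrite divr_gt0// mulr_gt0.
  rewrite invfM mulrA divfK ?gt_eqF//; lra.
have inU a b : 0 <= a <= t -> 0 <= b <= t ->
    [/\ U (x + a *: v + b *: w),
     `|'D_v ('D_w f) x - 'D_v ('D_w f) (x + a *: v + b *: w)| < e / 2 &
     `|'D_w ('D_v f) x - 'D_w ('D_v f) (x + a *: v + b *: w)| < e / 2].
  move=> /andP[a0 ta] /andP[b0 tb]; apply: Hd; rewrite /ball_ /= -addrA opprD addNKr normrN.
  apply: le_lt_trans td.
  apply: le_trans (ler_normD _ _) _; rewrite !normrZ (ger0_norm a0) (ger0_norm b0).
  rewrite !mulrDr mulr1 -[leLHS]addr0; apply: lerD; last exact: ltW.
  by apply: lerD; rewrite ler_wpM2r.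
have [|a [b [at0 bt0 E1]]] := @mixed_difference U f x v w t Hf t0.
  by move=> a b at0 bt0; have [] := inU _ _ at0 bt0.
have [|a' [b' [at0' bt0' E2]]] := @mixed_difference U f x w v t Hf t0.
  by move=> a' b' at0' bt0'; rewrite addrAC; have [] := inU _ _ bt0' at0'.
have E : 'D_w ('D_v f) (x + a *: v + b *: w) = 'D_v ('D_w f) (x + b' *: v + a' *: w).
  apply: (@mulfI _ (t ^+ 2)); first by rewrite expf_neq0// gt_eqF.
  have C1 : x + a' *: w + b' *: v = x + b' *: v + a' *: w by exact: addrAC.
  apply: etrans (esym E1) _; apply: etrans (etrans _ E2) _.
    rewrite [x + t *: w + t *: v]addrAC; congr (_ + _); exact: addrAC.
  by congr (_ * 'D_v ('D_w f) _).
have [_ _ H1] := inU _ _ at0 bt0.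
have [_ H2 _] := inU _ _ bt0' at0'.
have subE (p q r : R) : p - q = (p - r) - (q - r) by ring.
rewrite (subE _ _ ('D_v ('D_w f) (x + b' *: v + a' *: w))) -{2}E.
rewrite [e]splitr; apply: le_trans (ler_normB _ _) _.
exact: lerD (ltW H2) (ltW H1).
Qed.

End TwoVariables.

(** * Iterated integrals over the standard simplex *)

Section Integrals.
Context {R : realType}.
Local Notation mu := (@lebesgue_measure R).
Local Notation "∫ f" := (\int[mu]_(x in `[(0:R), 1]) f x) (at level 10).

Lemma segment_integrable (f : R -> R) (a b : R) :
  {within `[a, b], continuous f} -> mu.-integrable `[a, b] (EFin \o f).
Proof.
by move=> cf; apply: continuous_compact_integrable => //; exact: segment_compact.
Qed.

Lemma Rintegral_FTC2 (F f : R -> R) (a b : R) : a <= b ->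
  {within `[a, b], continuous f} -> {within `[a, b], continuous F} ->
  (forall x : R, x \in `]a, b[ -> is_derive x 1 F (f x)) ->
  \int[mu]_(x in `[a, b]) f x = F b - F a.
Proof.
rewrite le_eqVlt => /predU1P[-> _ _ _|ab cf cF dF].
  by rewrite set_itv1 Rintegral_set1 subrr.
rewrite /Rintegral (@continuous_FTC2 R f F a b)//.
- have /(continuous_within_itvP _ ab)[_ ca cb] := cF.
  by split => // x /dF[].
- by move=> x /dF[_ <-]; rewrite derive1E.
Qed.

(** Composition with this retraction onto [[0, 1]] extends a function continuous on the segment to
    the line, so that continuity under the integral sign, available on open intervals, also reaches
    the end points. *)
Definition clamp (x : R) : R := Num.max 0 (Num.min x 1).

Lemma clamp_in x : clamp x \in `[0, 1].
Proof. by rewrite in_itv/= /clamp le_max lexx/= ge_max ler01 ge_min lexx orbT. Qed.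

Lemma clamp_id x : x \in `[0, 1] -> clamp x = x.
Proof.
by rewrite in_itv/= /clamp => /andP[x0 x1]; rewrite min_l// max_r.
Qed.

Lemma continuous_clamp (k : R -> R) : {within `[0, 1], continuous k} ->
  continuous (k \o clamp).
Proof.
move=> /subspace_continuousP ck x.
apply: (@cvg_comp _ _ _ clamp k _ (within `[0, 1] (nbhs (clamp x)))); last first.
  by apply: ck; exact: clamp_in.
move=> A /= wA.
have cc : {for x, continuous clamp}.
  have c1 : {for x, continuous ((id : R -> R^o) \min cst 1)}.
    by apply: continuous_min; [exact: cvg_id|exact: cvg_cst].
  have c2 := @continuous_max _ _ (cst 0 : R -> R^o) _ x (cvg_cst _) c1.
  exact: c2.
have H : nbhs x (clamp @^-1` [set t | t \in `[(0:R), 1] -> A t]) := cc _ wA.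
suff : nbhs x (clamp @^-1` A) by [].
by apply: filterS H => y /= ; apply; exact: clamp_in.
Qed.

Lemma integral_param_continuous (K : R -> R -> R) (M : R) :
  (forall x : R, x \in `[0, 1] -> {within `[0, 1], continuous (K x)}) ->
  (forall r : R, r \in `[0, 1] -> {within `[0, 1], continuous (K ^~ r)}) ->
  (forall x r : R, x \in `[0, 1] -> r \in `[0, 1] -> `|K x r| <= M) ->
  {within `[0, 1], continuous (fun x => ∫ (K x))}.
Proof.
move=> Kx Kr KM.
have H := @continuity_under_integral R _ _ mu (fun x r => K (clamp x) r)
  `[0, 1]%classic (measurable_itv _) (-1) 2.
have {}H := H _ _ (cst M) _ _.
have cK : {in `](-1), 2[%classic, continuous (fun x => ∫ (K (clamp x)))}.
  apply: H.
  - by move=> x _; apply: segment_integrable; apply: Kx; exact: clamp_in.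
  - by apply/aeW => r r01 x _; exact: (continuous_clamp (Kr r r01)).
  - by apply: segment_integrable; apply: continuous_subspaceT => x; exact: cvg_cst.
  - by move=> x _; apply/aeW => r r01; apply: KM => //; exact: clamp_in.
apply: (@subspace_eq_continuous _ _ _ (fun x => ∫ (K (clamp x)))).
  by move=> x; rewrite inE => x01; rewrite /= clamp_id.
apply: continuous_in_subspaceT => x; rewrite inE /= in_itv/= => /andP[x0 x1].
apply: cK; rewrite inE/= in_itv/=; apply/andP; split; lra.
Qed.

(** The integral of [K x] is differentiated under the integral sign, with the constant [M] as
    dominating function, and the fundamental theorem is applied in [x]. No exchange of the two
    integrals is involved. *)
Lemma leibniz_square (K K' : R -> R -> R) (M : R) :
  (forall x : R, x \in `[0, 1] -> {within `[0, 1], continuous (K x)}) ->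
  (forall x : R, x \in `[0, 1] -> {within `[0, 1], continuous (K' x)}) ->
  (forall r : R, r \in `[0, 1] -> {within `[0, 1], continuous (K ^~ r)}) ->
  (forall r : R, r \in `[0, 1] -> {within `[0, 1], continuous (K' ^~ r)}) ->
  (forall x r : R, x \in `]0, 1[ -> r \in `[0, 1] ->
     is_derive x 1 (K ^~ r) (K' x r)) ->
  (forall x r : R, x \in `[0, 1] -> r \in `[0, 1] -> `|K x r| <= M) ->
  (forall x r : R, x \in `[0, 1] -> r \in `[0, 1] -> `|K' x r| <= M) ->
  \int[mu]_(x in `[(0:R), 1]) ∫ (K' x) = ∫ (K 1) - ∫ (K 0).
Proof.
move=> Kx Kx' Kr Kr' dK KM KM'.
have C' := integral_param_continuous Kx' Kr' KM'.
have C := integral_param_continuous Kx Kr KM.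
pose F (x : R) := ∫ (K x).
pose f (x : R) := ∫ (K' x).
suff H : forall x : R, x \in `]0, 1[ -> is_derive x 1 F (f x).
  exact: (@Rintegral_FTC2 F f 0 1 ler01 C' C H).
move=> x x01.
have sub y : y \in `](0:R), 1[ -> y \in `[(0:R), 1] by exact: subset_itv_oo_cc.
have M0 : 0 <= M.
  have := KM 0 0; rewrite !in_itv/= lexx ler01 => /(_ isT isT).
  exact: le_trans.
have dE y r : y \in `](0:R), 1[ -> r \in `[(0:R), 1] -> partial1of2 K y r = K' y r.
  by move=> y01 r01; rewrite partial1of2E; case: (dK y r y01 r01).
have A1 : forall y, `](0:R), 1[%classic y -> mu.-integrable `[(0:R), 1] (EFin \o K y).
  by move=> y y01; apply: segment_integrable; exact/Kx/sub.
have A2 : forall y r, `](0:R), 1[%classic y -> `[(0:R), 1]%classic r ->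
    derivable (K ^~ r) y 1.
  by move=> y r y01 r01; case: (dK y r y01 r01).
have A3 : forall r : R, 0 <= cst M r by [].
have A4 : mu.-integrable `[(0:R), 1] (EFin \o cst M).
  by apply: segment_integrable; apply: continuous_subspaceT => ?; exact: cvg_cst.
have A5 : forall y r, `](0:R), 1[%classic y -> `[(0:R), 1]%classic r ->
    `|partial1of2 K y r| <= cst M r.
  by move=> y r y01 r01; rewrite dE//; apply: KM' => //; exact: sub.
have B1 := @derivable_under_integral R _ _ mu K `[(0:R), 1]%classic
  (measurable_itv _) x 0 1 x01 A1 A2 (cst M) A3 A4 A5.
have B2 := @differentiation_under_integral R _ _ mu K `[(0:R), 1]%classic
  (measurable_itv _) x 0 1 x01 A1 A2 (cst M) A3 A4 A5.
split; first exact: B1.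
rewrite -derive1E B2; apply: eq_Rintegral => r; rewrite inE => r01.
exact: dE.
Qed.

(** This moves the inner integral over [[0, 1 - x]] to a domain independent of [x]. The degenerate
    interval [c = 0] is separate because the substitution has to be strictly increasing. *)
Lemma Rintegral_rescale (G : R -> R) (c : R) : 0 <= c ->
  {within `[0, c], continuous G} ->
  \int[mu]_(y in `[0, c]) G y = ∫ (fun r => c * G (c * r)).
Proof.
rewrite le_eqVlt => /predU1P[<- _|c0 cG].
  rewrite set_itv1 Rintegral_set1.
  under eq_Rintegral do rewrite mul0r.
  by rewrite Rintegral_cst ?mul0r.
rewrite /Rintegral; congr fine.
have dF (x : R) : is_derive x 1 ( *%R c) c.
  have -> : *%R c = (fun x => c *: id x) by [].
  by have := @is_deriveZ R R R id c x 1 1 (is_derive_id _ _); rewrite [c *: 1]mulr1.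
have F' : derive1 ( *%R c) = cst c.
  by apply/funext => x; rewrite derive1E; case: (dF x).
have ccF (x : R) : {for x, continuous ( *%R c)}.
  exact: mulrl_continuous.
have := @integration_by_substitution_increasing R ( *%R c) G 0 1 ler01.
rewrite mulr0 mulr1 F' => ->//.
- by apply: eq_integral => r _ /=; rewrite mulrC.
- by move=> x y _ _; rewrite ltr_pM2l.
- by move=> x _; exact: cvg_cst.
- exact: is_cvg_cst.
- exact: is_cvg_cst.
- split; first by move=> x _; case: (dF x).
    by apply: cvg_at_right_filter; exact: ccF.
  by apply: cvg_at_left_filter; exact: ccF.
Qed.


Local Notation e0 := (@point2 R 1 0).
Local Notation e1 := (@point2 R 0 1).

Lemma continuous_line (V W : normedModType R) (f : V -> W) (y v : V) (t : R) :
  {for (y + t *: v), continuous f} -> {for t, continuous (fun s : R => f (y + s *: v))}.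
Proof.
move=> cf; apply: (@cvg_comp _ _ _ (fun s : R => y + s *: v) f _ (nbhs (y + t *: v))).
  by apply: cvgD; [exact: cvg_cst|apply: cvgZr_tmp; exact: cvg_id].
exact: cf.
Qed.

Lemma point2_add (a b c d : R) : point2 a b + point2 c d = point2 (a + c) (b + d).
Proof. by apply/rowP => j; rewrite !mxE; case: ifP. Qed.

Lemma point2_scale (a c d : R) : a *: point2 c d = point2 (a * c) (a * d).
Proof. by apply/rowP => j; rewrite !mxE; case: ifP. Qed.

Lemma point20 (a b : R) : point2 a b 0 0 = a.
Proof. by rewrite mxE. Qed.

Lemma point21 (a b : R) : point2 a b 0 1 = b.
Proof. by rewrite mxE. Qed.

Lemma simplex2_point2 (a b : R) :
  0 <= a -> 0 <= b -> a + b <= 1 -> simplex2 (point2 a b).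
Proof. by move=> *; split; rewrite ?point20 ?point21. Qed.

Lemma compact_simplex2 : compact (@simplex2 R).
Proof.
apply: bounded_closed_compact.
  exists 1; split; first exact: num_real.
  move=> M M1 u [u0 u1 u01]; rewrite [u]point2E !point2_scale point2_add.
  rewrite !mulr0 !mulr1 addr0 add0r; apply: norm_point2; rewrite ger0_norm//; lra.
have -> : @simplex2 R = [set u | 0 <= u 0 0] `&` [set u | 0 <= u 0 1] `&`
    [set u | u 0 0 + u 0 1 <= 1].
  by apply/seteqP; split=> u; [move=> [? ? ?]; split|move=> [[? ?] ?]; split].
have cc j : continuous (fun u : 'rV[R]_2 => u 0 j) by exact: coord_continuous.
apply: closedI; first apply: closedI.
- exact: (@preimage_closed _ _ (fun u : 'rV[R]_2 => u 0 0) [set x | 0 <= x]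
    (fun x _ => cc 0 x) (@closed_ge R 0)).
- exact: (@preimage_closed _ _ (fun u : 'rV[R]_2 => u 0 1) [set x | 0 <= x]
    (fun x _ => cc 1 x) (@closed_ge R 0)).
- apply: (@preimage_closed _ _ (fun u : 'rV[R]_2 => u 0 0 + u 0 1) [set x | x <= 1] _
    (@closed_le R 1)).
  by move=> x _; exact: cvgD (cc 0 x) (cc 1 x).
Qed.

Lemma bounded_on_simplex2 (U : set 'rV[R]_2) (f : 'rV[R]_2 -> R) :
  @simplex2 R `<=` U -> (forall x, U x -> {for x, continuous f}) ->
  exists M : R, forall u, simplex2 u -> `|f u| <= M.
Proof.
move=> DU cf.
have [||c _ Hc] := @EVT_max_rV R 2 (fun u => `|f u|) (@simplex2 R) _ compact_simplex2.
- by exists (point2 0 0); apply: simplex2_point2; rewrite ?addr0.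
- apply: continuous_in_subspaceT => u; rewrite inE => Du.
  apply: (@cvg_comp _ _ _ f (fun y : R => `|y|) _ (nbhs (f u))).
    exact: (cf u (DU u Du)).
  exact: norm_continuous.
by exists `|f c| => u Du; apply: Hc; rewrite inE.
Qed.

(** * Integrals of partial derivatives over the triangle *)

Section Triangle.
Variables (U : set 'rV[R]_2) (H : 'rV[R]_2 -> R).
Hypotheses (oU : open U) (DU : @simplex2 R `<=` U) (CH : Ck U 1 H).

Lemma within_line (f : 'rV[R]_2 -> R) (c : R -> 'rV[R]_2) (y v : 'rV[R]_2) (a b : R) :
  (forall x, U x -> {for x, continuous f}) ->
  (forall t, c t = y + t *: v) ->
  (forall t, t \in `[a, b] -> simplex2 (c t)) ->
  {within `[a, b], continuous (fun t => f (c t))}.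
Proof.
move=> cf cE cD; apply: continuous_in_subspaceT => t; rewrite inE /= => tab.
have -> : (fun t => f (c t)) = (fun t => f (y + t *: v)).
  by apply/funext => s; rewrite cE.
by apply: continuous_line; apply: cf; rewrite -cE; exact/DU/cD.
Qed.

Lemma triangle_dy :
  {within `[(0:R), 1], continuous (fun x =>
     \int[mu]_(y in `[0, 1 - x]) 'D_e1 H (point2 x y))} /\
  \int[mu]_(x in `[0, 1]) \int[mu]_(y in `[0, 1 - x]) 'D_e1 H (point2 x y) =
  ∫ (fun x => H (point2 x (1 - x))) - ∫ (fun x => H (point2 x 0)).
Proof.
have E (x : R) : x \in `[0, 1] ->
   \int[mu]_(y in `[0, 1 - x]) 'D_e1 H (point2 x y) =
   H (point2 x (1 - x)) - H (point2 x 0).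
  rewrite in_itv/= => /andP[x0 x1].
  have lineE (t : R) : point2 x t = point2 x 0 + t *: e1.
    by rewrite point2_scale point2_add mulr0 mulr1 addr0 add0r.
  have inD (t : R) : t \in `[0, 1 - x] -> simplex2 (point2 x t).
    by rewrite in_itv/= => /andP[t0 t1]; apply: simplex2_point2 => //; lra.
  apply: (@Rintegral_FTC2 (fun t => H (point2 x t))).
  - by rewrite subr_ge0.
  - exact: (@within_line ('D_e1 H) (point2 x) _ _ _ _ (CH.2.2 e1).1 lineE inD).
  - exact: (@within_line H (point2 x) _ _ _ _ CH.1 lineE inD).
  - move=> t /subset_itv_oo_cc/inD/DU.
    have -> : (fun t => H (point2 x t)) = (fun t => H (point2 x 0 + t *: e1)).
      by apply/funext => s; rewrite lineE.
    by rewrite lineE => Ut; apply: is_derive_line; exact: CH.2.1.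
have C1 : {within `[(0:R), 1], continuous (fun x => H (point2 x (1 - x)))}.
  apply: (@within_line H (fun x => point2 x (1 - x)) (point2 0 1) (point2 1 (-1))); first exact: CH.1.
    by move=> t; rewrite point2_scale point2_add; congr point2; ring.
  by move=> t; rewrite in_itv/= => /andP[? ?]; apply: simplex2_point2 => //; lra.
have C2 : {within `[(0:R), 1], continuous (fun x => H (point2 x 0))}.
  apply: (@within_line H (fun x => point2 x 0) (point2 0 0) (point2 1 0)); first exact: CH.1.
    by move=> t; rewrite point2_scale point2_add; congr point2; ring.
  by move=> t; rewrite in_itv/= => /andP[? ?]; apply: simplex2_point2 => //; lra.
split.
  apply: (@subspace_eq_continuous _ _ _
    (fun x => H (point2 x (1 - x)) - H (point2 x 0))).
    by move=> x; rewrite inE => x01; exact: (esym (E x x01)).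
  move=> x; apply: (@continuousB _ _ _ (from_subspace `[0, 1] (fun x => H (point2 x (1 - x))))).
    exact: C1.
  exact: C2.
rewrite -RintegralB//; [|exact: segment_integrable|exact: segment_integrable].
by apply: eq_Rintegral => x; rewrite inE; exact: E.
Qed.

(** Here the derivative is in the outer variable, on which the inner interval depends. The map [q]
    collapses the square onto the triangle, [K] is [H] times its Jacobian [1 - x], and [K'] is the
    [x]-derivative of [K]. The inner integral differs from that of [K'] by a boundary value on the
    hypotenuse, and [leibniz_square] handles [K']. *)
Lemma triangle_dx :
  {within `[(0:R), 1], continuous (fun x =>
     \int[mu]_(y in `[0, 1 - x]) 'D_e0 H (point2 x y))} /\
  \int[mu]_(x in `[0, 1]) \int[mu]_(y in `[0, 1 - x]) 'D_e0 H (point2 x y) =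
  ∫ (fun t => H (point2 (1 - t) t)) - ∫ (fun t => H (point2 0 t)).
Proof.
pose q (x r : R) : 'rV[R]_2 := point2 x ((1 - x) * r).
pose K (x r : R) : R := (1 - x) * H (q x r).
pose K' (x r : R) : R := - H (q x r) + (1 - x) * ('D_e0 H (q x r) - r * 'D_e1 H (q x r)).
have inD (x r : R) : x \in `[0, 1] -> r \in `[0, 1] -> simplex2 (q x r).
  rewrite !in_itv/= => /andP[x0 x1] /andP[r0 r1].
  by apply: simplex2_point2 => //; nra.
have qx (r x : R) : q x r = point2 0 r + x *: point2 1 (- r).
  by rewrite /q point2_scale point2_add; congr point2; ring.
have qr (x r : R) : q x r = point2 x 0 + r *: point2 0 (1 - x).
  by rewrite /q point2_scale point2_add; congr point2; ring.
have Wx (f : 'rV[R]_2 -> R) (x : R) : (forall x, U x -> {for x, continuous f}) ->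
    x \in `[0, 1] -> {within `[(0:R), 1], continuous (fun r => f (q x r))}.
  move=> cf x01; apply: (@within_line f (q x) _ _ _ _ cf (qr x)) => r r01.
  exact: inD.
have Wr (f : 'rV[R]_2 -> R) (r : R) : (forall x, U x -> {for x, continuous f}) ->
    r \in `[0, 1] -> {within `[(0:R), 1], continuous (fun x => f (q x r))}.
  move=> cf r01; apply: (@within_line f (q ^~ r) _ _ _ _ cf (qx r)) => x x01.
  exact: inD.
have c0 := (CH.2.2 e0).1; have c1 := (CH.2.2 e1).1; have cH := CH.1.
have cid (g : R -> R) : continuous g -> {within `[(0:R), 1], continuous g}.
  exact: continuous_subspaceT.
have cB : {within `[(0:R), 1], continuous (fun x : R => 1 - x)}.
  by apply: cid => x; apply: cvgB; [exact: cvg_cst|exact: cvg_id].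
have cI : {within `[(0:R), 1], continuous (fun x : R => x)} by apply: cid => x.
have wD (f g : R -> R) : {within `[(0:R), 1], continuous f} ->
    {within `[(0:R), 1], continuous g} ->
    {within `[(0:R), 1], continuous (fun x => f x + g x)}.
  by move=> cf cg x; apply: cvgD; [exact: cf|exact: cg].
have wN (f : R -> R) : {within `[(0:R), 1], continuous f} ->
    {within `[(0:R), 1], continuous (fun x => - f x)}.
  by move=> cf x; apply: cvgN; exact: cf.
have wM (f g : R -> R) : {within `[(0:R), 1], continuous f} ->
    {within `[(0:R), 1], continuous g} ->
    {within `[(0:R), 1], continuous (fun x => f x * g x)}.
  by move=> cf cg x; apply: cvgM; [exact: cf|exact: cg].
have wC (c : R) : {within `[(0:R), 1], continuous (fun _ => c)}.
  by apply: cid => x; exact: cvg_cst.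
have [M0 HM0] := bounded_on_simplex2 DU cH.
have [M1 HM1] := bounded_on_simplex2 DU c0.
have [M2 HM2] := bounded_on_simplex2 DU c1.
have Kx (x : R) : x \in `[0, 1] -> {within `[(0:R), 1], continuous (K x)}.
  by move=> x01; apply: (wM); [exact: wC|exact: Wx].
have Kr (r : R) : r \in `[0, 1] -> {within `[(0:R), 1], continuous (K ^~ r)}.
  by move=> r01; apply: (wM); [exact: cB|exact: Wr].
have Kx' (x : R) : x \in `[0, 1] -> {within `[(0:R), 1], continuous (K' x)}.
  move=> x01; apply: (wD); first by apply: (wN); exact: (Wx _ _ cH).
  apply: (wM); first exact: wC.
  by apply: (wD); [exact: (Wx _ _ c0)|apply: (wN); apply: (wM); [exact: cI|exact: (Wx _ _ c1)]].
have Kr' (r : R) : r \in `[0, 1] -> {within `[(0:R), 1], continuous (K' ^~ r)}.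
  move=> r01; apply: (wD); first by apply: (wN); exact: (Wr _ _ cH).
  apply: (wM); first exact: cB.
  by apply: (wD); [exact: (Wr _ _ c0)|apply: (wN); apply: (wM); [exact: wC|exact: (Wr _ _ c1)]].
have dK (x r : R) : x \in `]0, 1[ -> r \in `[0, 1] ->
     is_derive x 1 (K ^~ r) (K' x r).
  move=> /subset_itv_oo_cc x01 r01.
  have Uq := DU (inD _ _ x01 r01).
  have dq : is_derive x 1 (fun x => H (q x r)) ('D_e0 H (q x r) - r * 'D_e1 H (q x r)).
    have -> : (fun x => H (q x r)) = (fun x => H (point2 0 r + x *: point2 1 (- r))).
      by apply/funext => s; rewrite qx.
    have -> : 'D_e0 H (q x r) - r * 'D_e1 H (q x r) = 'D_(point2 1 (- r)) H (q x r).
      by rewrite (C1_derive_linear (point2 1 (- r)) oU CH Uq) point20 point21 mul1r mulNr.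
    by rewrite qx; apply: is_derive_line; rewrite -qx; exact: CH.2.1.
  have dB : is_derive x 1 (fun x : R => 1 - x) (-1).
    by have := @is_deriveB R R R (cst 1) id x 1 0 1 (is_derive_cst _ _ _) (is_derive_id _ _);
      rewrite sub0r.
  have -> : K' x r = (1 - x) *: ('D_e0 H (q x r) - r * 'D_e1 H (q x r)) +
      H (q x r) *: (-1).
    by rewrite addrC -[H _ *: _]/(H _ * _) mulrN1.
  exact: is_deriveM dB dq.
have pos (x : R) : x \in `[0, 1] -> `|x| <= 1 /\ `|1 - x| <= 1.
  by rewrite in_itv/= => /andP[? ?]; rewrite !ger0_norm; lra.
have n1 (a b M : R) : `|a| <= 1 -> `|b| <= M -> `|a * b| <= M.
  move=> a1 bM; rewrite normrM; apply: le_trans bM; exact: ler_piMl.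
have KM (x r : R) : x \in `[0, 1] -> r \in `[0, 1] -> `|K x r| <= M0 + (M1 + M2).
  move=> x01 r01.
  have h1 := HM1 _ (inD _ _ x01 r01); have h2 := HM2 _ (inD _ _ x01 r01).
  apply: (@le_trans _ _ M0); first by apply: (n1); [exact: (pos x x01).2|exact/HM0/inD].
  by rewrite lerDl addr_ge0//; [exact: le_trans h1|exact: le_trans h2].
have KM' (x r : R) : x \in `[0, 1] -> r \in `[0, 1] -> `|K' x r| <= M0 + (M1 + M2).
  move=> x01 r01; apply: le_trans (ler_normD _ _) _; apply: lerD.
    by rewrite normrN; exact/HM0/inD.
  apply: (n1); first exact: (pos x x01).2.
  apply: le_trans (ler_normB _ _) _; apply: lerD; first exact/HM1/inD.
  by apply: (n1); [exact: (pos r r01).1|exact/HM2/inD].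
have L := leibniz_square Kx Kx' Kr Kr' dK KM KM'.
have CK' := integral_param_continuous Kx' Kr' KM'.
have E (x : R) : x \in `[0, 1] ->
   \int[mu]_(y in `[0, 1 - x]) 'D_e0 H (point2 x y) = ∫ (K' x) + H (point2 x (1 - x)).
  move=> x01; have [x0 x1] : 0 <= x /\ 0 <= 1 - x.
    by move: x01; rewrite in_itv/= => /andP[? ?]; lra.
  rewrite Rintegral_rescale//; last first.
    apply: (@within_line ('D_e0 H) (point2 x) (point2 x 0) e1); first exact: c0.
      by move=> t; rewrite point2_scale point2_add; congr point2; ring.
    by move=> t; rewrite in_itv/= => /andP[? ?]; apply: simplex2_point2 => //; lra.
  (* [h] is the part of the rescaled integrand missing from [K']. It is the [r]-derivative of
     [r * H (q x r)], so it integrates to the value of [H] on the hypotenuse. *)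
  pose h (r : R) : R := H (q x r) + r * ((1 - x) * 'D_e1 H (q x r)).
  have ch : {within `[(0:R), 1], continuous h}.
    apply: (wD); first exact: (Wx _ _ cH).
    apply: (wM); first exact: cI.
    by apply: (wM); [exact: wC|exact: (Wx _ _ c1)].
  have Ih : ∫ h = H (point2 x (1 - x)).
    have -> : H (point2 x (1 - x)) = 1 * H (q x 1) - 0 * H (q x 0).
      by rewrite mul1r mul0r subr0 /q mulr1.
    pose F (r : R) : R := r * H (q x r).
    have cF : {within `[(0:R), 1], continuous F}.
      by apply: (wM); [exact: cI|exact: (Wx _ _ cH)].
    suff dF : forall r : R, r \in `]0, 1[ -> is_derive r 1 F (h r).
      exact: (@Rintegral_FTC2 F h 0 1 ler01 ch cF dF).
    move=> r /subset_itv_oo_cc r01.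
    have Uq := DU (inD _ _ x01 r01).
    have dq : is_derive r 1 (fun r => H (q x r)) ((1 - x) * 'D_e1 H (q x r)).
      have -> : (fun r => H (q x r)) = (fun r => H (point2 x 0 + r *: point2 0 (1 - x))).
        by apply/funext => s; rewrite qr.
      have -> : (1 - x) * 'D_e1 H (q x r) = 'D_(point2 0 (1 - x)) H (q x r).
        by rewrite (C1_derive_linear (point2 0 (1 - x)) oU CH Uq) point20 point21 mul0r add0r.
      by rewrite qr; apply: is_derive_line; rewrite -qr; exact: CH.2.1.
    have -> : h r = r *: ((1 - x) * 'D_e1 H (q x r)) + H (q x r) *: 1.
      by rewrite addrC -[H _ *: _]/(H _ * _) mulr1.
    exact: is_deriveM (is_derive_id r 1) dq.
  rewrite -Ih -RintegralD//; [|by apply: segment_integrable; exact: Kx'|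
    exact: segment_integrable].
  by apply: eq_Rintegral => r _; rewrite /K' /h /q; ring.
have CH1 : {within `[(0:R), 1], continuous (fun x => H (point2 x (1 - x)))}.
  apply: (@within_line H (fun x => point2 x (1 - x)) (point2 0 1) (point2 1 (-1))); first exact: CH.1.
    by move=> t; rewrite point2_scale point2_add; congr point2; ring.
  by move=> t; rewrite in_itv/= => /andP[? ?]; apply: simplex2_point2 => //; lra.
split.
  apply: (@subspace_eq_continuous _ _ _ (fun x => ∫ (K' x) + H (point2 x (1 - x)))).
    by move=> x; rewrite inE => x01; exact: (esym (E x x01)).
  exact: wD.
have -> : \int[mu]_(x in `[0, 1]) \int[mu]_(y in `[0, 1 - x]) 'D_e0 H (point2 x y) =
    \int[mu]_(x in `[0, 1]) (∫ (K' x) + H (point2 x (1 - x))).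
  by apply: eq_Rintegral => x; rewrite inE; exact: E.
rewrite RintegralD//; [|exact: segment_integrable|exact: segment_integrable].
rewrite L addrC.
(* The side [x = 1] of the square is collapsed to a vertex, where the Jacobian vanishes. *)
have -> : ∫ (K 1) = 0.
  under eq_Rintegral do rewrite /K subrr mul0r.
  by rewrite Rintegral_cst ?mul0r.
have -> : ∫ (K 0) = ∫ (fun t => H (point2 0 t)).
  by apply: eq_Rintegral => r _; rewrite /K /q subr0 !mul1r.
rewrite sub0r; congr (_ - _).
rewrite Rintegration_by_substitution_onem ?ler01 ?lexx//.
rewrite /unstable.onem subrr; apply: eq_Rintegral => r _.
by have -> : 1 - (1 - r) = r by ring.
Qed.

End Triangle.
End Integrals.

(** * Stokes' formula and relative cycles *)

Lemma alternating_sum3 (R : pzRingType) (F : 'I_3 -> R) :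
  \sum_(i < 3) (-1) ^+ i * F i =
  F ord0 - F (lift ord0 ord0) + F (lift ord0 (lift ord0 ord0)).
Proof.
rewrite !big_ord_recl big_ord0 /= expr0 mul1r expr1 mulN1r expr2 mulrNN mulr1.
by rewrite mul1r addr0 addrA.
Qed.

Section Stokes.
Context {R : realType}.
Local Notation mu := (@lebesgue_measure R).
Local Notation "∫ f" := (\int[mu]_(x in `[(0:R), 1]) f x) (at level 10).
Local Notation e0 := (@point2 R 1 0).
Local Notation e1 := (@point2 R 0 1).

Lemma segment_RintegralB (f g : R -> R) (a b : R) :
  {within `[a, b], continuous f} -> {within `[a, b], continuous g} ->
  \int[mu]_(x in `[a, b]) (f x - g x) =
  \int[mu]_(x in `[a, b]) f x - \int[mu]_(x in `[a, b]) g x.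
Proof. by move=> cf cg; rewrite RintegralB//; exact: segment_integrable. Qed.

Definition liouville (p v : 'rV[R]_4) : R := p 0 0 * v 0 1 + p 0 2 * v 0 3.

(** Over the open interval the integrand depends only on the values of [g] on [[0, 1]]; at an end
    point ['D_1 g] would also see values outside. This matters because [boundary_coef] identifies
    paths that agree on [[0, 1]]. *)
Definition path_action (g : R -> 'rV[R]_4) : R :=
  \int[mu]_(t in `](0:R), 1[) liouville (g t) ('D_1 g t).

Lemma eq_path_action (g h : R -> 'rV[R]_4) :
  (forall t : R, 0 <= t <= 1 -> g t = h t) -> path_action g = path_action h.
Proof.
move=> gh; apply: eq_Rintegral => t; rewrite inE /= => t01.
have nt : \forall s \near t, g s = h s.
  near=> s; apply: gh; apply/andP; split; apply/ltW; near: s.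
    by apply: lt_nbhsr; move: t01; rewrite in_itv/= => /andP[].
  by apply: lt_nbhsl; move: t01; rewrite in_itv/= => /andP[].
by rewrite (near_eq_derive _ nt) (nbhs_singleton nt).
Unshelve. all: by end_near. Qed.

Lemma Rintegral_itvoo (f : R -> R) : {within `[0, 1], continuous f} ->
  \int[mu]_(t in `](0:R), 1[) f t = ∫ f.
Proof.
move=> cf; have If := segment_integrable cf.
rewrite -Rintegral_itv_obnd_cbnd; last first.
  by apply: integrableS If => //; exact: subset_itv_oc_cc.
rewrite Rintegral_itv_bndo_bndc//.
by apply: integrableS If => //; exact: subset_itv_oo_cc.
Qed.

Definition edge (i : 'I_3) : 'rV[R]_2 :=
  if i == 0 then point2 (-1) 1 else if i == 1 then e1 else e0.

Lemma face_edge (i : 'I_3) (t : R) : face i t = face i 0 + t *: edge i.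
Proof.
rewrite /face /edge; case: ifP => _; last case: ifP => _;
  by rewrite point2_scale point2_add; congr point2; ring.
Qed.

Lemma face_simplex2 (i : 'I_3) (t : R) : 0 <= t <= 1 -> simplex2 (face i t).
Proof.
move=> /andP[t0 t1]; rewrite /face; case: ifP => _; last case: ifP => _;
  apply: simplex2_point2; lra.
Qed.

Variables (U : set 'rV[R]_2) (s : 'rV[R]_2 -> 'rV[R]_4).
Hypotheses (oU : open U) (DU : @simplex2 R `<=` U) (Us : smooth_on U s).

Let coord (j : 'I_4) (u : 'rV[R]_2) : R := s u 0 j.

Let Cs k j : Ck U k (coord j).
Proof. by apply: (Ck_mxP k s oU).1; exact: (smooth_onP U s).1. Qed.

Lemma derivable_simplex u v : U u -> derivable s u v.
Proof. by move=> Uu; exact: (((smooth_onP U s).1 Us 1%N).2.1). Qed.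

Lemma derive_coord u v (j : 'I_4) : U u -> ('D_v s u) 0 j = 'D_v (coord j) u.
Proof. by move=> Uu; rewrite derive_mx ?mxE//; exact: derivable_simplex. Qed.

Lemma is_derive_face (i : 'I_3) (t : R) : 0 <= t <= 1 ->
  is_derive t 1 (fun t => s (face i t)) ('D_(edge i) s (face i t)).
Proof.
move=> t01.
have -> : (fun t => s (face i t)) = (fun t => s (face i 0 + t *: edge i)).
  by apply/funext => r; rewrite -face_edge.
have Uf : U (face i t) by apply: DU; exact: face_simplex2.
rewrite face_edge in Uf *; apply: is_derive_line.
exact: derivable_simplex.
Qed.

(** The Liouville form pulled back by [s], evaluated on the constant vector field [v]. *)
Let primitive (v u : 'rV[R]_2) : R :=
  coord 0 u * 'D_v (coord 1) u + coord 2 u * 'D_v (coord 3) u.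

Lemma primitiveE v u : U u -> liouville (s u) ('D_v s u) = primitive v u.
Proof. by move=> Uu; rewrite /liouville !derive_coord. Qed.

Let Cprimitive v : Ck U 1 (primitive v).
Proof.
by apply: Ck_add => //; apply: Ck_mul => //; exact: Ck_derive (Cs 2 _).
Qed.

Lemma liouville_face_continuous (i : 'I_3) :
  {within `[(0:R), 1], continuous (fun t => liouville (s (face i t)) ('D_(edge i) s (face i t)))}.
Proof.
apply: (@subspace_eq_continuous _ _ _ (fun t => primitive (edge i) (face i t))).
  move=> t; rewrite inE /= in_itv/= => t01.
  by rewrite -[RHS]/(liouville _ _) primitiveE//; apply: DU; exact: face_simplex2.
apply: (@within_line _ _ DU (primitive (edge i)) (face i) (face i 0) (edge i)).
- exact: (Cprimitive _).1.
- exact: face_edge.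
- by move=> t; rewrite in_itv/=; exact: face_simplex2.
Qed.

Lemma path_action_face (i : 'I_3) :
  path_action (fun t => s (face i t)) = ∫ (fun t => primitive (edge i) (face i t)).
Proof.
rewrite /path_action.
transitivity (\int[mu]_(t in `](0:R), 1[)
    liouville (s (face i t)) ('D_(edge i) s (face i t))).
  apply: eq_Rintegral => t; rewrite inE/= => /subset_itv_oo_cc; rewrite in_itv/= => t01.
  by have [_ ->] := is_derive_face i t01.
rewrite Rintegral_itvoo; last exact: liouville_face_continuous.
apply: eq_Rintegral => t; rewrite inE/= in_itv/= => t01.
by rewrite primitiveE//; apply: DU; exact: face_simplex2.
Qed.

Lemma primitive_edge0 u : U u -> primitive (edge 0) u = primitive e1 u - primitive e0 u.
Proof.
move=> Uu; rewrite /primitive.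
have D j : 'D_(edge 0) (coord j) u = 'D_e1 (coord j) u - 'D_e0 (coord j) u.
  rewrite (C1_derive_linear (edge 0) oU (Cs 1 j) Uu) /edge eqxx point20 point21.
  by rewrite mulN1r mul1r addrC.
by rewrite !D !mulrBr opprD addrACA.
Qed.

(** This is the formula for the exterior derivative of a 1-form on two constant vector fields, whose
    bracket is zero. The second derivatives of [s] cancel by [derive_comm]. *)
Lemma omega_primitive u v w : U u ->
  omega ('D_v s u) ('D_w s u) = 'D_v (primitive w) u - 'D_w (primitive v) u.
Proof.
move=> Uu.
have cv j := derive_coord v j Uu; have cw j := derive_coord w j Uu.
have -> : omega ('D_v s u) ('D_w s u) =
    'D_v (coord 0) u * 'D_w (coord 1) u - 'D_v (coord 1) u * 'D_w (coord 0) u +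
    ('D_v (coord 2) u * 'D_w (coord 3) u - 'D_v (coord 3) u * 'D_w (coord 2) u).
  by congr (_ * _ - _ * _ + (_ * _ - _ * _));
    [exact: cv|exact: cw|exact: cv|exact: cw|exact: cv|exact: cw|exact: cv|exact: cw].
have D a b : 'D_a (primitive b) u =
    (coord 0 u * 'D_a ('D_b (coord 1)) u + 'D_b (coord 1) u * 'D_a (coord 0) u) +
    (coord 2 u * 'D_a ('D_b (coord 3)) u + 'D_b (coord 3) u * 'D_a (coord 2) u).
  have d j : derivable (coord j) u a by exact: (Cs 1 j).2.1.
  have d2 j : derivable ('D_b (coord j)) u a by exact: ((Cs 2 j).2.2 b).2.1.
  rewrite deriveD; [|exact: derivableM|exact: derivableM].
  by rewrite !deriveM.
rewrite !D (derive_comm v w oU (Cs 2 1) Uu) (derive_comm v w oU (Cs 2 3) Uu).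
move: ('D_w ('D_v _) u) ('D_w ('D_v _) u) => X Y.
move: ('D_v (coord 0) u) ('D_v (coord 1) u) ('D_v (coord 2) u) ('D_v (coord 3) u).
move: ('D_w (coord 0) u) ('D_w (coord 1) u) ('D_w (coord 2) u) ('D_w (coord 3) u).
move: (coord 0 u) (coord 2 u) => p p' *; ring.
Qed.

(** [triangle_dx] and [triangle_dy] treat the two halves of [omega_primitive]. Each leaves one leg
    and the hypotenuse, and the two integrals over the hypotenuse combine through
    [primitive_edge0]. *)
Lemma simplex_area_boundary : simplex_area s =
  \sum_(i < 3) (-1) ^+ i * path_action (fun t => s (face i t)).
Proof.
have seg (x y : R) : x \in `[0, 1] -> y \in `[0, 1 - x] -> U (point2 x y).
  rewrite !in_itv/= => /andP[? ?] /andP[? ?].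
  by apply: DU; apply: simplex2_point2; lra.
have Cx v w (x : R) : x \in `[0, 1] ->
    {within `[(0:R), 1 - x], continuous (fun y => 'D_v (primitive w) (point2 x y))}.
  move=> x01; apply: (@within_line _ _ DU ('D_v (primitive w)) (point2 x) (point2 x 0) e1).
  - exact: ((Cprimitive w).2.2 v).1.
  - by move=> t; rewrite point2_scale point2_add; congr point2; ring.
  - move: x01; rewrite in_itv/= => /andP[? ?] t; rewrite in_itv/= => /andP[? ?].
    by apply: simplex2_point2; lra.
have W v (c : R -> 'rV[R]_2) (y w : 'rV[R]_2) : (forall t : R, c t = y + t *: w) ->
    (forall t : R, t \in `[0, 1] -> simplex2 (c t)) ->
    {within `[(0:R), 1], continuous (fun t => primitive v (c t))}.
  move=> cE cD; exact: (@within_line _ _ DU (primitive v) c y w _ _ (Cprimitive v).1 cE cD).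
have W0 v : {within `[(0:R), 1], continuous (fun t : R => primitive v (point2 (1 - t) t))}.
  apply: (W v (fun t : R => point2 (1 - t) t) (point2 1 0) (point2 (-1) 1)).
    by move=> t; rewrite point2_scale point2_add; congr point2; ring.
  by move=> t; rewrite in_itv/= => /andP[? ?]; apply: simplex2_point2; lra.
have W1 v : {within `[(0:R), 1], continuous (fun x : R => primitive v (point2 x (1 - x)))}.
  apply: (W v (fun x : R => point2 x (1 - x)) (point2 0 1) (point2 1 (-1))).
    by move=> t; rewrite point2_scale point2_add; congr point2; ring.
  by move=> t; rewrite in_itv/= => /andP[? ?]; apply: simplex2_point2; lra.
have U0 (t : R) : t \in `[0, 1] -> U (point2 (1 - t) t).
  by rewrite in_itv/= => /andP[? ?]; apply: DU; apply: simplex2_point2; lra.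
have subst (t : R) : 1 - (1 - t) = t by ring.
pose A1 := ∫ (fun t => primitive e1 (point2 (1 - t) t)).
pose A2 := ∫ (fun t => primitive e1 (point2 0 t)).
pose B1 := ∫ (fun t => primitive e0 (point2 t (1 - t))).
pose B2 := ∫ (fun t => primitive e0 (point2 t 0)).
have P0 : path_action (fun t => s (face ord0 t)) = A1 - B1.
  apply: etrans (path_action_face ord0) _.
  (* [triangle_dy] runs along the hypotenuse by increasing [x], [face] by decreasing [x]; the
     substitution [t |-> 1 - t] reconciles them. *)
  have -> : B1 = ∫ (fun t => primitive e0 (point2 (1 - t) t)).
    apply: etrans (Rintegration_by_substitution_onem _ (W1 e0)) _.
      by rewrite ler01 lexx.
    by rewrite /unstable.onem subrr; apply: eq_Rintegral => r _; rewrite subst.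
  apply: etrans (segment_RintegralB (W0 e1) (W0 e0)).
  apply: eq_Rintegral => t; rewrite inE/= => t01.
  by apply: primitive_edge0; exact: U0.
have P1 : path_action (fun t => s (face (lift ord0 ord0) t)) = A2.
  exact: (path_action_face (lift ord0 ord0)).
have P2 : path_action (fun t => s (face (lift ord0 (lift ord0 ord0)) t)) = B2.
  exact: (path_action_face (lift ord0 (lift ord0 ord0))).
have arith (x y z w : R) : x - y - (z - w) = x - z - y + w by ring.
rewrite alternating_sum3 P0 P1 P2.
have [cX IX] := triangle_dx oU DU (Cprimitive e1).
have [cY IY] := triangle_dy DU (Cprimitive e0).
have -> : simplex_area s = \int[mu]_(x in `[0, 1])
   (\int[mu]_(y in `[0, 1 - x]) 'D_e0 (primitive e1) (point2 x y) -
    \int[mu]_(y in `[0, 1 - x]) 'D_e1 (primitive e0) (point2 x y)).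
  apply: eq_Rintegral => x; rewrite inE/= => x01.
  apply: (etrans _ (segment_RintegralB (Cx e0 e1 x x01) (Cx e1 e0 x x01))).
  apply: eq_Rintegral => y; rewrite inE/= => y01.
  by apply: omega_primitive; exact: seg.
rewrite (segment_RintegralB cX cY).
exact: etrans (f_equal2 (fun x y => x - y) IX IY) (arith A1 A2 B1 B2).
Qed.

End Stokes.

(** * From simplices to relative cycles *)

Section IntegralChains.
Context {R : realType}.

(** Entries with equal second component are collected, so a value of [r] has to be integral only
    where the total coefficient is non-zero. This is how cancellation in the boundary of a chain
    enters. *)
Lemma grouped_sum_int (E : eqType) (r : E -> R) (T : seq (int * E)) :
  (forall p, p \in T -> \sum_(q <- T) q.1 * (q.2 == p.2)%:R != 0 -> r p.2 \is a Num.int) ->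
  \sum_(p <- T) p.1%:~R * r p.2 \is a Num.int.
Proof.
move=> H; pose s := undup (map snd T).
have us : uniq s by exact: undup_uniq.
have -> : \sum_(p <- T) p.1%:~R * r p.2 =
    \sum_(e <- s) (\sum_(q <- T) q.1 * (q.2 == e)%:R)%:~R * r e.
  under [RHS]eq_bigr do rewrite raddf_sum/= mulr_suml.
  rewrite exchange_big/=; apply: eq_big_seq => p pT.
  have ps : p.2 \in s by rewrite mem_undup map_f.
  rewrite (bigD1_seq _ ps us)/= eqxx mulr1 big1 ?addr0// => e.
  by rewrite eq_sym => /negPf ->; rewrite mulr0 mulr0z mul0r.
rewrite big_seq; apply: rpred_sum => e; rewrite mem_undup => /mapP[p pT ->].
have [->|/(H _ pT) rp] := eqVneq (\sum_(q <- T) q.1 * (q.2 == p.2)%:R) 0.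
  by rewrite mulr0z mul0r rpred0.
by apply: rpredM; [exact: intr_int|exact: rp].
Qed.

Lemma chain_area_int (X L : set 'rV[R]_4) (S : 'rV[R]_4 -> R) (c : chain2 R) :
  (forall (s : 'rV[R]_2 -> 'rV[R]_4) i, smooth_simplex X s ->
     (forall t : R, 0 <= t <= 1 -> L (s (face i t))) ->
     path_action (fun t => s (face i t)) - (S (s (face i 1)) - S (s (face i 0)))
       \is a Num.int) ->
  relative_cycle X L c -> chain_area c \is a Num.int.
Proof.
move=> HS [cX cL].
(* Cutting paths off to 0 outside [[0, 1]] turns the agreement on [[0, 1]] used by [boundary_coef]
   into equality of functions, as [grouped_sum_int] requires. *)
pose res (h : R -> 'rV[R]_4) (t : R) := if 0 <= t <= 1 then h t else 0.
(* The increments of [S] along the three edges of a triangle add up to zero with their signs, so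
   subtracting them from the actions leaves the chain area unchanged, whatever [S] is off [L]. *)
pose r (g : R -> 'rV[R]_4) := path_action g - (S (g 1) - S (g 0)).
have resE h t : 0 <= t <= 1 -> res h t = h t by rewrite /res => ->.
have r_res h : r (res h) = r h.
  rewrite /r (@eq_path_action _ (res h) h); last exact: resE.
  by rewrite !resE ?lexx ?ler01.
pose T : seq (int * (R -> 'rV[R]_4)) := flatten
  [seq [seq (x.1 * (-1) ^+ (nat_of_ord i), res (fun t => x.2 (face i t)))
       | i <- enum 'I_3] | x <- c].
have sumT (V : zmodType) (G : int * (R -> 'rV[R]_4) -> V) : \sum_(p <- T) G p =
    \sum_(x <- c) \sum_(i < 3) G (x.1 * (-1) ^+ i, res (fun t => x.2 (face i t))).
  rewrite /T big_flatten/= big_map; apply: eq_bigr => x _.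
  by rewrite big_map big_enum.
have -> : chain_area c = \sum_(p <- T) p.1%:~R * r p.2.
  rewrite sumT /chain_area; apply: eq_big_seq => x xc.
  have [[U [oU DU Us]] _] := cX x xc.
  rewrite (simplex_area_boundary oU DU Us).
  under [RHS]eq_bigr do rewrite /= r_res /r intrM -mulrA mulrBr.
  rewrite -mulr_sumr; congr (_ * _).
  under [RHS]eq_bigr do rewrite rmorphXn /= rmorphN1.
  rewrite sumrB -[LHS]subr0; congr (_ - _).
  rewrite alternating_sum3 /face /= subr0 subrr.
  by move: (S _) (S _) (S _) => *; ring.
apply: grouped_sum_int => p pT.
have [x xc [i pE]] : exists2 x, x \in c & exists i : 'I_3,
    p = (x.1 * (-1) ^+ i, res (fun t => x.2 (face i t))).
  move: pT => /flatten_mapP[x xc /mapP[i _ ->]]; exists x => //; by exists i.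
rewrite {}pE /= r_res => nz; apply: (HS x.2 i (cX x xc)) => t t01.
apply: (cL (fun t => x.2 (face i t))) => //.
apply: contra_neq nz => bc0; rewrite -[RHS]bc0 sumT /boundary_coef.
apply: eq_bigr => y _; rewrite mulr_sumr; apply: eq_bigr => j _ /=.
rewrite -mulrA; congr (_ * (_ * _%:R)); congr nat_of_bool.
apply/eqP/asboolP => [E u u01|E].
  by have := congr1 (fun h => h u) E; rewrite !resE.
by apply/funext => u; rewrite /res; case: ifP => // /E.
Qed.

End IntegralChains.

(** * Periods of an embedded Lagrangian torus *)

Section Periods.
Context {R : realType}.

Lemma trig_period_int (x k : R) : k \is a Num.int ->
  cos (2 * pi * (x + k)) = cos (2 * pi * x) /\
  sin (2 * pi * (x + k)) = sin (2 * pi * x).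
Proof.
have nat_case (y : R) (n : nat) : cos (2 * pi * (y + n%:R)) = cos (2 * pi * y) /\
    sin (2 * pi * (y + n%:R)) = sin (2 * pi * y).
  have -> : 2 * pi * (y + n%:R) = 2 * pi * y + pi *+ 2 *+ n.
    by rewrite -[_ *+ n]mulr_natr -[pi *+ 2]mulr_natr; ring.
  by rewrite (periodicn (@cosD2pi R)) (periodicn (@sinD2pi R)).
move=> /intrP[[n|n] ->]; first exact: nat_case.
have := nat_case (x + (Negz n)%:~R) n.+1.
by rewrite NegzE mulrNz -addrA addNr addr0 => -[-> ->].
Qed.

(** The fractional part [r] of [x - y] satisfies [cos (2 * pi * r) = 1], that is [sin (pi * r) = 0],
    whereas the sine is positive strictly between 0 and [pi]. *)
Lemma trig_eq_int (x y : R) : cos (2 * pi * x) = cos (2 * pi * y) ->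
  sin (2 * pi * x) = sin (2 * pi * y) -> x - y \is a Num.int.
Proof.
move=> cxy sxy; pose d := x - y.
have cd : cos (2 * pi * d) = 1.
  have -> : 2 * pi * d = 2 * pi * x - 2 * pi * y by rewrite /d; ring.
  by rewrite cosB cxy sxy -!expr2 cos2Dsin2.
pose k : R := (Num.floor d)%:~R; pose r := d - k.
have kint : k \is a Num.int by exact: intr_int.
have /andP[r0 r1] : 0 <= r < 1.
  rewrite /r /k subr_ge0 floor_le //= ltrBlDl.
  by have := floorD1_gt d; rewrite intrD addrC.
have cr : cos (2 * pi * r) = 1.
  have [<- _] := trig_period_int r kint.
  by rewrite /r subrK.
have sr : sin (pi * r) = 0.
  have E : pi * r *+ 2 = 2 * pi * r by rewrite -[LHS]mulr_natl mulrA.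
  move: cr; rewrite -E cos_mulr2n cos2sin2 => h2.
  by apply/eqP; rewrite -sqrf_eq0; apply/eqP; lra.
have [r00|rn0] := eqVneq r 0.
  by rewrite -/d -[d](subrK k) -/r r00 add0r.
have : 0 < sin (pi * r).
  apply: sin_gt0_pi; apply/andP; split; last by rewrite gtr_pMr ?pi_gt0.
  by apply: mulr_gt0; [exact: pi_gt0|rewrite lt_def rn0].
by rewrite sr ltxx.
Qed.

Lemma near0_norm (n : nat) (d : R) : 0 < d ->
  \forall h \near (0 : 'rV[R]_n), `|h| < d.
Proof.
move=> d0; apply/nbhs_normP; exists d => // h /=.
by rewrite /ball_ /= sub0r normrN.
Qed.

Lemma dist_continuous (V : normedModType R) (u0 : V) :
  continuous (fun u : V => `|u - u0|).
Proof.
move=> u; apply: (@cvg_comp _ _ _ (fun u : V => u - u0) (fun w => `|w|)).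
  by apply: cvgB; [exact: cvg_id|exact: cvg_cst].
exact: norm_continuous.
Qed.

(** An increment that is negligible against that of a derivable [h] is negligible against the
    increment of the parameter. It serves to differentiate functions defined through a lift whose
    derivative is not at hand. *)
Lemma derive0_dominated (W : normedModType R) (f : R -> R) (h : R -> W) (t : R) :
  derivable h t 1 ->
  (forall e : R, 0 < e -> \forall s \near t, `|f s - f t| <= e * `|h s - h t|) ->
  is_derive t 1 f 0.
Proof.
move=> dh Hf.
pose M := `|'D_1 h t| + 1.
have M0 : 0 < M by rewrite ltr_wpDl.
have hM : \forall r \near (0 : R)^', `|r^-1 *: (h (r *: 1 + t) - h t)| <= M.
  have /cvgrPdist_le/(_ 1 ltr01) : r^-1 *: (h (r *: 1 + t) - h t) @[r --> (0:R)^'] -->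
    'D_1 h t by exact: dh.
  apply: filterS => r; rewrite /M => Hr.
  by rewrite -lerBlDl; apply: le_trans Hr; rewrite distrC; exact: lerB_dist.
suff H : r^-1 *: (f (r *: 1 + t) - f t) @[r --> (0:R)^'] --> (0 : R).
  by split; [apply/cvg_ex; exists 0|apply/cvg_lim].
apply/cvgrPdist_le => e e0.
have eM : 0 < e / M by rewrite divr_gt0.
have shift : \forall r \near (0 : R)^', `|f (r + t) - f t| <= e / M * `|h (r + t) - h t|.
  have H0 : r + t @[r --> (0:R)^'] --> t.
    have : r + t @[r --> (0:R)] --> 0 + t by apply: cvgD; [exact: cvg_id|exact: cvg_cst].
    by rewrite add0r => H; apply: cvg_trans H; apply: cvg_app; exact: cvg_within.
  exact: H0 _ (Hf _ eM).
near=> r.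
have r0 : r != 0 by near: r; exact: nbhs_dnbhs_neq.
rewrite sub0r normrN [r *: 1]mulr1 normrZ.
have Hr : `|r^-1 *: (h (r *: 1 + t) - h t)| <= M by near: r.
have Hr' : `|f (r + t) - f t| <= e / M * `|h (r + t) - h t| by near: r.
move: Hr; rewrite [r *: 1]mulr1 normrZ => Hr.
apply: (@le_trans _ _ (e / M * (`|r^-1| * `|h (r + t) - h t|))).
  by rewrite mulrCA ler_wpM2l.
apply: (@le_trans _ _ (e / M * M)); first by rewrite ler_wpM2l// ltW.
by rewrite divfK// gt_eqF.
Unshelve. all: by end_near. Qed.

End Periods.

(** * Doubly periodic immersions of the plane *)

Section ImmersedTorus.
Context {R : realType}.
Local Notation mu := (@lebesgue_measure R).
Local Notation e0 := (@point2 R 1 0).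
Local Notation e1 := (@point2 R 0 1).
Variables (Phi : 'rV[R]_2 -> 'rV[R]_4) (S : 'rV[R]_2 -> R) (c : R).
Hypothesis c0 : 0 < c.
Hypothesis CPhi : forall k, Ck setT k Phi.
Hypothesis CS : Ck setT 1 S.
Hypothesis immersion : forall u v : 'rV[R]_2, 'D_v Phi u = 0 -> v = 0.
(** The period lattice appears only through this hypothesis and the next one. In the application
    [c = pi] and the norm is the maximum norm, so the closed ball of radius [c] is a full period
    square and [Phi] is injective on its interior. *)
Hypothesis periodic : forall u0 u : 'rV[R]_2, exists u' : 'rV[R]_2,
  [/\ `|u' - u0| <= c, Phi u' = Phi u & S u' - S u \is a Num.int].
Hypothesis embedding : forall u u' : 'rV[R]_2, Phi u = Phi u' -> `|u - u'| < 2 * c -> u = u'.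
Hypothesis dS : forall u v : 'rV[R]_2, 'D_v S u = liouville (Phi u) ('D_v Phi u).

Let coord (j : 'I_4) (u : 'rV[R]_2) : R := Phi u 0 j.
Let Ccoord k j : Ck setT k (coord j).
Proof. exact: (Ck_mxP k Phi openT).1. Qed.

Let derivable_Phi u v : derivable Phi u v.
Proof. exact: ((CPhi 1).2.1 u v I). Qed.

Let derive_Phi u v j : ('D_v Phi u) 0 j = 'D_v (coord j) u.
Proof. by rewrite derive_mx ?mxE. Qed.

Let continuous_Phi : continuous Phi.
Proof. by move=> u; exact: (CPhi 0).1 u I. Qed.

Let derive_Phi_linear u v : 'D_v Phi u = v 0 0 *: 'D_e0 Phi u + v 0 1 *: 'D_e1 Phi u.
Proof.
apply/rowP => j; rewrite derive_Phi (C1_derive_linear v openT (Ccoord 1 j) I).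
rewrite [RHS]mxE [X in _ = X + _]mxE [X in _ = _ + X]mxE.
by congr (_ * _ + _ * _); apply/esym; exact: derive_Phi.
Qed.

(** ['D_v Phi u] is linear in [v] and vanishes only at 0, so its norm has a positive minimum on the
    compact unit sphere; homogeneity does the rest. *)
Lemma immersion_lower_bound u : exists2 m : R, 0 < m &
  forall v, m * `|v| <= `|'D_v Phi u|.
Proof.
pose A := [set v : 'rV[R]_2 | `|v| = 1].
have cA : compact A.
  apply: bounded_closed_compact.
    by exists 1; split; [exact: num_real|move=> M M1 v /= ->; exact: ltW].
  apply: (@preimage_closed _ _ (fun v : 'rV[R]_2 => `|v|) [set x | x = 1] _ (@closed_eq R 1)).
  by move=> v _; exact: norm_continuous.
have A0 : A !=set0.
  exists (point2 1 1); rewrite /A/=; apply/eqP; rewrite eq_le.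
  rewrite norm_point2 ?normr1//=.
  by have := norm_coord (point2 1 1 : 'rV[R]_2) 0; rewrite point20 normr1.
have cD : continuous (fun v => `|'D_v Phi u|).
  move=> v.
  have -> : (fun v => `|'D_v Phi u|) =
      (fun v : 'rV[R]_2 => `|v 0 0 *: 'D_e0 Phi u + v 0 1 *: 'D_e1 Phi u|).
    by apply/funext => w; rewrite derive_Phi_linear.
  have cl (p q : 'rV[R]_4) : continuous (fun v : 'rV[R]_2 => v 0 0 *: p + v 0 1 *: q).
    move=> w; have FF : Filter (nbhs w) by exact: (nbhs_filter (w : 'rV[R]_2)).
    by apply: cvgD; apply: cvgZr_tmp; exact: coord_continuous.
  exact: (continuous_comp (cl _ _ v) (@norm_continuous _ _ _)).
have [w wA Hw] := EVT_min_rV A0 cA (continuous_subspaceT cD).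
rewrite inE /A /= in wA.
exists `|'D_w Phi u|.
  rewrite normr_gt0; apply/eqP => /immersion w0.
  by move: wA; rewrite w0 normr0 => /eqP; rewrite eq_sym oner_eq0.
move=> v; have [->|v0] := eqVneq v 0; first by rewrite normr0 mulr0.
have nv : 0 < `|v| by rewrite normr_gt0.
have Av : `|v|^-1 *: v \in A.
  by rewrite inE /A /= normrZ normfV normr_id mulVf// gt_eqF.
have := Hw _ Av.
have -> : 'D_(`|v|^-1 *: v) Phi u = `|v|^-1 *: 'D_v Phi u.
  rewrite (derive_Phi_linear u (`|v|^-1 *: v)) (derive_Phi_linear u v).
  have lin (a b k : R) (p q : 'rV[R]_4) :
      (k * a) *: p + (k * b) *: q = k *: (a *: p + b *: q).
    by rewrite scalerDr !scalerA.
  by apply: etrans (lin _ _ _ _ _); congr (_ *: _ + _ *: _); exact: mxE.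
by rewrite normrZ normfV normr_id ler_pdivlMl// mulrC.
Qed.

Lemma Phi_expansion u (e : R) : 0 < e -> \forall h \near (0 : 'rV[R]_2),
  `|Phi (u + h) - Phi u - 'D_h Phi u| <= e * `|h|.
Proof.
move=> ep.
have Hj j : \forall h \near (0 : 'rV[R]_2),
    `|coord j (u + h) - coord j u - 'D_h (coord j) u| <= e * `|h|.
  have [d d0 Hd] := C1_expansion openT (Ccoord 1 j) (I : setT u) ep.
  near=> h; rewrite (C1_derive_linear h openT (Ccoord 1 j) I); apply: Hd.
  by near: h; exact: near0_norm.
near=> h; rewrite [leLHS]/Num.Def.normr/= mx_normrE.
apply: bigmax_le; first by rewrite mulr_ge0// ltW.
move=> [i j] _; rewrite !mxE/= (ord1 i) derive_Phi.
move: j {i}; near: h; exact: filter_forall.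
Unshelve. all: by end_near. Qed.

Lemma S_expansion u (e : R) : 0 < e -> \forall h \near (0 : 'rV[R]_2),
  `|S (u + h) - S u - 'D_h S u| <= e * `|h|.
Proof.
move=> ep; have [d d0 Hd] := C1_expansion openT CS (I : setT u) ep.
near=> h; rewrite (C1_derive_linear h openT CS I); apply: Hd.
by near: h; exact: near0_norm.
Unshelve. all: by end_near. Qed.

(* This allows [S] to be differentiated along a path in the torus through a
   lift that is only known to be continuous. *)
Lemma potential_expansion u (e : R) : 0 < e -> \forall v \near u,
  `|S v - S u - liouville (Phi u) (Phi v - Phi u)| <= e * `|Phi v - Phi u|.
Proof.
move=> ep; have [m m0 Hm] := immersion_lower_bound u.
pose M := 1 + (`|Phi u 0 0| + `|Phi u 0 2|).
have M0 : 0 < M by rewrite ltr_wpDr// addr_ge0.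
have m2 : 0 < m / 2 by rewrite divr_gt0.
(* Half of [m] is lost to the first-order error of [Phi], so the displacement of [Phi] is at least
   [m / 2] times the norm of [h]. The factor [M] collects the error of [S] and the two coordinate
   errors inside [liouville]. *)
pose e' := e * (m / 2) / M.
have e'0 : 0 < e' by rewrite divr_gt0// mulr_gt0.
have near0 : \forall h \near (0 : 'rV[R]_2),
    `|S (u + h) - S u - liouville (Phi u) (Phi (u + h) - Phi u)| <=
    e * `|Phi (u + h) - Phi u|.
  near=> h.
  have H1 : `|Phi (u + h) - Phi u - 'D_h Phi u| <= m / 2 * `|h|.
    by near: h; exact: Phi_expansion.
  have H2 : `|Phi (u + h) - Phi u - 'D_h Phi u| <= e' * `|h|.
    by near: h; exact: Phi_expansion.
  have H3 : `|S (u + h) - S u - 'D_h S u| <= e' * `|h|.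
    by near: h; exact: S_expansion.
  have hle : m / 2 * `|h| <= `|Phi (u + h) - Phi u|.
    have := Hm h; have : `|'D_h Phi u| <= `|Phi (u + h) - Phi u| + m / 2 * `|h|.
      apply: (@le_trans _ _ (`|Phi (u + h) - Phi u| + `|Phi (u + h) - Phi u - 'D_h Phi u|)).
        rewrite -{1}['D_h Phi u](subKr (Phi (u + h) - Phi u)).
        exact: ler_normB.
      by rewrite lerD2l.
    by move: (`|Phi _ - _|) (`|'D_h Phi u|) (`|h|) => a b x; lra.
  pose w := Phi (u + h) - Phi u.
  have wE j : `|w 0 j - 'D_h Phi u 0 j| <= e' * `|h|.
    apply: le_trans H2; rewrite -/w [leRHS]/Num.Def.normr/= mx_normrE.
    have := @le_bigmax _ _ _ 0 (fun ij => `|(w - 'D_h Phi u) ij.1 ij.2|) (0, j).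
    by rewrite /= !mxE.
  have E : S (u + h) - S u - liouville (Phi u) w =
    (S (u + h) - S u - 'D_h S u) - (Phi u 0 0 * (w 0 1 - 'D_h Phi u 0 1) +
      Phi u 0 2 * (w 0 3 - 'D_h Phi u 0 3)).
    rewrite (dS u h) /liouville.
    by move: (S (u + h)) (S u) (Phi u 0 0) (Phi u 0 2) (w 0 1) (w 0 3)
      ('D_h Phi u 0 1) ('D_h Phi u 0 3) => *; ring.
  rewrite -/w E.
  apply: (@le_trans _ _ (M * (e' * `|h|))).
    apply: le_trans (ler_normB _ _) _; rewrite /M mulrDl mul1r; apply: lerD => //.
    apply: le_trans (ler_normD _ _) _; rewrite !normrM mulrDl; apply: lerD.
      by apply: ler_wpM2l => //; exact: wE.
    by apply: ler_wpM2l => //; exact: wE.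
  have -> : M * (e' * `|h|) = e * (m / 2 * `|h|).
    rewrite /e' -[RHS](mulfVK (lt0r_neq0 M0)) !mulrA.
    by move: (M) (M^-1) (`|h|) => p q r; ring.
  by rewrite ler_pM2l.
have [d /= d0 Hd] := (nbhs_normP _ _).1 near0.
apply/nbhs_normP; exists d => // v; rewrite /ball_ /= => vd.
have := Hd (v - u); rewrite /ball_ /= sub0r normrN distrC => /(_ vd).
by rewrite [u + _]addrC subrK.
Unshelve. all: by end_near. Qed.

(** This is continuity of the inverse of [Phi]. The points at distance between [e] and [c] from [u0]
    form a compact set whose image misses [Phi u0] by [embedding]; [W] is the complement of that
    image. The representative that [periodic] gives within [c] of [u0] is then closer than [e]. *)
Lemma local_lift u0 (e : R) : 0 < e -> exists W : set 'rV[R]_4,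
  [/\ open W, W (Phi u0) & forall u, W (Phi u) -> exists u',
    [/\ `|u' - u0| < e, Phi u' = Phi u & S u' - S u \is a Num.int]].
Proof.
move=> ep; pose A := [set u | e <= `|u - u0| <= c].
have cn : continuous (fun u : 'rV[R]_2 => `|u - u0|).
  exact: dist_continuous.
have cA : compact A.
  apply: bounded_closed_compact.
    exists (c + `|u0|); split; first exact: num_real.
    move=> M hM u /andP[_ uc]; apply: le_trans (ltW hM).
    by rewrite -[u in leLHS](subrK u0); apply: le_trans (ler_normD _ _) _; rewrite lerD2r.
  have -> : A = [set u | e <= `|u - u0|] `&` [set u | `|u - u0| <= c].
    by apply/seteqP; split=> u /andP.
  apply: closedI.
    exact: (@preimage_closed _ _ (fun u : 'rV[R]_2 => `|u - u0|) [set x | e <= x]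
      (fun x _ => cn x) (@closed_ge R e)).
  exact: (@preimage_closed _ _ (fun u : 'rV[R]_2 => `|u - u0|) [set x | x <= c]
      (fun x _ => cn x) (@closed_le R c)).
have cPA : compact (Phi @` A).
  by apply: continuous_compact => //; exact: continuous_subspaceT.
exists (~` (Phi @` A)); split.
- by apply: closed_openC; apply: compact_closed => //; exact: norm_hausdorff.
- move=> [u /andP[eu uc] uE].
  have uu : u = u0.
    apply: embedding => //; apply: le_lt_trans uc _.
    by rewrite mulr_natl mulr2n ltrDl.
  by move: eu; rewrite uu subrr normr0 leNgt ep.
- move=> u nA; have [u' [u'c u'E u'S]] := periodic u0 u.
  exists u'; split => //; rewrite ltNge; apply/negP => eu'.
  by apply: nA; exists u' => //; apply/andP.
Qed.

(** [U] is the open ball of radius [c] and [W] the complement of the image of its boundary sphere. A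
    point of the torus has a representative in the closed ball, and in [W] that representative lies
    in [U]. *)
Lemma torus_local_parametrization u0 : exists U,
  local_parametrization (range Phi) (Phi u0) U Phi.
Proof.
pose U := [set u : 'rV[R]_2 | `|u - u0| < c].
have oU : open U.
  have -> : U = ball u0 c.
    by apply/seteqP; split=> u; rewrite /U /= -ball_normE /ball_ /= distrC.
  exact: ball_open.
have injU u u' : U u -> U u' -> Phi u = Phi u' -> u = u'.
  move=> Uu Uu' E; apply: embedding => //.
  have -> : u - u' = (u - u0) - (u' - u0) by rewrite opprB addrA subrK.
  apply: le_lt_trans (ler_normB _ _) _; rewrite mulr_natl mulr2n.
  exact: ltrD Uu Uu'.
have smoothPhi V : smooth_on V Phi.
  have /smooth_onP H : forall k, Ck setT k Phi by [].
  by move=> vs x _; exact: H.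
pose B := [set u : 'rV[R]_2 | `|u - u0| = c].
exists U; split => //.
  by move=> u v _; exact: immersion.
have cB : compact (Phi @` B).
  apply: continuous_compact; first exact: continuous_subspaceT.
  apply: bounded_closed_compact.
    exists (c + `|u0|); split; first exact: num_real.
    move=> M hM u uc; apply: le_trans (ltW hM); rewrite -uc.
    by rewrite -[u in leLHS](subrK u0); exact: ler_normD.
  apply: (@preimage_closed _ _ (fun u : 'rV[R]_2 => `|u - u0|) [set x | x = c] _ (@closed_eq R c)).
  by move=> u _; exact: dist_continuous.
have PU u : U u -> ~ (Phi @` B) (Phi u).
  move=> Uu [u' Bu' E]; have uu : u' = u.
    apply: embedding => //.
    have -> : u' - u = (u' - u0) - (u - u0) by rewrite opprB addrA subrK.
    apply: le_lt_trans (ler_normB _ _) _; rewrite mulr_natl mulr2n.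
    by rewrite Bu' ltrD2l; exact: Uu.
  by move: Uu Bu'; rewrite uu /U /B /= => + E'; rewrite E' ltxx.
exists (~` (Phi @` B)); split.
- by apply: closed_openC; apply: compact_closed => //; exact: norm_hausdorff.
- by apply: PU; rewrite /U /= subrr normr0.
- apply/seteqP; split=> [z [u Uu <-]|z [[u _ <-] nB]].
    by split; [exists u|exact: PU].
  have [u' [u'c u'E _]] := periodic u0 u.
  exists u' => //; rewrite /U /= lt_neqAle u'c andbT; apply/eqP => E.
  by apply: nB; exists u'.
pose g z := xget 0 [set u | U u /\ Phi u = z].
have gK u : U u -> g (Phi u) = u.
  move=> Uu; apply: xget_unique => // u' [Uu' E]; exact: injU.
exists g; split => //.
apply/subspace_continuousP => z [[v _ <-] nB].
have [u [Uu uE]] : exists u, U u /\ Phi u = Phi v.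
  have [u' [u'c u'E _]] := periodic u0 v.
  exists u'; split => //; rewrite /U /= lt_neqAle u'c andbT; apply/eqP => E.
  by apply: nB; exists u'.
rewrite -uE -[X in _ --> X]/(g (Phi u)) gK//; apply/cvgrPdist_lt => e ep.
have : \forall x \near u, U x by exact: open_nbhs_nbhs.
move=> /nbhs_normP[d /= d0 Hd].
have ed : 0 < Num.min e d by rewrite lt_min ep.
have [V [oV Vu HV]] := local_lift u ed.
have nV : nbhs (Phi u) V by exact: open_nbhs_nbhs.
rewrite /within /=; apply: filterS nV => w Vw [[v' _ v'E] _].
move: Vw; rewrite -v'E => /HV[u' [u'd u'E _]]; move: u'd; rewrite lt_min => /andP[u'e u'd].
suff : `|u - g (Phi v')| < e by [].
by rewrite -u'E gK; [rewrite distrC|apply: Hd; rewrite /ball_ /= distrC].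
Qed.

Lemma torus_lagrangian :
  (forall u v w : 'rV[R]_2, omega ('D_v Phi u) ('D_w Phi u) = 0) -> lagrangian (range Phi).
Proof.
move=> iso; split.
- by exists (Phi 0); exists 0.
- have -> : range Phi = Phi @` [set u : 'rV[R]_2 | `|u - 0| <= c].
    apply/seteqP; split=> z [u uc <-]; last by exists u.
    by have [u' [u'c u'E _]] := periodic 0 u; exists u'.
  apply: continuous_compact; first exact: continuous_subspaceT.
  apply: bounded_closed_compact.
    exists c; split; first exact: num_real.
    by move=> M cM u /=; rewrite subr0 => uc; exact: le_trans uc (ltW cM).
  apply: (@preimage_closed _ _ (fun u : 'rV[R]_2 => `|u - 0|) [set x | x <= c] _ (@closed_le R c)).
  by move=> u _; exact: dist_continuous.
- move=> p [u0 _ <-]; have [U LU] := torus_local_parametrization u0.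
  by exists U, Phi; split => // u v w _; exact: iso.
Qed.

(** An arbitrary preimage is selected, so this function jumps; two preimages of a point give values
    of [S] differing by an integer. *)
Definition torus_potential (z : 'rV[R]_4) : R := S (xget 0 [set u | Phi u = z]).

Section Path.
Variables g dg : R -> 'rV[R]_4.
Hypothesis gL : forall t : R, t \in `[0, 1] -> range Phi (g t).
Hypothesis dgE : forall t : R, t \in `[0, 1] -> is_derive t 1 g (dg t).
Hypothesis cg : {within `[(0:R), 1], continuous (fun t => liouville (g t) (dg t))}.

(** Near [t0] the path is lifted to the preimages closer than [c] to [u0], and [q] is the branch of
    the potential along this lift. The last clause expresses that the lift tends to [u0] without
    naming it. Everything is relative to [[0, 1]], since outside it the path may leave the torus. *)
Lemma local_path_lift (t0 : R) : t0 \in `[0, 1] -> exists (u0 : 'rV[R]_2) (q : R -> R),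
  [/\ Phi u0 = g t0, q t0 = S u0,
    \forall t \near t0, t \in `[0, 1] -> q t - torus_potential (g t) \is a Num.int &
    forall P : set 'rV[R]_2, (\forall v \near u0, P v) ->
      \forall t \near t0, t \in `[0, 1] -> exists v, [/\ P v, Phi v = g t & S v = q t]].
Proof.
move=> t01; have [u0 _ u0E] := gL t01.
pose lift t := xget u0 [set u | `|u - u0| < c /\ Phi u = g t].
have liftE t v : `|v - u0| < c -> Phi v = g t -> lift t = v.
  move=> vc vE; apply: xget_unique => // v' [v'c v'E].
  apply: embedding; first by rewrite vE.
  have -> : v' - v = (v' - u0) - (v - u0) by rewrite opprB addrA subrK.
  by apply: le_lt_trans (ler_normB _ _) _; rewrite mulr_natl mulr2n; exact: ltrD.
have cgt : {for t0, continuous g}.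
  by apply/differentiable_continuous/derivable1_diffP; case: (dgE t01).
have main (P : set 'rV[R]_2) : (\forall v \near u0, P v) ->
    \forall t \near t0, t \in `[0, 1] -> [/\ P (lift t), Phi (lift t) = g t &
      S (lift t) - torus_potential (g t) \is a Num.int].
  move=> /nbhs_normP[d /= d0 Hd].
  have dc : 0 < Num.min d c by rewrite lt_min d0.
  have [W [oW Wu HW]] := local_lift u0 dc.
  have nW : nbhs (g t0) W by apply: open_nbhs_nbhs; split; rewrite -?u0E.
  have nWt : nbhs t0 (g @^-1` W) := cgt _ nW.
  apply: filterS nWt => t Wt tt.
  have gt : Phi (xget 0 [set u | Phi u = g t]) = g t.
    by have [v _ vE] := gL tt; apply: (@xgetPex _ 0 [set u | Phi u = g t]); exists v.
  have [|v [vd vE vS]] := HW (xget 0 [set u | Phi u = g t]); first by rewrite gt.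
  move: vd; rewrite lt_min => /andP[vd vc].
  have -> : lift t = v by apply: liftE => //; rewrite vE.
  split => //; last by rewrite vE.
  by apply: Hd; rewrite /ball_ /= distrC.
exists u0, (S \o lift); split => //.
- by rewrite /= (liftE t0 u0)// subrr normr0.
- have nm := main setT (@filterT _ _ (nbhs_filter u0)).
  by apply: filterS nm => t Ht tt; have [] := Ht tt.
- move=> P /main nm; apply: filterS nm => t Ht tt; have [Pt PhiE _] := Ht tt.
  by exists (lift t).
Qed.

Let lam t := liouville (g t) (dg t).
Let J x := parameterized_integral mu 0 x lam.

(** A function of period 1 hides the jumps of [torus_potential], so that locally the branch [q] may
    take its place. Then [q - J] has derivative zero, because [S] is a primitive of the Liouville
    form on the torus. *)
Lemma trig_potential_cst (phi dphi : R -> R) :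
  (forall x : R, is_derive x 1 phi (dphi x)) ->
  (forall x k : R, k \is a Num.int -> phi (x + k) = phi x) ->
  phi (torus_potential (g 1) - J 1) = phi (torus_potential (g 0) - J 0).
Proof.
move=> dphiE phi_per; pose C t := phi (torus_potential (g t) - J t).
have cphi : continuous phi.
  by move=> x; apply/differentiable_continuous/derivable1_diffP; case: (dphiE x).
have CE q t : q t - torus_potential (g t) \is a Num.int -> C t = phi (q t - J t).
  move=> qi; rewrite /C -(phi_per (torus_potential (g t) - J t) _ qi).
  by congr phi; ring.
have cJ : {within `[(0:R), 1], continuous J}.
  by apply: parameterized_integral_continuous => //; exact: segment_integrable.
have cC : {within `[(0:R), 1], continuous C}.
  apply/subspace_continuousP => t0 /= t01.
  have [u0 [q [u0E q0 qint qP]]] := local_path_lift t01.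
  have qt0 : C t0 = phi (q t0 - J t0) by apply: CE; exact: (nbhs_singleton qint).
  rewrite -[X in _ --> X]/(C t0) qt0.
  have : phi (q t - J t) @[t --> within `[(0:R), 1] (nbhs t0)] --> phi (q t0 - J t0).
    apply: (@cvg_comp _ _ _ (fun t => q t - J t) phi _ (nbhs (q t0 - J t0))); last exact: cphi.
    apply: cvgB; last by move/subspace_continuousP : cJ; exact.
    apply/cvgrPdist_lt => e e0.
    have cS : \forall v \near u0, `|S u0 - S v| < e.
      by have /cvgrPdist_lt := CS.1 u0 I; exact.
    have := qP _ cS; rewrite /prop_near1 /within /=; apply: filterS => t H tt.
    by rewrite q0; have [v [? _ <-]] := H tt.
  apply: cvg_trans; apply: near_eq_cvg; rewrite /prop_near1 /within /=.
  by apply: filterS qint => t H tt; apply/esym/CE/H.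
have dC (t0 : R) : t0 \in `]0, 1[ -> is_derive t0 1 C 0.
  move=> t01; have t01' : t0 \in `[(0:R), 1] by exact: subset_itv_oo_cc.
  have [u0 [q [u0E q0 qint qP]]] := local_path_lift t01'.
  have nt : \forall t \near t0, t \in `[(0:R), 1].
    near=> t; apply: subset_itv_oo_cc; near: t; exact: near_in_itvoo.
  pose rho t := q t - liouville (g t0) (g t).
  have liouvilleB p v w : liouville p (v - w) = liouville p v - liouville p w.
    by rewrite /liouville !mxE; ring.
  have drho : is_derive t0 1 rho 0.
    apply: (@derive0_dominated R _ rho g); first by case: (dgE t01').
    move=> e e0; have := qP _ (potential_expansion u0 e0).
    apply: filterS2 nt => t tt H; have [v [+ vE vS]] := H tt.
    rewrite vS vE u0E liouvilleB /rho q0.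
    by congr (`|_| <= _); ring.
  have dg_coord j : is_derive t0 1 (fun t => g t 0 j) (dg t0 0 j).
    have [dgt <-] := dgE t01'; split; first exact: (derivable_mxP _ _ _).1 dgt 0 j.
    by rewrite derive_mx// mxE.
  have dlin : is_derive t0 1 (fun t => liouville (g t0) (g t)) (lam t0).
    have h1 := @is_deriveZ R R R _ (g t0 0 0) t0 1 _ (dg_coord 1).
    have h3 := @is_deriveZ R R R _ (g t0 0 2) t0 1 _ (dg_coord 3).
    exact: is_deriveD h1 h3.
  have dq : is_derive t0 1 q (lam t0).
    have -> : q = (fun t => rho t + liouville (g t0) (g t)).
      by apply/funext => t; rewrite /rho subrK.
    by have := is_deriveD drho dlin; rewrite add0r.
  have dJ : is_derive t0 1 J (lam t0).
    have /(continuous_within_itvP _ ltr01)[cl _ _] := cg.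
    have /andP[t0p t0l] : 0 < t0 < 1 by move: t01; rewrite in_itv.
    have [h1 h2] := continuous_FTC1_closed t0l (segment_integrable cg) t0p (cl t0 t01).
    by split; [exact: h1|rewrite -derive1E; exact: h2].
  have dqJ : is_derive t0 1 (fun t => q t - J t) 0.
    by have := is_deriveB dq dJ; rewrite subrr.
  have dphiq : is_derive t0 1 (fun t => phi (q t - J t)) 0.
    by have := is_derive_comp1 dqJ (dphiE _); rewrite mulr0.
  apply: near_eq_is_derive dphiq.
  by apply: filterS2 nt qint => t tt H; apply/esym/CE/H.
have [t _] := @MVT R C (cst 0) 0 1 ltr01 dC cC.
by rewrite /= mul0r => /eqP; rewrite subr_eq0 => /eqP.
Unshelve. all: by end_near. Qed.

Lemma torus_path_action :
  path_action g - (torus_potential (g 1) - torus_potential (g 0)) \is a Num.int.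
Proof.
have J0 : J 0 = 0 by rewrite /J /parameterized_integral set_itv1 Rintegral_set1.
have J1 : J 1 = path_action g.
  rewrite /J /parameterized_integral -(Rintegral_itvoo cg).
  apply: eq_Rintegral => t; rewrite inE/= => /subset_itv_oo_cc t01.
  by have [_ ->] := dgE t01.
have dcos (x : R) : is_derive x 1 (fun x => cos (2 * pi * x)) (- sin (2 * pi * x) * (2 * pi)).
  apply: is_derive_comp1.
  by have := @is_deriveZ R R R id (2 * pi) x 1 1 (is_derive_id _ _); rewrite [_ *: 1]mulr1.
have dsin (x : R) : is_derive x 1 (fun x => sin (2 * pi * x)) (cos (2 * pi * x) * (2 * pi)).
  apply: is_derive_comp1.
  by have := @is_deriveZ R R R id (2 * pi) x 1 1 (is_derive_id _ _); rewrite [_ *: 1]mulr1.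
have Ec := trig_potential_cst dcos (fun x k kint => (trig_period_int x kint).1).
have Es := trig_potential_cst dsin (fun x k kint => (trig_period_int x kint).2).
have := trig_eq_int Ec Es; rewrite J0 J1 subr0 => H.
have E (x y z : R) : x - (y - z) = - (y - x - z) by ring.
by rewrite E rpredN.
Qed.

End Path.

Lemma torus_integral_lagrangian (X : set 'rV[R]_4) :
  (forall u v w : 'rV[R]_2, omega ('D_v Phi u) ('D_w Phi u) = 0) -> range Phi `<=` X ->
  integral_lagrangian X (range Phi).
Proof.
move=> iso sub; split => //; first exact: torus_lagrangian.
move=> C; apply: (chain_area_int (S := torus_potential)).
move=> s i [[U [oU DU Us]] _] sL.
have in01 (t : R) : t \in `[0, 1] -> 0 <= t <= 1 by rewrite in_itv.
apply: (@torus_path_action (fun t => s (face i t)) (fun t => 'D_(edge i) s (face i t))).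
- by move=> t /in01; exact: sL.
- by move=> t /in01 t01; exact: (is_derive_face DU Us i t01).
- exact: (liouville_face_continuous oU DU Us).
Qed.

End ImmersedTorus.

(** * A rounded square *)

Lemma is_derive_ext (R : realType) (V : normedModType R) (f g : V -> R) (x v : V) (df dg : R) :
  is_derive x v f df -> (forall y, f y = g y) -> df = dg -> is_derive x v g dg.
Proof. by move=> D /funext <- <-. Qed.

(** * Antiderivatives on the whole line *)

Section Antiderivative.
Context {R : realType}.
Local Notation mu := (@lebesgue_measure R).

Lemma derive0_cst (f : R -> R) (a b : R) : a <= b ->
  (forall x : R, x \in `[a, b] -> is_derive x 1 f 0) -> f a = f b.
Proof.
rewrite le_eqVlt => /predU1P[->//|ab] df.
have cf : {within `[a, b], continuous f}.
  apply: continuous_in_subspaceT => x; rewrite inE /= => /df[dx _].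
  exact/differentiable_continuous/derivable1_diffP.
have df' (x : R) : x \in `]a, b[ -> is_derive x 1 f ((fun _ : R => 0 : R) x).
  by move=> /subset_itv_oo_cc/df.
have [t _] := MVT ab df' cf.
by rewrite mul0r => /eqP; rewrite subr_eq0 => /eqP.
Qed.

(** The integral starts at [- n], to the left of the point considered, and is normalised to vanish
    at 0. Then different [n] give the same value, and [n] may depend on [x]. *)
Lemma antiderivative (g : R -> R) : continuous g ->
  exists F : R -> R, forall x : R, is_derive x 1 F (g x).
Proof.
move=> cg.
pose I (n x : R) := \int[mu]_(t in `[- n, x]) g t - \int[mu]_(t in `[- n, 0]) g t.
have dI (n x : R) : - n < x -> is_derive x 1 (I n) (g x).
  move=> nx.
  have If : mu.-integrable `[- n, x + 1] (EFin \o g).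
    by apply: segment_integrable; exact: continuous_subspaceT.
  have xx : x < x + 1 by rewrite ltrDl.
  have [d1 d2] := continuous_FTC1_closed xx If nx (cg x).
  have dJ : is_derive x 1 (fun x => \int[mu]_(t in `[- n, x]) g t) (g x).
    by split; [exact: d1|rewrite -derive1E; exact: d2].
  have := is_deriveB dJ (is_derive_cst (\int[mu]_(t in `[- n, 0]) g t) x 1).
  by rewrite subr0.
have I0 n : I n 0 = 0 by rewrite /I subrr.
have IE (n m x : R) : 0 < n -> 0 < m -> - n < x -> - m < x -> I n x = I m x.
  move=> n0 m0 nx mx; pose f y := I n y - I m y.
  have df (y : R) : - n < y -> - m < y -> is_derive y 1 f 0.
    by move=> ny my; have := is_deriveB (dI n y ny) (dI m y my); rewrite subrr.
  suff : f x = f 0 by rewrite /f !I0 subrr => /eqP; rewrite subr_eq0 => /eqP.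
  have [x0|x0] := leP x 0; [|apply/esym].
    apply: derive0_cst => // y; rewrite in_itv/= => /andP[xy _].
    by apply: df; [exact: lt_le_trans xy|exact: lt_le_trans xy].
  apply: derive0_cst; first exact: ltW.
  by move=> y; rewrite in_itv/= => /andP[y0 _]; apply: df; lra.
pose F x := I (`|x| + 1) x.
exists F => x.
apply: (@near_eq_is_derive _ _ _ (I (`|x| + 2))); last first.
  by apply: dI; have := ler_norm (- x); rewrite normrN; lra.
near=> y; apply: IE.
- by rewrite ltr_wpDl.
- by rewrite ltr_wpDl.
- have xy : `|x - y| < 1 by near: y; apply/nbhs_normP; exists 1 => //= z.
  have := ler_norm (- x); have := ler_norm (x - y); rewrite normrN; lra.
- by have := ler_norm (- y); rewrite normrN; lra.
Unshelve. all: by end_near. Qed.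

End Antiderivative.

Section RoundedSquare.
Context {R : realType}.
Variable e : R.
Hypothesis e0 : 0 < e.

(** A smooth odd increasing bijection onto the interval from -1 to 1, close to the sign function for
    small [e]. Applied to both coordinates of the unit circle it gives an explicit rounded square,
    without bump functions. *)
Definition soft_sign (x : R) : R := x / Num.sqrt (x ^+ 2 + e).
Definition dsoft_sign (x : R) : R := e / ((x ^+ 2 + e) * Num.sqrt (x ^+ 2 + e)).

Let den_gt0 x : 0 < x ^+ 2 + e.
Proof. by rewrite ltr_wpDl// sqr_ge0. Qed.

Let sden_gt0 x : 0 < Num.sqrt (x ^+ 2 + e).
Proof. by rewrite sqrtr_gt0. Qed.

Lemma dsoft_sign_gt0 x : 0 < dsoft_sign x.
Proof. by rewrite divr_gt0// mulr_gt0. Qed.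

Lemma is_derive_soft_sign (x : R) : is_derive x 1 soft_sign (dsoft_sign x).
Proof.
have h1 : is_derive x 1 (fun x : R => x ^+ 2 + e) (2 * x).
  have D := is_deriveD (is_deriveM (is_derive_id x 1) (is_derive_id x 1)) (is_derive_cst e x 1).
  apply: (is_derive_ext D) => [y|]; first by rewrite expr2.
  by rewrite addr0 -[x *: 1]/(x * 1) mulr1 mulrDl mul1r.
have h2 := is_derive_comp1 h1 (is_derive1_sqrt (den_gt0 x)).
have h3 := @is_deriveV R (fun y => Num.sqrt (y ^+ 2 + e)) x _ 1 (lt0r_neq0 (sden_gt0 x)) h2.
apply: (is_derive_ext (is_deriveM (is_derive_id x 1) h3)) => //.
rewrite /= -[x *: _]/(x * _) -[_ *: 1]/(_ * 1) mulr1 -[_ *: (_ * _)]/(_ * (_ * _)) /dsoft_sign.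
have q2 : Num.sqrt (x ^+ 2 + e) ^+ 2 = x ^+ 2 + e by rewrite sqr_sqrtr// ltW.
move: q2 (sden_gt0 x); move: (Num.sqrt _) => q q2 q0.
rewrite -q2; have -> : e = q ^+ 2 - x ^+ 2 by rewrite q2; ring.
by field; rewrite gt_eqF.
Qed.

Lemma soft_signN x : soft_sign (- x) = - soft_sign x.
Proof. by rewrite /soft_sign sqrrN mulNr. Qed.

Lemma sqr_soft_sign x : soft_sign x ^+ 2 = x ^+ 2 / (x ^+ 2 + e).
Proof. by rewrite /soft_sign exprMn exprVn sqr_sqrtr// ltW. Qed.

Lemma soft_sign_lt1 x : `|soft_sign x| < 1.
Proof.
rewrite -(@ltr_pXn2r _ 2)// ?nnegrE// expr1n real_normK ?num_real// sqr_soft_sign.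
by rewrite ltr_pdivrMr// mul1r ltrDl.
Qed.

Lemma soft_sign_inj : injective soft_sign.
Proof.
move=> x y xy.
have sgE z : Num.sg (soft_sign z) = Num.sg z.
  by rewrite /soft_sign sgrM [X in _ * X]gtr0_sg ?invr_gt0// mulr1.
have sxy : Num.sg x = Num.sg y by rewrite -sgE xy sgE.
have : x ^+ 2 = y ^+ 2.
  have := congr1 (fun z => z ^+ 2) xy; rewrite !sqr_soft_sign => /eqP.
  rewrite eqr_div ?lt0r_neq0// => /eqP E.
  have : (x ^+ 2 - y ^+ 2) * e = 0 by move: E; rewrite !mulrDr => E; lra.
  by move/eqP; rewrite mulf_eq0 [e == 0]gt_eqF// orbF subr_eq0 => /eqP.
move=> /eqP; rewrite eqf_sqr => /orP[/eqP//|/eqP xNy].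
move: sxy; rewrite xNy sgrN => /eqP; rewrite eq_sym -subr_eq0 opprK -mulr2n.
by rewrite mulrn_eq0/= sgr_eq0 => /eqP ->; rewrite oppr0.
Qed.

(** The left-hand side is the value of [soft_sign] at [cos (pi / 4)], where the square of the
    argument is [1 / 2]. *)
Lemma soft_sign_ge (x : R) : 0 <= x -> 1 <= 2 * x ^+ 2 ->
  (Num.sqrt (1 + 2 * e))^-1 <= soft_sign x.
Proof.
move=> x0 x2.
have s0 : 0 < Num.sqrt (1 + 2 * e) by rewrite sqrtr_gt0 addr_gt0// mulr_gt0.
rewrite -(@ler_pXn2r _ 2)// ?nnegrE ?invr_ge0 ?sqrtr_ge0 ?divr_ge0 ?sqrtr_ge0//.
rewrite sqr_soft_sign exprVn sqr_sqrtr; last by rewrite addr_ge0// mulr_ge0// ltW.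
rewrite ler_pdivlMr// mulrC ler_pdivrMr; last by rewrite addr_gt0// mulr_gt0.
have H : 0 <= e * (2 * x ^+ 2 - 1) by apply: mulr_ge0; [exact: ltW|rewrite subr_ge0].
by move: H; move: (x ^+ 2) => p; lra.
Qed.

Definition curve_x (s : R) : R := soft_sign (cos s).
Definition curve_y (s : R) : R := soft_sign (sin s).
Definition dcurve_x (s : R) : R := - (dsoft_sign (cos s) * sin s).
Definition dcurve_y (s : R) : R := dsoft_sign (sin s) * cos s.

Lemma is_derive_curve_x (s : R) : is_derive s 1 curve_x (dcurve_x s).
Proof.
have := is_derive_comp1 (is_derive_cos s) (is_derive_soft_sign (cos s)).
by rewrite mulrN.
Qed.

Lemma is_derive_curve_y (s : R) : is_derive s 1 curve_y (dcurve_y s).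
Proof. exact: is_derive_comp1 (is_derive_sin s) (is_derive_soft_sign (sin s)). Qed.

Lemma dcurve_neq0 (s a : R) : dcurve_x s * a = 0 -> dcurve_y s * a = 0 -> a = 0.
Proof.
move=> /eqP; rewrite mulf_eq0 => /orP[/eqP xs|/eqP//].
move=> /eqP; rewrite mulf_eq0 => /orP[/eqP ys|/eqP//].
move: xs ys; rewrite /dcurve_x /dcurve_y => /eqP; rewrite oppr_eq0 mulf_eq0.
rewrite gt_eqF ?dsoft_sign_gt0//= => /eqP s0 /eqP.
rewrite mulf_eq0 gt_eqF ?dsoft_sign_gt0//= => /eqP c0.
by have /eqP := cos2Dsin2 s; rewrite s0 c0 expr0n/= addr0 eq_sym oner_eq0.
Qed.

Lemma continuous_soft_sign : continuous soft_sign.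
Proof.
move=> x; apply/differentiable_continuous/derivable1_diffP.
by case: (is_derive_soft_sign x).
Qed.

Lemma continuous_dsoft_sign : continuous dsoft_sign.
Proof.
have c2 : continuous (fun x : R => x ^+ 2 + e).
  by move=> x; apply: cvgD; [exact: exprn_continuous|exact: cvg_cst].
move=> x; apply: cvgM; first exact: cvg_cst.
apply: cvgV; first by rewrite gt_eqF// mulr_gt0.
apply: cvgM; first exact: c2.
exact: (@cvg_comp _ _ _ (fun x : R => x ^+ 2 + e) Num.sqrt _ _ _ (c2 x) (@sqrt_continuous R _)).
Qed.

Lemma continuous_curve_area : continuous (fun s => curve_x s * dcurve_y s).
Proof.
have cc : continuous (@cos R) by exact: continuous_cos.
have cs : continuous (@sin R) by exact: continuous_sin.
move=> s; apply: cvgM.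
  exact: (@continuous_comp _ _ _ cos soft_sign s (cc s) (@continuous_soft_sign _)).
apply: cvgM; last exact: cc.
exact: (@continuous_comp _ _ _ sin dsoft_sign s (cs s) (@continuous_dsoft_sign _)).
Qed.

(* [F] is the area swept by the curve; the part of a half turn lying over
   [-pi/4 <= s <= pi/4] already fills a rectangle of area [2 / (1 + 2e)]. *)
Lemma curve_area : exists (F : R -> R) (h : R),
  [/\ forall s : R, is_derive s 1 F (curve_x s * dcurve_y s),
      forall s, F (s + pi) = F s + h & 2 / (1 + 2 * e) <= h].
Proof.
have [F dF] := antiderivative continuous_curve_area.
have g_ge0 s : 0 <= curve_x s * dcurve_y s.
  have -> : curve_x s * dcurve_y s =
      dsoft_sign (sin s) * (Num.sqrt (cos s ^+ 2 + e))^-1 * cos s ^+ 2.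
    by rewrite /curve_x /dcurve_y /soft_sign; ring.
  apply: mulr_ge0; last exact: sqr_ge0.
  by apply: mulr_ge0; [exact/ltW/dsoft_sign_gt0|rewrite invr_ge0 sqrtr_ge0].
(* A half turn changes the sign of both [curve_x] and [dcurve_y], so the integrand has period [pi]
   and the increment of [F] over a half turn is a constant [h]. The curve encloses the area
   [2 * h]. *)
pose f s := F (s + pi) - F s.
have gpi s : curve_x (s + pi) * dcurve_y (s + pi) = curve_x s * dcurve_y s.
  rewrite /curve_x /dcurve_y cosDpi sinDpi soft_signN.
  have -> : dsoft_sign (- sin s) = dsoft_sign (sin s) by rewrite /dsoft_sign sqrrN.
  by rewrite mulrN mulrNN.
have dshift (s : R) : is_derive s 1 (fun x => x + pi) 1.
  have := is_deriveD (is_derive_id s 1) (is_derive_cst pi s 1).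
  by rewrite addr0.
have df (s : R) : is_derive s 1 f 0.
  have := is_deriveB (is_derive_comp1 (dshift s) (dF (s + pi))) (dF s).
  by rewrite mulr1 gpi subrr.
have fc s : f s = f (- (pi / 4)).
  have [ss|ss] := leP s (- (pi / 4)).
    by apply: derive0_cst => // x _.
  by apply/esym; apply: derive0_cst => //; exact: ltW.
exists F, (f (- (pi / 4))); split => //.
  by move=> s; rewrite -(fc s) /f; ring.
have p0 := @pi_gt0 R.
have cF (a b : R) (G dG : R -> R) : (forall x : R, is_derive x 1 G (dG x)) ->
    {within `[a, b], continuous G}.
  move=> DG; apply: continuous_subspaceT => x.
  by apply/differentiable_continuous/derivable1_diffP; case: (DG x).
pose w := (Num.sqrt (1 + 2 * e))^-1.
have w2 : w * w = (1 + 2 * e)^-1.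
  by rewrite -expr2 exprVn sqr_sqrtr// addr_ge0// mulr_ge0// ltW.
have w0 : 0 <= w by rewrite invr_ge0 sqrtr_ge0.
have quarter (s : R) : - (pi / 4) <= s <= pi / 4 -> 0 <= cos s /\ 1 <= 2 * cos s ^+ 2.
  move=> /andP[s1 s2]; split; first by apply: cos_ge0_pihalf; apply/andP; split; lra.
  have : 0 <= cos (s *+ 2).
    by apply: cos_ge0_pihalf; rewrite [s *+ 2]mulr2n; apply/andP; split; lra.
  by rewrite cos_mulr2n -[_ *+ 2]mulr_natl; lra.
have cq : 2 * cos (pi / 4) ^+ 2 = 1 :> R.
  have : cos (pi / 4 *+ 2) = 0 :> R.
    by rewrite -[_ *+ 2]mulr_natl (_ : 2 * (pi / 4) = pi / 2) ?cos_pihalf//; field.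
  by rewrite cos_mulr2n -[_ *+ 2]mulr_natl; lra.
have sq : 2 * sin (pi / 4) ^+ 2 = 1 :> R by rewrite sin2cos2; lra.
have s0 : 0 <= sin (pi / 4) :> R by apply: sin_ge0_pi; apply/andP; split; lra.
have yq : w <= curve_y (pi / 4) by apply: soft_sign_ge => //; rewrite sq.
have yqN : curve_y (- (pi / 4)) = - curve_y (pi / 4) by rewrite /curve_y sinN soft_signN.
(* The other half of the half turn contributes a non-negative area, since the integrand is
   non-negative everywhere. *)
have step1 : F (pi / 4) <= F (3 * pi / 4).
  have [|t _] := @MVT_segment R F (fun s => curve_x s * dcurve_y s) (pi / 4) (3 * pi / 4) _
    (fun x _ => dF x) (cF _ _ _ _ dF); first lra.
  by have := g_ge0 t; move=> g0 E; have : 0 <= curve_x t * dcurve_y t * (3 * pi / 4 - pi / 4);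
    [apply: mulr_ge0 => //; lra|rewrite -E subr_ge0].
(* On the quarter turn [curve_x] is at least [w], so [F] grows at least as fast as [w * curve_y],
   whose increment there is at least [2 * w ^+ 2]. *)
pose K s := F s - w * curve_y s.
have dK (s : R) : is_derive s 1 K (curve_x s * dcurve_y s - w * dcurve_y s).
  exact: is_deriveB (dF s) (is_deriveZ w (is_derive_curve_y s)).
have step2 : K (- (pi / 4)) <= K (pi / 4).
  have [|t] := @MVT_segment R K (fun s => curve_x s * dcurve_y s - w * dcurve_y s)
    (- (pi / 4)) (pi / 4) _ (fun x _ => dK x) (cF _ _ _ _ dK); first lra.
  rewrite in_itv/= => tq E; have [t1 t2] := quarter t tq.
  rewrite -subr_ge0 E -mulrBl; apply: mulr_ge0; last by lra.
  apply: mulr_ge0; first by rewrite subr_ge0; exact: soft_sign_ge.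
  by apply: mulr_ge0 => //; exact/ltW/dsoft_sign_gt0.
have fE : f (- (pi / 4)) = F (3 * pi / 4) - F (- (pi / 4)).
  by rewrite /f; congr (F _ - _); field.
rewrite fE; move: step2; rewrite /K yqN => step2.
have : w * w <= w * curve_y (pi / 4) by apply: ler_wpM2l.
rewrite w2; lra.
Qed.

End RoundedSquare.

(** * Products of polar coordinates *)

Section TrigPeriod.
Context {R : realType}.

Let p0 : 2 * pi != 0 :> R.
Proof. by rewrite mulf_neq0// gt_eqF// pi_gt0. Qed.

Lemma trig_period (x : R) (m : int) :
  cos (x + 2 * pi * m%:~R) = cos x /\ sin (x + 2 * pi * m%:~R) = sin x.
Proof.
have E : x = 2 * pi * (x / (2 * pi)) by rewrite mulrC divfK.
have mint : (m%:~R : R) \is a Num.int by exact: intr_int.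
have := trig_period_int (x / (2 * pi)) mint.
by rewrite mulrDr -E.
Qed.

Lemma trig_inj (x y : R) : cos x = cos y -> sin x = sin y -> `|x - y| < 2 * pi ->
  x = y.
Proof.
move=> cxy sxy xy.
have E (z : R) : z = 2 * pi * (z / (2 * pi)) by rewrite mulrC divfK.
have : x / (2 * pi) - y / (2 * pi) \is a Num.int.
  by apply: trig_eq_int; rewrite -!E.
rewrite -mulrBl => /intrP[m mE].
have pp : 0 < 2 * pi :> R by rewrite mulr_gt0// pi_gt0.
have : `|(m%:~R : R)| < 1.
  by rewrite -mE normrM normfV (gtr0_norm pp) ltr_pdivrMr// mul1r.
rewrite -intr_norm (_ : 1 = 1%:~R)// ltr_int => m1.
have m0 : m = 0 by apply/eqP; rewrite -normr_le0 -ltzD1 add0r.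
move: mE; rewrite m0 => /eqP; rewrite mulf_eq0 invr_eq0 (negPf p0) orbF subr_eq0.
by move/eqP.
Qed.

Lemma shift_near (x x0 : R) : exists m : int, `|x + 2 * pi * m%:~R - x0| <= pi.
Proof.
have pp : 0 < 2 * pi :> R by rewrite mulr_gt0// pi_gt0.
pose y := (x - x0 + pi) / (2 * pi).
have yE : x - x0 + pi = 2 * pi * y by rewrite mulrC divfK.
exists (- Num.floor y); rewrite mulrNz.
have f1 := floor_le y; have := floorD1_gt y; rewrite intrD => f2.
have h1 : 2 * pi * (Num.floor y)%:~R <= 2 * pi * y by rewrite ler_pM2l.
have h2 : 2 * pi * y <= 2 * pi * (Num.floor y)%:~R + 2 * pi.
  by rewrite -[X in _ + X]mulr1 -mulrDr ler_pM2l// ltW.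
move: h1 h2; rewrite mulrN -yE; move: (2 * pi * _) => z h1 h2.
by rewrite ler_norml; apply/andP; split; lra.
Qed.

End TrigPeriod.

Section Polar.
Context {R : realType}.

Definition radius (A : 'rV[R]_2 -> R) u : R := Num.sqrt (A u / pi).

Section OneFactor.
Variables A f : 'rV[R]_2 -> R.
Hypotheses (A0 : forall u, 0 < A u) (CA : forall k, Ck setT k A) (Cf : forall k, Ck setT k f).

Lemma radius_gt0 u : 0 < radius A u.
Proof. by rewrite sqrtr_gt0 divr_gt0 ?pi_gt0. Qed.

Lemma sqr_radius u : pi * radius A u ^+ 2 = A u.
Proof.
by rewrite sqr_sqrtr ?divr_ge0 ?pi_ge0// 1?ltW// mulrC divfK// gt_eqF// pi_gt0.
Qed.

Lemma Ck_radius k : Ck setT k (radius A).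
Proof.
apply: Ck_sqrt; [exact: openT|by move=> u _; rewrite divr_gt0 ?pi_gt0|].
by apply: Ck_mul; [exact: openT|exact: CA|exact: Ck_cst].
Qed.

Lemma derive_radius u v : 2 * pi * (radius A u * 'D_v (radius A) u) = 'D_v A u.
Proof.
have d : derivable (radius A) u v by exact: (Ck_radius 1).2.1.
have E : 'D_v A u = 'D_v (fun u => pi *: (radius A * radius A) u) u.
  by congr ('D_v _ u); apply/funext => w; rewrite -[LHS]sqr_radius expr2.
rewrite {}E deriveZ; last exact: derivableM.
rewrite deriveM// -[_ *: (_ + _)]/(_ * (_ + _)).
by rewrite -[radius A u *: _]/(_ * _); ring.
Qed.

Definition polar_x u : R := radius A u * cos (f u).
Definition polar_y u : R := radius A u * sin (f u).

Lemma Ck_polar k : Ck setT k polar_x /\ Ck setT k polar_y.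
Proof.
have [Cc Cs] := Ck_cos_sin openT (Cf k).
by split; apply: Ck_mul => //; first [exact: openT|exact: Ck_radius].
Qed.

Lemma derive_polar u v :
  'D_v polar_x u = 'D_v (radius A) u * cos (f u) - radius A u * sin (f u) * 'D_v f u /\
  'D_v polar_y u = 'D_v (radius A) u * sin (f u) + radius A u * cos (f u) * 'D_v f u.
Proof.
have dr : is_derive u v (radius A) ('D_v (radius A) u).
  by apply: derivableP; exact: (Ck_radius 1).2.1.
have df : is_derive u v f ('D_v f u) by apply: derivableP; exact: (Cf 1).2.1.
have dc := is_derive_comp1 df (is_derive_cos (f u)).
have ds := is_derive_comp1 df (is_derive_sin (f u)).
have [_ Ex] := is_deriveM dr dc; have [_ Ey] := is_deriveM dr ds.
split.
  apply: etrans Ex _.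
  by rewrite -[_ *: _ + _ *: _]/(_ * _ + _ * _); ring.
apply: etrans Ey _.
by rewrite -[_ *: _ + _ *: _]/(_ * _ + _ * _); ring.
Qed.

Lemma polar_area u : pi * (polar_x u ^+ 2 + polar_y u ^+ 2) = A u.
Proof. by rewrite /polar_x /polar_y !exprMn -mulrDr cos2Dsin2 mulr1 sqr_radius. Qed.

Lemma polar_inj u u' : polar_x u = polar_x u' -> polar_y u = polar_y u' ->
  [/\ A u = A u', cos (f u) = cos (f u') & sin (f u) = sin (f u')].
Proof.
move=> Ex Ey; have EA : A u = A u' by rewrite -!polar_area Ex Ey.
have Er : radius A u = radius A u' by rewrite /radius EA.
have r0 := lt0r_neq0 (radius_gt0 u').
move: Ex Ey; rewrite /polar_x /polar_y Er => /(mulfI r0) -> /(mulfI r0) ->.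
by split.
Qed.

Lemma polar_immersion u v : 'D_v polar_x u = 0 -> 'D_v polar_y u = 0 ->
  'D_v A u = 0 /\ 'D_v f u = 0.
Proof.
have [-> ->] := derive_polar u v; rewrite -derive_radius.
have r0 := lt0r_neq0 (radius_gt0 u); have cs := cos2Dsin2 (f u).
move: ('D_v (radius A) u) ('D_v f u) (radius A u) r0 (cos (f u)) (sin (f u)) cs.
move=> r' f' r r0 c s cs Ex Ey.
have r'0 : r' = 0.
  rewrite -[r']mulr1 -cs.
  have -> : r' * (c ^+ 2 + s ^+ 2) = c * (r' * c - r * s * f') + s * (r' * s + r * c * f').
    by ring.
  by rewrite Ex Ey !mulr0 addr0.
split; first by rewrite r'0 !mulr0.
apply: (mulfI r0); rewrite mulr0 -[f']mulr1 -cs.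
have -> : r * (f' * (c ^+ 2 + s ^+ 2)) =
    c * (r' * s + r * c * f') - s * (r' * c - r * s * f') by ring.
by rewrite Ex Ey !mulr0 subr0.
Qed.

Lemma polar_omega u v w : 2 * pi *
  ('D_v polar_x u * 'D_w polar_y u - 'D_v polar_y u * 'D_w polar_x u) =
  'D_v A u * 'D_w f u - 'D_w A u * 'D_v f u.
Proof.
have [-> ->] := derive_polar u v; have [-> ->] := derive_polar u w.
rewrite -!derive_radius; have cs := cos2Dsin2 (f u).
move: ('D_v (radius A) u) ('D_v f u) ('D_w (radius A) u) ('D_w f u) cs.
move: (radius A u) (cos (f u)) (sin (f u)) => r c s rv fv rw fw cs.
rewrite -[RHS]mulr1 -cs; ring.
Qed.

(** [x dy] and [A df / (2 pi)] are primitives of the same area form; they differ by the differential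
    of [x y / 2], which becomes [A sin f cos f] after multiplication by [2 pi]. *)
Lemma polar_liouville u v : 2 * pi * (polar_x u * 'D_v polar_y u) =
  A u * 'D_v f u + 'D_v (fun u => A u * (sin (f u) * cos (f u))) u.
Proof.
have dA : is_derive u v A ('D_v A u) by apply: derivableP; exact: (CA 1).2.1.
have df : is_derive u v f ('D_v f u) by apply: derivableP; exact: (Cf 1).2.1.
have dc := is_derive_comp1 df (is_derive_cos (f u)).
have ds := is_derive_comp1 df (is_derive_sin (f u)).
have [_ E] := is_deriveM dA (is_deriveM ds dc).
rewrite [X in _ = _ + X]E {E dA df dc ds}.
have [_ ->] := derive_polar u v; rewrite -derive_radius -[in RHS]sqr_radius /polar_x.
rewrite -[_ *: _ + _ *: _]/(_ * _ + _ * _) -[sin _ *: _ + _]/(_ * _ + _ * _).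
rewrite -[((fun y => sin (f y)) * _) u]/(sin (f u) * cos (f u)) /=.
have cs : sin (f u) ^+ 2 = 1 - cos (f u) ^+ 2 by exact: sin2cos2.
move: ('D_v (radius A) u) ('D_v f u) cs.
move: (radius A u) (cos (f u)) (sin (f u)) => r c s rv fv cs.
have -> : (s * (- s * fv) + c * (c * fv)) = (c ^+ 2 - s ^+ 2) * fv by ring.
rewrite cs; ring.
Qed.

End OneFactor.

Section TwoFactors.
Variables A1 f1 A2 f2 : 'rV[R]_2 -> R.
Hypotheses (A10 : forall u, 0 < A1 u) (A20 : forall u, 0 < A2 u).
Hypotheses (CA1 : forall k, Ck setT k A1) (Cf1 : forall k, Ck setT k f1).
Hypotheses (CA2 : forall k, Ck setT k A2) (Cf2 : forall k, Ck setT k f2).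

Definition bipolar (u : 'rV[R]_2) : 'rV[R]_4 := \row_j
  (if j == 0 then polar_x A1 f1 u else if j == 1 then polar_y A1 f1 u
   else if j == 2 then polar_x A2 f2 u else polar_y A2 f2 u).

Lemma Ck_bipolar k : Ck setT k bipolar.
Proof.
have [X1 Y1] := Ck_polar A10 CA1 Cf1 k; have [X2 Y2] := Ck_polar A20 CA2 Cf2 k.
apply/(Ck_mxP _ _ openT) => i j.
have -> : (fun u => bipolar u i j) = (fun u =>
   if j == 0 then polar_x A1 f1 u else if j == 1 then polar_y A1 f1 u
   else if j == 2 then polar_x A2 f2 u else polar_y A2 f2 u).
  by apply/funext => u; rewrite mxE.
by case: (j == 0) => //; case: (j == 1) => //; case: (j == 2).
Qed.

Lemma derive_bipolar u v : 'D_v bipolar u = \row_j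
  (if j == 0 then 'D_v (polar_x A1 f1) u else if j == 1 then 'D_v (polar_y A1 f1) u
   else if j == 2 then 'D_v (polar_x A2 f2) u else 'D_v (polar_y A2 f2) u).
Proof.
rewrite derive_mx; last exact: (Ck_bipolar 1).2.1.
apply/rowP => j; rewrite !mxE.
have -> : (fun u => bipolar u 0 j) = (fun u =>
   if j == 0 then polar_x A1 f1 u else if j == 1 then polar_y A1 f1 u
   else if j == 2 then polar_x A2 f2 u else polar_y A2 f2 u).
  by apply/funext => w; rewrite mxE.
by case: (j == 0) => //; case: (j == 1) => //; case: (j == 2).
Qed.

Lemma derive_bipolar_coord u v :
  [/\ ('D_v bipolar u) 0 0 = 'D_v (polar_x A1 f1) u,
      ('D_v bipolar u) 0 1 = 'D_v (polar_y A1 f1) u,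
      ('D_v bipolar u) 0 2 = 'D_v (polar_x A2 f2) u &
      ('D_v bipolar u) 0 3 = 'D_v (polar_y A2 f2) u].
Proof. by rewrite derive_bipolar; split; rewrite mxE. Qed.

Lemma bipolar_area u : area1 (bipolar u) = A1 u /\ area2 (bipolar u) = A2 u.
Proof. by rewrite /area1 /area2 !mxE /= !polar_area. Qed.

Lemma bipolar_inj u u' : bipolar u = bipolar u' ->
  [/\ A1 u = A1 u', cos (f1 u) = cos (f1 u') & sin (f1 u) = sin (f1 u')] /\
  [/\ A2 u = A2 u', cos (f2 u) = cos (f2 u') & sin (f2 u) = sin (f2 u')].
Proof.
move=> /rowP E; move: (E 0) (E 1) (E 2) (E 3); rewrite !mxE /= => E0 E1 E2 E3.
by split; apply: polar_inj.
Qed.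

Lemma eq_bipolar u u' : A1 u = A1 u' -> A2 u = A2 u' ->
  cos (f1 u) = cos (f1 u') -> sin (f1 u) = sin (f1 u') ->
  cos (f2 u) = cos (f2 u') -> sin (f2 u) = sin (f2 u') -> bipolar u = bipolar u'.
Proof.
move=> a1 a2 c1 s1 c2 s2; apply/rowP => j.
by rewrite !mxE /polar_x /polar_y /radius a1 a2 c1 s1 c2 s2.
Qed.

Lemma bipolar_immersion u v : 'D_v bipolar u = 0 ->
  [/\ 'D_v A1 u = 0, 'D_v f1 u = 0, 'D_v A2 u = 0 & 'D_v f2 u = 0].
Proof.
move=> /rowP E; have [D0 D1 D2 D3] := derive_bipolar_coord u v.
have E0 := etrans (esym D0) (etrans (E 0) (mxE _ _ 0 0)).
have E1 := etrans (esym D1) (etrans (E 1) (mxE _ _ 0 1)).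
have E2 := etrans (esym D2) (etrans (E 2) (mxE _ _ 0 2)).
have E3 := etrans (esym D3) (etrans (E 3) (mxE _ _ 0 3)).
have [? ?] := polar_immersion A10 CA1 Cf1 E0 E1.
by have [? ?] := polar_immersion A20 CA2 Cf2 E2 E3.
Qed.

Lemma bipolar_omega u v w : 2 * pi * omega ('D_v bipolar u) ('D_w bipolar u) =
  ('D_v A1 u * 'D_w f1 u - 'D_w A1 u * 'D_v f1 u) +
  ('D_v A2 u * 'D_w f2 u - 'D_w A2 u * 'D_v f2 u).
Proof.
rewrite -(polar_omega A10 CA1 Cf1 u v w) -(polar_omega A20 CA2 Cf2 u v w) -mulrDr.
have [v0 v1 v2 v3] := derive_bipolar_coord u v.
have [w0 w1 w2 w3] := derive_bipolar_coord u w.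
by congr (_ * (_ * _ - _ * _ + (_ * _ - _ * _)));
  [exact: v0|exact: w1|exact: v1|exact: w0|exact: v2|exact: w3|exact: v3|exact: w2].
Qed.

Lemma bipolar_liouville u v :
  2 * pi * liouville (bipolar u) ('D_v bipolar u) =
  (A1 u * 'D_v f1 u + A2 u * 'D_v f2 u) +
  ('D_v (fun u => A1 u * (sin (f1 u) * cos (f1 u))) u +
   'D_v (fun u => A2 u * (sin (f2 u) * cos (f2 u))) u).
Proof.
rewrite addrACA -(polar_liouville A10 CA1 Cf1 u v) -(polar_liouville A20 CA2 Cf2 u v).
rewrite -mulrDr /liouville; have [_ -> _ ->] := derive_bipolar_coord u v.
by rewrite !mxE.
Qed.

End TwoFactors.
End Polar.

(** * The torus *)

Section PointwiseDerive.
Context {R : realType} {V : normedModType R}.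
Variables (f g : V -> R) (x v : V) (df dg : R).
Hypotheses (Df : is_derive x v f df) (Dg : is_derive x v g dg).

(** These pointwise forms, with real products in place of scalings, let the derivatives of long
    expressions be assembled as terms and compared by [ring] or [field]. *)
Lemma is_derive_add : is_derive x v (fun y => f y + g y) (df + dg).
Proof. exact: is_deriveD. Qed.

Lemma is_derive_sub : is_derive x v (fun y => f y - g y) (df - dg).
Proof. exact: is_deriveB. Qed.

Lemma is_derive_scal (c : R) : is_derive x v (fun y => c * f y) (c * df).
Proof. exact: is_deriveZ. Qed.

Lemma is_derive_mul : is_derive x v (fun y => f y * g y) (f x * dg + g x * df).
Proof. exact: is_deriveM. Qed.

End PointwiseDerive.

Section Torus.
Context {R : realType}.
(** [P] and [Q] are the half side lengths of the rectangle in the coordinates [A_1] and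
    [f_1 / (2 pi)]. As [2 * h] is the area inside the rounded square, [QPh] says that the rounded
    rectangle has area 1. *)
Variables (e P Q k sg h : R) (F : R -> R).
Hypotheses (e0 : 0 < e) (P0 : 0 < P) (P1 : P <= 1) (Q0 : 0 < Q) (Q1 : Q < 1 / 2).
Hypotheses (k0 : 0 < k) (k1 : k <= 1 / 4) (sgE : sg = k / 16).
Hypothesis dF : forall s : R, is_derive s 1 F (curve_x e s * dcurve_y e s).
Hypothesis Fpi : forall s, F (s + pi) = F s + h.
Hypothesis QPh : Q * P * (2 * h) = 1.

Implicit Types u v : 'rV[R]_2.

Local Ltac params_lra := have := P0; have := P1; have := Q0; have := Q1;
  have := k0; have := k1; have := sgE; lra.

Definition torus_area1 u : R :=
  3 / 2 + P * curve_x e (u 0 0) + sg * cos (u 0 1).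
Definition torus_angle1 u : R :=
  2 * pi * Q * curve_y e (u 0 0) - k * (sin (u 0 1) * cos (u 0 1)).
(** The product with [P * curve_x] compensates the rotation, whose angular derivative in [t] is
    [- k cos (2 t)]; the product with [curve_y] compensates the translation, whose derivative is
    [- sg sin t]. With them the coefficient of [dA_1 df_1 + dA_2 df_2] vanishes identically. *)
Definition torus_area2 u : R :=
  1 - k * cos (u 0 1) +
  k * ((cos (u 0 1) * cos (u 0 1) - sin (u 0 1) * sin (u 0 1)) * (P * curve_x e (u 0 0))) -
  2 * pi * sg * Q * (sin (u 0 1) * curve_y e (u 0 0)).
Definition torus_angle2 u : R := u 0 1.

Definition torus := bipolar torus_area1 torus_angle1 torus_area2 torus_angle2.

(* [d torus_action = A1 d(f1) + A2 d(f2)] in the notation [A], [f] for areas and angles. *)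
Definition torus_action u : R :=
  2 * pi * Q * (3 / 2 * curve_y e (u 0 0) + P * F (u 0 0)) +
  2 * pi * Q * sg * (cos (u 0 1) * curve_y e (u 0 0)) -
  3 / 2 * k * (sin (u 0 1) * cos (u 0 1)) + u 0 1 - k * sin (u 0 1) -
  sg * k * (sin (u 0 1) * (cos (u 0 1) * cos (u 0 1)) +
    1 / 3 * (sin (u 0 1) * (sin (u 0 1) * sin (u 0 1)))).

(** [torus_action] is completed by the exact terms of [polar_liouville], to become a primitive of
    the Liouville form itself; the division by [2 * pi] turns the periods [2 pi] into 1. *)
Definition torus_primitive u : R := (2 * pi)^-1 * (torus_action u +
  (torus_area1 u * (sin (torus_angle1 u) * cos (torus_angle1 u)) +
   torus_area2 u * (sin (torus_angle2 u) * cos (torus_angle2 u)))).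

Let p0 : 0 < pi :> R. Proof. exact: pi_gt0. Qed.
Let p4 : pi < 4 :> R. Proof. by have := @pihalf_lt2 R; lra. Qed.

Lemma curve_bounds s : -1 < curve_x e s < 1 /\ -1 < curve_y e s < 1.
Proof.
by have := soft_sign_lt1 e0 (cos s); have := soft_sign_lt1 e0 (sin s); rewrite !ltr_norml.
Qed.

(** With [pi < 4] and [Q < 1 / 2] the product is at most [4 * sg]. This is the origin of
    [sg = k / 16]: the translation disturbs [A_2] by at most a quarter of [k]. *)
Let sQ_bound : 0 <= 2 * pi * sg * Q <= k / 4.
Proof.
have sg0 : 0 < sg by rewrite sgE divr_gt0.
have h1 : 0 <= pi * sg by rewrite mulr_ge0// ltW.
have h2 : pi * sg <= 4 * sg by rewrite ler_pM2r// ltW.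
have h3 : pi * sg * Q <= pi * sg * (1 / 2) by rewrite ler_wpM2l// ltW.
have h4 : 0 <= pi * sg * Q by rewrite mulr_ge0// ltW.
have -> : 2 * pi * sg * Q = 2 * (pi * sg * Q) by ring.
move: h1 h2 h3 h4; move: (pi * sg * Q) (pi * sg) => x y *; apply/andP; split; params_lra.
Qed.

Lemma torus_area1_bounds u :
  3 / 2 - P - sg < torus_area1 u < 3 / 2 + P + sg.
Proof.
have [/andP[x1 x2] _] := curve_bounds (u 0 0).
have sg0 : 0 < sg by rewrite sgE divr_gt0.
have c1 := cos_geN1 (u 0 1); have c2 := cos_le1 (u 0 1).
have h1 : P * curve_x e (u 0 0) < P * 1 by rewrite ltr_pM2l.
have h2 : P * (-1) < P * curve_x e (u 0 0) by rewrite ltr_pM2l.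
have h3 : sg * cos (u 0 1) <= sg * 1 by rewrite ler_pM2l.
have h4 : sg * (-1) <= sg * cos (u 0 1) by rewrite ler_pM2l.
rewrite /torus_area1; apply/andP; split; params_lra.
Qed.

(** The three oscillating terms contribute at most [k], [k] and [k / 4]. *)
Lemma torus_area2_bounds u :
  1 - 9 / 4 * k <= torus_area2 u <= 1 + 9 / 4 * k.
Proof.
have [/andP[x1 x2] /andP[y1 y2]] := curve_bounds (u 0 0).
have c1 := cos_geN1 (u 0 1); have c2 := cos_le1 (u 0 1).
have n1 : `|k * cos (u 0 1)| <= k.
  by rewrite normrM (gtr0_norm k0) ler_piMr ?cos_max// ltW.
have n2 : `|k * ((cos (u 0 1) * cos (u 0 1) - sin (u 0 1) * sin (u 0 1)) *
    (P * curve_x e (u 0 0)))| <= k.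
  rewrite normrM (gtr0_norm k0) ler_piMr ?(ltW k0)// -cosD normrM mulr_ile1 ?cos_max//.
  by rewrite normrM (gtr0_norm P0) mulr_ile1// ?(ltW P0)// ltW// ltr_norml x1.
have n3 : `|2 * pi * sg * Q * (sin (u 0 1) * curve_y e (u 0 0))| <= k / 4.
  have /andP[q0 q1] := sQ_bound.
  rewrite normrM (ger0_norm q0); apply: le_trans q1; rewrite ler_piMr//.
  by rewrite normrM mulr_ile1 ?sin_max// ltW// ltr_norml y1.
move: n1 n2 n3; rewrite /torus_area2 !ler_norml.
by move=> /andP[? ?] /andP[? ?] /andP[? ?]; apply/andP; split; params_lra.
Qed.

Lemma torus_area1_gt0 u : 0 < torus_area1 u.
Proof. by have /andP[+ _] := torus_area1_bounds u; rewrite sgE; params_lra. Qed.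

Lemma torus_area2_gt0 u : 0 < torus_area2 u.
Proof. by have /andP[+ _] := torus_area2_bounds u; params_lra. Qed.

Let oT : open [set: 'rV[R]_2]. Proof. exact: openT. Qed.

Lemma Ck_curve (n : nat) :
  Ck setT n (fun u => curve_x e (u 0 0)) /\ Ck setT n (fun u => curve_y e (u 0 0)).
Proof.
have [Cc Cs] := Ck_cos_sin oT (Ck_coord setT n (0 : 'I_2)).
have C_soft (f : 'rV[R]_2 -> R) : Ck setT n f -> Ck setT n (fun u => soft_sign e (f u)).
  move=> Cf; have d0 u : 0 < f u * f u + e by rewrite ltr_wpDl// -expr2 sqr_ge0.
  apply: (Ck_mul oT Cf); apply: (Ck_inv oT).
    by move=> u _; rewrite gt_eqF// sqrtr_gt0 expr2.
  apply: (Ck_sqrt oT); first by move=> u _; rewrite expr2.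
  have := Ck_add oT (Ck_mul oT Cf Cf) (Ck_cst setT n e).
  by apply: Ck_eq => // u _; rewrite expr2.
by split; exact: C_soft.
Qed.

Lemma Ck_torus_area1 n : Ck setT n torus_area1.
Proof.
have [Cx _] := Ck_curve n; have [Cc _] := Ck_cos_sin oT (Ck_coord setT n (1 : 'I_2)).
apply: (Ck_add oT); last by apply: (Ck_mul oT) => //; exact: Ck_cst.
by apply: (Ck_add oT); [exact: Ck_cst|apply: (Ck_mul oT) => //; exact: Ck_cst].
Qed.

Lemma Ck_torus_angle1 n : Ck setT n torus_angle1.
Proof.
have [_ Cy] := Ck_curve n; have [Cc Cs] := Ck_cos_sin oT (Ck_coord setT n (1 : 'I_2)).
apply: (Ck_add oT); first by apply: (Ck_mul oT) => //; exact: Ck_cst.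
apply: (Ck_opp oT); apply: (Ck_mul oT); first exact: Ck_cst.
exact: (Ck_mul oT).
Qed.

Lemma Ck_torus_area2 n : Ck setT n torus_area2.
Proof.
have [Cx Cy] := Ck_curve n; have [Cc Cs] := Ck_cos_sin oT (Ck_coord setT n (1 : 'I_2)).
have Ccst c : Ck setT n (fun _ : 'rV[R]_2 => c : R) by exact: Ck_cst.
apply: (Ck_add oT); last first.
  by apply: (Ck_opp oT); apply: (Ck_mul oT) => //; exact: (Ck_mul oT).
apply: (Ck_add oT).
  by apply: (Ck_add oT) => //; apply: (Ck_opp oT); exact: (Ck_mul oT).
apply: (Ck_mul oT) => //; apply: (Ck_mul oT); last exact: (Ck_mul oT).
by apply: (Ck_add oT); [|apply: (Ck_opp oT)]; exact: (Ck_mul oT).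
Qed.

Lemma Ck_torus_angle2 n : Ck setT n torus_angle2.
Proof. exact: Ck_coord. Qed.

Lemma Ck_torus n : Ck setT n torus.
Proof.
exact: (Ck_bipolar torus_area1_gt0 torus_area2_gt0 Ck_torus_area1 Ck_torus_angle1
  Ck_torus_area2 Ck_torus_angle2).
Qed.

Section Derivatives.
Variables u v : 'rV[R]_2.
Let s := u 0 0.
Let t := u 0 1.
Let a := v 0 0.
Let b := v 0 1.
Let dt : is_derive u v (fun u : 'rV[R]_2 => u 0 1) b := is_derive_coord u v 1.
Let dc := is_derive_comp1 dt (is_derive_cos t).
Let ds := is_derive_comp1 dt (is_derive_sin t).
Let dX := is_derive_comp1 (is_derive_coord u v 0) (is_derive_curve_x e0 s).
Let dY := is_derive_comp1 (is_derive_coord u v 0) (is_derive_curve_y e0 s).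
Let dFs := is_derive_comp1 (is_derive_coord u v 0) (dF s).
Let d1 c := @is_derive_cst R 'rV[R]_2 R c u v.

Lemma is_derive_torus_area1 : is_derive u v torus_area1
  (P * dcurve_x e s * a - sg * sin t * b).
Proof.
have D := is_derive_add (is_derive_add (d1 (3 / 2)) (is_derive_scal dX P)) (is_derive_scal dc sg).
by apply: (is_derive_ext D) => //; rewrite /s /t /a /b; ring.
Qed.

Lemma is_derive_torus_angle1 : is_derive u v torus_angle1
  (2 * pi * Q * dcurve_y e s * a - k * (cos t * cos t - sin t * sin t) * b).
Proof.
have D := is_derive_sub (is_derive_scal dY (2 * pi * Q)) (is_derive_scal (is_derive_mul ds dc) k).
by apply: (is_derive_ext D) => //; rewrite /s /t /a /b; ring.
Qed.

Lemma is_derive_torus_area2 : is_derive u v torus_area2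
  (k * sin t * b + k * P * (dcurve_x e s * a * (cos t * cos t - sin t * sin t) -
     4 * (cos t * sin t) * b * curve_x e s) -
   2 * pi * sg * Q * (cos t * b * curve_y e s + sin t * (dcurve_y e s * a))).
Proof.
have D2 := is_derive_sub (is_derive_mul dc dc) (is_derive_mul ds ds).
have D := is_derive_sub (is_derive_add (is_derive_sub (d1 1) (is_derive_scal dc k))
  (is_derive_scal (is_derive_mul D2 (is_derive_scal dX P)) k))
  (is_derive_scal (is_derive_mul ds dY) (2 * pi * sg * Q)).
by apply: (is_derive_ext D) => //; rewrite /s /t /a /b; ring.
Qed.

Lemma is_derive_torus_action : is_derive u v torus_action
  (torus_area1 u * (2 * pi * Q * dcurve_y e s * a - k * (cos t * cos t - sin t * sin t) * b) +
   torus_area2 u * b).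
Proof.
have Da := is_derive_scal (is_derive_add (is_derive_scal dY (3 / 2)) (is_derive_scal dFs P))
  (2 * pi * Q).
have Db := is_derive_scal (is_derive_mul dc dY) (2 * pi * Q * sg).
have Dc := is_derive_scal (is_derive_mul ds dc) (3 / 2 * k).
have Dd := is_derive_scal (is_derive_add (is_derive_mul ds (is_derive_mul dc dc))
  (is_derive_scal (is_derive_mul ds (is_derive_mul ds ds)) (1 / 3))) (sg * k).
have D := is_derive_sub (is_derive_sub (is_derive_add (is_derive_sub (is_derive_add Da Db) Dc) dt)
  (is_derive_scal ds k)) Dd.
apply: (is_derive_ext D) => //; rewrite /torus_area1 /torus_area2 /s /t /a /b.
by move: (curve_x _ _) (curve_y _ _) (dcurve_y _ _) (cos _) (sin _) pi => *; field.
Qed.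

End Derivatives.

Let D_area1 u v := @derive_val _ _ _ _ _ _ _ (is_derive_torus_area1 u v).
Let D_angle1 u v := @derive_val _ _ _ _ _ _ _ (is_derive_torus_angle1 u v).
Let D_area2 u v := @derive_val _ _ _ _ _ _ _ (is_derive_torus_area2 u v).
Let D_angle2 u v : 'D_v torus_angle2 u = v 0 1.
Proof. by case: (is_derive_coord u v 1). Qed.

Lemma torus_immersion u v : 'D_v torus u = 0 -> v = 0.
Proof.
move=> /(bipolar_immersion torus_area1_gt0 torus_area2_gt0 Ck_torus_area1
  Ck_torus_angle1 Ck_torus_area2 Ck_torus_angle2) [].
rewrite D_area1 D_angle1 D_angle2 => E1 E2 _ v1.
move: E1 E2; rewrite v1 !mulr0 !subr0 => E1 E2.
have x0 : dcurve_x e (u 0 0) * v 0 0 = 0.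
  by apply: (mulfI (lt0r_neq0 P0)); rewrite mulr0 mulrA.
have pQ : 0 < 2 * pi * Q by rewrite !mulr_gt0.
have y0 : dcurve_y e (u 0 0) * v 0 0 = 0.
  by apply: (mulfI (lt0r_neq0 pQ)); rewrite mulr0 mulrA.
have v0 := dcurve_neq0 e0 x0 y0.
by rewrite [v]point2E v0 v1 !scale0r addr0.
Qed.

Lemma torus_isotropic u v w : omega ('D_v torus u) ('D_w torus u) = 0.
Proof.
have pp : 2 * pi != 0 :> R by rewrite mulf_neq0// gt_eqF.
apply: (mulfI pp); rewrite mulr0.
rewrite (bipolar_omega torus_area1_gt0 torus_area2_gt0 Ck_torus_area1
  Ck_torus_angle1 Ck_torus_area2 Ck_torus_angle2).
rewrite (D_area1 u v) (D_area1 u w) (D_angle1 u v) (D_angle1 u w).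
rewrite (D_area2 u v) (D_area2 u w) (D_angle2 u v) (D_angle2 u w).
move: (v 0 0) (v 0 1) (w 0 0) (w 0 1) (cos _) (sin _) (dcurve_x _ _) (dcurve_y _ _).
move: (curve_x _ _) (curve_y _ _) pi => *; ring.
Qed.

Lemma torus_primitive_liouville u v :
  'D_v torus_primitive u = liouville (torus u) ('D_v torus u).
Proof.
have pp : 2 * pi != 0 :> R by rewrite mulf_neq0// gt_eqF.
apply: (mulfI pp).
rewrite (bipolar_liouville torus_area1_gt0 torus_area2_gt0 Ck_torus_area1
  Ck_torus_angle1 Ck_torus_area2 Ck_torus_angle2).
have Csc (f : 'rV[R]_2 -> R) : (forall n, Ck setT n f) ->
    Ck setT 1 (fun u => sin (f u) * cos (f u)).
  by move=> Cf; have [Cc Cs] := Ck_cos_sin oT (Cf 1%N); exact: (Ck_mul oT Cs Cc).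
have dE (f : 'rV[R]_2 -> R) : Ck setT 1 f -> is_derive u v f ('D_v f u).
  by move=> Cf; apply: derivableP; exact: Cf.2.1.
have h1 := dE _ (Ck_mul oT (Ck_torus_area1 1) (Csc _ Ck_torus_angle1)).
have h2 := dE _ (Ck_mul oT (Ck_torus_area2 1) (Csc _ Ck_torus_angle2)).
have [_ ->] := is_derive_scal (is_derive_add (is_derive_torus_action u v)
  (is_derive_add h1 h2)) (2 * pi)^-1.
by rewrite mulVKf// (D_angle1 u v) (D_angle2 u v).
Qed.

Lemma Ck_torus_primitive : Ck setT 1 torus_primitive.
Proof.
have Ccst c : Ck setT 1 (fun _ : 'rV[R]_2 => c : R) by exact: Ck_cst.
have [Cx Cy] := Ck_curve 1; have [Cc Cs] := Ck_cos_sin oT (Ck_coord setT 1 (1 : 'I_2)).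
have Csc (f : 'rV[R]_2 -> R) : Ck setT 1 f -> Ck setT 1 (fun u => sin (f u) * cos (f u)).
  by move=> Cf; have [C1 C2] := Ck_cos_sin oT Cf; exact: (Ck_mul oT C2 C1).
(* About [F] only its derivative is known; continuity of that derivative gives order 1, the order
   demanded of the potential in [torus_integral_lagrangian]. *)
have CF : Ck setT 1 (fun u : 'rV[R]_2 => F (u 0 0)).
  have D u v := is_derive_comp1 (is_derive_coord u v 0) (dF (u 0 0)).
  have cF : continuous F.
    by move=> x; apply/differentiable_continuous/derivable1_diffP; case: (dF x).
  have cc : continuous (fun u : 'rV[R]_2 => u 0 0) by exact: coord_continuous.
  split; first by move=> u _; exact: (continuous_comp (cc u) (cF _)).
  split=> [u v _|v]; first by case: (D u v).
  split=> // u _.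
  have -> : 'D_v (fun u : 'rV[R]_2 => F (u 0 0)) =
      (fun u => curve_x e (u 0 0) * dcurve_y e (u 0 0) * v 0 0).
    by apply/funext => w; case: (D w v).
  have cg : continuous (fun s : R => curve_x e s * dcurve_y e s).
    exact: continuous_curve_area.
  have cm : continuous (fun x : R => x * v 0 0) by exact: mulrr_continuous.
  exact: (continuous_comp (continuous_comp (cc u) (cg _)) (cm _)).
have Ct : Ck setT 1 (fun u : 'rV[R]_2 => u 0 1) by exact: Ck_coord.
have C1 := Ck_mul oT (Ccst (2 * pi * Q)) (Ck_add oT (Ck_mul oT (Ccst (3 / 2)) Cy)
  (Ck_mul oT (Ccst P) CF)).
have C2 := Ck_mul oT (Ccst (2 * pi * Q * sg)) (Ck_mul oT Cc Cy).
have C3 := Ck_opp oT (Ck_mul oT (Ccst (3 / 2 * k)) (Ck_mul oT Cs Cc)).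
have C4 := Ck_opp oT (Ck_mul oT (Ccst k) Cs).
have C5 := Ck_opp oT (Ck_mul oT (Ccst (sg * k)) (Ck_add oT (Ck_mul oT Cs (Ck_mul oT Cc Cc))
  (Ck_mul oT (Ccst (1 / 3)) (Ck_mul oT Cs (Ck_mul oT Cs Cs))))).
have Caction : Ck setT 1 torus_action.
  exact: Ck_add oT (Ck_add oT (Ck_add oT (Ck_add oT (Ck_add oT C1 C2) C3) Ct) C4) C5.
have C6 := Ck_mul oT (Ck_torus_area1 1) (Csc _ (Ck_torus_angle1 1)).
have C7 := Ck_mul oT (Ck_torus_area2 1) (Csc _ (Ck_torus_angle2 1)).
exact: Ck_mul oT (Ccst _) (Ck_add oT Caction (Ck_add oT C6 C7)).
Qed.

Lemma F_period (s : R) (m : int) : F (s + 2 * pi * m%:~R) = F s + 2 * h * m%:~R.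
Proof.
have nat_case (x : R) (n : nat) : F (x + 2 * pi * n%:R) = F x + 2 * h * n%:R.
  elim: n x => [|n IH] x; first by rewrite !mulr0 !addr0.
  have nE : n.+1%:R = n%:R + 1 :> R by rewrite natr1.
  rewrite nE mulrDr mulr1 addrA.
  have -> : x + 2 * pi * n%:R + 2 * pi = x + 2 * pi * n%:R + pi + pi by ring.
  by rewrite !Fpi IH; ring.
case: m => n; first exact: nat_case.
have := nat_case (s + 2 * pi * (Negz n)%:~R) n.+1.
rewrite NegzE mulrNz mulrN.
have -> : s - 2 * pi * n.+1%:~R + 2 * pi * n.+1%:R = s by rewrite subrK.
by move=> ->; rewrite mulrN addrK.
Qed.

(** A period of [s] adds [2 pi Q P (2 h) = 2 pi] to the action through [F], and a period of [t] adds
    [2 pi] through the term [u 0 1], which comes from the mean 1 of [A_2]. All other terms are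
    periodic. *)
Lemma torus_periodic u0 u : exists u', [/\ `|u' - u0| <= pi, torus u' = torus u &
  torus_primitive u' - torus_primitive u \is a Num.int].
Proof.
have [m Hm] := shift_near (u 0 0) (u0 0 0).
have [n Hn] := shift_near (u 0 1) (u0 0 1).
pose u' : 'rV[R]_2 := point2 (u 0 0 + 2 * pi * m%:~R) (u 0 1 + 2 * pi * n%:~R).
have u'0 : u' 0 0 = u 0 0 + 2 * pi * m%:~R by exact: point20.
have u'1 : u' 0 1 = u 0 1 + 2 * pi * n%:~R by exact: point21.
have [cm sm] := trig_period (u 0 0) m; have [cn sn] := trig_period (u 0 1) n.
have ex : curve_x e (u' 0 0) = curve_x e (u 0 0) by rewrite u'0 /curve_x cm.
have ey : curve_y e (u' 0 0) = curve_y e (u 0 0) by rewrite u'0 /curve_y sm.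
have ec : cos (u' 0 1) = cos (u 0 1) by rewrite u'1.
have es : sin (u' 0 1) = sin (u 0 1) by rewrite u'1.
have a1 : torus_area1 u' = torus_area1 u by rewrite /torus_area1 ex ec.
have a2 : torus_area2 u' = torus_area2 u by rewrite /torus_area2 ex ey ec es.
have g1 : torus_angle1 u' = torus_angle1 u by rewrite /torus_angle1 ey ec es.
exists u'; split.
- have -> : u' - u0 = point2 (u' 0 0 - u0 0 0) (u' 0 1 - u0 0 1).
    rewrite [LHS]point2E !point2_scale point2_add !mxE /=.
    by congr point2; ring.
  by apply: norm_point2; rewrite ?u'0 ?u'1.
- by apply: eq_bipolar; rewrite ?g1 ?a1 ?a2 // /torus_angle2 ?ec ?es.
- have -> : torus_primitive u' - torus_primitive u = m%:~R + n%:~R.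
    rewrite /torus_primitive /torus_action g1 a1 a2 /torus_angle2 ey ec es u'0 u'1 F_period.
    rewrite -mulrBr.
    set T1 := torus_area1 u * _; set T2 := torus_area2 u * _.
    have pp : 2 * pi != 0 :> R by rewrite mulf_neq0// gt_eqF.
    apply: (mulfI pp); rewrite mulVKf//.
    have mE : m%:~R = Q * P * (2 * h) * m%:~R :> R by rewrite QPh mul1r.
    rewrite [X in _ = 2 * pi * (X + _)]mE.
    move: T1 T2 (F _) (curve_y _ _) (cos _) (sin _) pi => *; ring.
  by apply: rpredD; exact: intr_int.
Qed.

(** The second angle returns [t]. For equal [t] the first angles differ by less than [4 pi Q], which
    is less than [2 pi], so they are equal as real numbers and not merely modulo [2 pi]. The point
    of the rounded square is then known, and with it [s]. *)
Lemma torus_embedding u u' : torus u = torus u' -> `|u - u'| < 2 * pi -> u = u'.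
Proof.
move=> E uu'; have d0 : `|u 0 0 - u' 0 0| < 2 * pi.
  by apply: le_lt_trans uu'; have := norm_coord (u - u') 0; rewrite !mxE.
have d1 : `|u 0 1 - u' 0 1| < 2 * pi.
  by apply: le_lt_trans uu'; have := norm_coord (u - u') 1; rewrite !mxE.
have [[a1 c1 s1] [_ c2 s2]] :=
  bipolar_inj torus_area1_gt0 torus_area2_gt0 E.
have E1 := trig_inj c2 s2 d1; rewrite /torus_angle2 in E1.
have xx : curve_x e (u 0 0) = curve_x e (u' 0 0).
  move: a1; rewrite /torus_area1 E1 => /addIr /addrI.
  exact: (mulfI (lt0r_neq0 P0)).
have pQ : 0 < 2 * pi * Q by rewrite !mulr_gt0.
have yy : curve_y e (u 0 0) = curve_y e (u' 0 0).
  have : torus_angle1 u = torus_angle1 u'.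
    apply: trig_inj => //; rewrite /torus_angle1 E1.
    have [_ /andP[y1 y2]] := curve_bounds (u 0 0).
    have [_ /andP[y1' y2']] := curve_bounds (u' 0 0).
    have -> (x y z : R) : x - z - (y - z) = x - y by ring.
    rewrite -mulrBr normrM (gtr0_norm pQ).
    apply: (@lt_trans _ _ (2 * pi * Q * 2)).
      by rewrite ltr_pM2l// ltr_norml; apply/andP; split; lra.
    rewrite -mulrA gtr_pMr ?mulr_gt0//; params_lra.
  rewrite /torus_angle1 E1 => /addIr; exact: (mulfI (lt0r_neq0 pQ)).
have E0 : u 0 0 = u' 0 0.
  by apply: trig_inj d0; [exact: soft_sign_inj xx|exact: soft_sign_inj yy].
by rewrite [u]point2E [u']point2E E0 E1.
Qed.

Lemma integral_lagrangian_torus (X : set 'rV[R]_4) : range torus `<=` X ->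
  integral_lagrangian X (range torus).
Proof.
exact: (torus_integral_lagrangian p0 Ck_torus Ck_torus_primitive torus_immersion
  torus_periodic torus_embedding torus_primitive_liouville torus_isotropic).
Qed.

(* On [A1 = 2] the cosine of the second angle exceeds -1/10 and [A2 < 1]; on
   [A1 = 1] it is below 1/10 and [A2 > 1]. *)
Lemma torus_avoids u : P < 1 / 2 + sg / 10 -> torus_area2 u = 1 ->
  torus_area1 u <> 1 /\ torus_area1 u <> 2.
Proof.
move=> Psg; rewrite /torus_area1 /torus_area2.
have [/andP[x1 x2] /andP[y1 y2]] := curve_bounds (u 0 0).
have cs := cos2Dsin2 (u 0 1).
have c1 := cos_geN1 (u 0 1); have c2 := cos_le1 (u 0 1).
have hx1 : P * curve_x e (u 0 0) < P * 1 by rewrite ltr_pM2l.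
have hx2 : P * (-1) < P * curve_x e (u 0 0) by rewrite ltr_pM2l.
have : `|2 * pi * sg * Q * (sin (u 0 1) * curve_y e (u 0 0))| <= k / 4.
  have /andP[q0 q1] := sQ_bound.
  rewrite normrM (ger0_norm q0); apply: le_trans q1; rewrite ler_piMr//.
  by rewrite normrM mulr_ile1 ?sin_max// ltW// ltr_norml y1.
rewrite ler_norml => /andP[].
have -> : cos (u 0 1) * cos (u 0 1) - sin (u 0 1) * sin (u 0 1) = 2 * cos (u 0 1) ^+ 2 - 1.
  by rewrite -!expr2 sin2cos2; ring.
move: (2 * pi * sg * Q * _) => z.
move: (P * curve_x e (u 0 0)) hx1 hx2 => x hx1 hx2.
move: (cos (u 0 1)) c1 c2 {cs y1 y2 x1 x2} => c c1 c2 z1 z2 E2.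
have sg0 : 0 < sg by rewrite sgE divr_gt0.
(* [A_2 = 1] balances the two terms of order [k] against the translation term [z], which is at most
   [k / 4]. Dividing by [k] leaves an inequality in [c] and [x] alone, contradicted at both ends. *)
have {z z1 z2 E2} [F1 F2] : - (1 / 4) <= - c + (2 * c ^+ 2 - 1) * x /\
    - c + (2 * c ^+ 2 - 1) * x <= 1 / 4.
  have zE : z = k * (- c + (2 * c ^+ 2 - 1) * x).
    by move: E2; params_lra.
  by split; rewrite -(ler_pM2l k0) -zE; params_lra.
have sg1 : sg <= 1 / 64 by rewrite sgE; params_lra.
have bound (y : R) : -1 <= y <= 1 -> - (1 / 64) <= sg * y <= 1 / 64.
  move=> /andP[y1 y2].
  have h1 : sg * y <= sg * 1 by rewrite ler_pM2l.
  have h2 : sg * (-1) <= sg * y by rewrite ler_pM2l.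
  by apply/andP; split; lra.
have cc1 : 0 <= c ^+ 2 <= 1 by apply/andP; split; nra.
have /andP[g1 g2] : - (1 / 64) <= sg * (c * (2 * c ^+ 2 - 1)) <= 1 / 64.
  by apply: bound; nra.
split=> E1.
(* On [A_1 = 1] one has [- 1 / 2 - sg * c = x > - P > - 1 / 2 - sg / 10]. *)
- have cu : c < 1 / 10 by rewrite -(ltr_pM2l sg0); lra.
  have xE : x = - (1 / 2) - sg * c by lra.
  have {F1 F2 hx1 hx2} F2 : - c + (2 * c ^+ 2 - 1) * x <= 1 / 4 by [].
  have E : (2 * c ^+ 2 - 1) * x = - c ^+ 2 + 1 / 2 - sg * (c * (2 * c ^+ 2 - 1)).
    by rewrite xE; field.
  (* Up to [1 / 64], the left side of [F2] is [1 / 2 - c - c ^+ 2]. It is concave in [c], with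
     values [1 / 2] at -1 and [39 / 100] at [1 / 10], hence stays above [1 / 4 + 1 / 64]. The case
     [A_1 = 2] is the mirror image under a change of sign of [c]. *)
  by rewrite E in F2; nra.
- have cu : - (1 / 10) < c by rewrite -(ltr_pM2l sg0); lra.
  have xE : x = 1 / 2 - sg * c by lra.
  have {F1 F2 hx1 hx2} F1 : - (1 / 4) <= - c + (2 * c ^+ 2 - 1) * x by [].
  have E : (2 * c ^+ 2 - 1) * x = c ^+ 2 - 1 / 2 - sg * (c * (2 * c ^+ 2 - 1)).
    by rewrite xE; field.
  by rewrite E in F1; nra.
Qed.

End Torus.

(** * Choice of the parameters *)

Theorem mainTheorem1 (R : realType) (a b : R) (ha : 2 < a) (hb : 1 < b) :
  ~ maximal_integral_packing a b /\
  exists L : set 'rV[R]_4,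
    integral_lagrangian (polydisk a b) L /\
    forall m n : nat, (0 < m)%N -> (0 < n)%N -> m%:R < a -> n%:R < b ->
      L `&` product_torus (m%:R : R) n%:R = set0.
Proof.
suff HL : exists L : set 'rV[R]_4, integral_lagrangian (polydisk a b) L /\
    forall m n : nat, (0 < m)%N -> (0 < n)%N -> m%:R < a -> n%:R < b ->
      L `&` product_torus (m%:R : R) n%:R = set0.
  split => // maxP; have [L [intL disjL]] := HL.
  have [m [n [m0 n0 ma nb [z zL]]]] := maxP L intL.
  by have := disjL m n m0 n0 ma nb => /seteqP[/(_ z zL)].
have [d [d0 d1 da db]] : exists d : R, [/\ 0 < d, d <= 1, 2 + d <= a & 1 + d <= b].
  exists (Num.min (Num.min (a - 2) (b - 1)) 1); split.
  - by rewrite !lt_min !subr_gt0 ha hb ltr01.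
  - by rewrite ge_min lexx orbT.
  - by rewrite addrC -lerBrDr !ge_min lexx.
  - by rewrite addrC -lerBrDr !ge_min lexx !orbT.
(* The excess of [A_2] over 1 is at most [9 / 4 * k], and that of [A_1] over 2 is below
   [sg / 20 + sg]; both are smaller than [d]. The value of [P] lies below the threshold
   [1 / 2 + sg / 10] of [torus_avoids]. With this [e] one has [1 + 2 * e = 1 + sg / 20], less than
   [2 * P = 1 + sg / 10]: the extra length outweighs the rounded corners, which gives [1 < P * h],
   equivalently [Q < 1 / 2]. *)
pose k := d / 4; pose sg := k / 16; pose e := sg / 40; pose P := 1 / 2 + sg / 20.
have kE : k = d / 4 by []. have sE : sg = k / 16 by [].
have eE : e = sg / 40 by []. have PE : P = 1 / 2 + sg / 20 by [].
clearbody P e sg k.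
have e0 : 0 < e by lra.
have [F [h [dF Fpi hle]]] := curve_area e0.
have e2 : 0 < 1 + 2 * e by lra.
have P0 : 0 < P by lra.
have Ph : 1 < P * h.
  have h1 : P * (2 / (1 + 2 * e)) <= P * h by rewrite ler_pM2l.
  apply: lt_le_trans h1; rewrite mulrA ltr_pdivlMr//; lra.
have Ph0 : 0 < P * (2 * h) by lra.
pose Q := (P * (2 * h))^-1.
have QPh : Q * P * (2 * h) = 1 by rewrite -mulrA mulVf// gt_eqF.
have Q0 : 0 < Q by rewrite invr_gt0.
have Q1 : Q < 1 / 2.
  by rewrite div1r ltf_pV2 ?posrE//; lra.
have k0 : 0 < k by lra.
have k1 : k <= 1 / 4 by lra.
have P1 : P <= 1 by lra.
exists (range (torus e P Q k sg)).
have areaE u : area1 (torus e P Q k sg u) = torus_area1 e P sg u /\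
    area2 (torus e P Q k sg u) = torus_area2 e P Q k sg u.
  apply: bipolar_area => w.
    exact: (torus_area1_gt0 e0 P0 P1 Q0 Q1 k0 k1 sE w).
  exact: (torus_area2_gt0 e0 P0 P1 Q0 Q1 k0 k1 sE w).
have b1 u : torus_area1 e P sg u < 2 + d.
  by have /andP[_] := torus_area1_bounds e0 P0 P1 Q0 Q1 k0 k1 sE u; lra.
have b2 u : torus_area2 e P Q k sg u < 1 + d.
  by have /andP[_] := torus_area2_bounds e0 P0 P1 Q0 Q1 k0 k1 sE u; lra.
split.
  apply: (integral_lagrangian_torus e0 P0 P1 Q0 Q1 k0 k1 sE dF Fpi QPh) => z [u _ <-].
  have [E1 E2] := areaE u; split; rewrite ?E1 ?E2.
    by apply: lt_le_trans da; exact: b1.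
  by apply: lt_le_trans db; exact: b2.
move=> m n m0 n0 _ _; apply/seteqP; split => // z [[u _ <-] [zm zn]].
have [E1 E2] := areaE u; rewrite E1 in zm; rewrite E2 in zn.
(* Since [d <= 1], the torus stays in [A_1 < 3] and [A_2 < 2]. The bounds [a] and [b] may be large,
   but only [n = 1] with [m = 1] or [m = 2] can be met. *)
have n1 : n = 1%N.
  have : (n%:R : R) < 2%:R by rewrite -zn; have := b2 u; lra.
  by rewrite ltr_nat; case: n n0 {zn} => // -[].
have m2 : (m < 3)%N.
  by rewrite -(ltr_nat R) -zm; have := b1 u; lra.
have Psg : P < 1 / 2 + sg / 10 by lra.
rewrite n1 in zn.
have [] := torus_avoids e0 P0 P1 Q0 Q1 k0 k1 sE Psg zn; rewrite zm.
by case: m m0 m2 {zm} => // -[|[|]].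
Qed.
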